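(* Let $r\in(0,1/2)$, let $h\geq1$ be an integer, let $f_{\min}>0$, and let $f$ be a spectral density satisfying $f\geq f_{\min}$ on $[-\pi,\pi]$. For $\varepsilon>0$ set $$f_\pm(\lambda)=f(\lambda)\pm\frac{\varepsilon}{\pi}\cos(h\lambda),\qquad\lambda\in[-\pi,\pi].$$ Then $f_+$ and $f_-$ are spectral densities for every $\varepsilon\in(0,\pi f_{\min}]$, and there exists a constant $c_{r,f_{\min}}\in(0,\pi f_{\min}]$, depending only on $(r,f_{\min})$, such that, for every integer $N\geq h+1$ and every real $\alpha>0$, $$\inf_{K_{1:N}\in\mathcal M_\alpha^N}\ \inf_{\phi\in\mathcal E_{[0,1]}(K_{1:N})}\ \mathcal T_{N,\alpha}\bigl(\phi,f,\varepsilon_{\mathrm{low}},K_{1:N}\bigr)\ \geq\ r,$$ where $\varepsilon_{\mathrm{low}}=c_{r,f_{\min}}\left(1\wedge\left[(\alpha^4\wedge1)(N-h)\right]^{-1/2}\right)$.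
   Context: Notation: $u\wedge v=\min\{u,v\}$. A spectral density is a nonnegative, integrable, even function $f$ on $[-\pi,\pi]$. A centered real-valued stationary Gaussian process $X=(X_t)_{t\in\mathbb Z}$ has spectral density $f$ if $\operatorname{Cov}(X_0,X_k)=\int_{-\pi}^{\pi}f(\lambda)e^{ik\lambda}\,d\lambda$ for all $k\in\mathbb Z$. $\mathcal M_\alpha$ is the class of all Markov kernels $K$ from $\mathbb R$ to an arbitrary standard Borel space such that $K(S\mid x)\le e^\alpha K(S\mid x')$ for all $x,x'\in\mathbb R$ and all measurable $S$ in the output space of $K$. $\mathcal M_\alpha^N$ is the set of tuples $K_{1:N}=(K_1,\dots,K_N)$ with each $K_i\in\mathcal M_\alpha$; the output space of $K_{1:N}$ is the product of the output spaces of the $K_i$. For a spectral density $g$ and $K_{1:N}\in\mathcal M_\alpha^N$, $\mathbb E_{g,K_{1:N}}$ is expectation under the joint law of $(X,Z)$, where $X$ is a centered real stationary Gaussian process with spectral density $g$ and $Z=(Z_1,\dots,Z_N)$ is such that, conditionally on $X$, the $Z_i$ are independent with $Z_i\sim K_i(\cdot\mid X_i)$. $\mathcal E_{[0,1]}(K_{1:N})$ is the set of measurable functions from the output space of $K_{1:N}$ to $[0,1]$ (randomized tests of $f_-$ against $f_+$). The maximal testing risk of $\phi$ at separation $\varepsilon$ is $$\mathcal T_{N,\alpha}(\phi,f,\varepsilon,K_{1:N})=\max\left(\mathbb E_{f_-,K_{1:N}}[\phi(Z)],\ \mathbb E_{f_+,K_{1:N}}[1-\phi(Z)]\right),$$ with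 $f_\pm$ defined from $f$, $h$ and this $\varepsilon$. *)

(* Defs.v *)
From HB Require Import structures.
From mathcomp Require Import all_boot all_order all_algebra.
From mathcomp Require Import all_classical all_reals all_analysis.

Set Implicit Arguments.
Unset Strict Implicit.
Unset Printing Implicit Defensive.

Import Order.TTheory GRing.Theory Num.Theory.
Import numFieldNormedType.Exports.

Local Open Scope classical_set_scope.
Local Open Scope ring_scope.

Section spectral_density.
Context {R : realType}.

(* Only the values of [f] on [-pi, pi] are constrained and used. *)
Definition spectral_density (f : R -> R) : Prop :=
  [/\ forall x, x \in `[- pi, pi] -> 0 <= f x,
      (@lebesgue_measure R).-integrable `[- pi, pi] (EFin \o f)
    & forall x, x \in `[- pi, pi] -> f (- x) = f x].

Definition f_plus (f : R -> R) (h : nat) (eps : R) : R -> R :=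
  fun x => f x + eps / pi * cos (h%:R * x).

Definition f_minus (f : R -> R) (h : nat) (eps : R) : R -> R :=
  fun x => f x - eps / pi * cos (h%:R * x).

End spectral_density.

Section gaussian.
Context {R : realType}.

(* As [normal_prob 0 1] has the density of N(0,1); taking some [B j] to be
   [setT], the product rule over all indices yields that of any subfamily. *)
Definition iid_standard_normal d (W : measurableType d) (Q : probability W R)
    m (xi : 'I_m -> {RV Q >-> R}) : Prop :=
  (forall j, forall B : set R, measurable B ->
     Q (xi j @^-1` B) = normal_prob 0 1 B) /\
  (forall B : 'I_m -> set R, (forall j, measurable (B j)) ->
     Q (\bigcap_(j in [set: 'I_m]) (xi j @^-1` B j)) =
     (\prod_(j < m) Q (xi j @^-1` B j))%E).

(* [Y] is multivariate normal, possibly degenerate: it has the law of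
   [b + A xi] for some i.i.d. standard normal variables [xi].  Laws on R^n are
   compared on rectangles, which determine them. *)
Definition multivariate_normal d (T : measurableType d) (P : probability T R)
    n (Y : 'I_n -> {RV P >-> R}) : Prop :=
  exists m (b : 'cV[R]_n) (A : 'M[R]_(n, m))
    d' (W : measurableType d') (Q : probability W R)
    (xi : 'I_m -> {RV Q >-> R}),
    iid_standard_normal xi /\
    forall B : 'I_n -> set R, (forall i, measurable (B i)) ->
      P (\bigcap_(i in [set: 'I_n]) (Y i @^-1` B i)) =
      Q [set w | forall i, B i (b i ord0 + \sum_(j < m) A i j * xi j w)].

Context d (T : measurableType d) (P : probability T R)
  (X : int -> {RV P >-> R}).

Definition gaussian_process : Prop :=
  forall n (t : 'I_n -> int), multivariate_normal (fun i => X (t i)).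

Definition centered : Prop := forall t, 'E_P[X t]%E = 0%E.

Definition stationary : Prop :=
  forall n (t : 'I_n -> int) (k : int) (B : 'I_n -> set R),
    (forall i, measurable (B i)) ->
    P (\bigcap_(i in [set: 'I_n]) (X (t i + k) @^-1` B i)) =
    P (\bigcap_(i in [set: 'I_n]) (X (t i) @^-1` B i)).

(* Real and imaginary parts of
   Cov(X_0, X_k) = \int_[-pi, pi] g(x) exp(i k x) dx. *)
Definition has_spectral_density (g : R -> R) : Prop :=
  forall k : int,
    covariance P (X 0) (X k) =
      (\int[@lebesgue_measure R]_(x in `[- pi, pi]) (g x * cos (k%:~R * x)))%:E
    /\ \int[@lebesgue_measure R]_(x in `[- pi, pi]) (g x * sin (k%:~R * x)) = 0.

Definition sigma_process : set (set T) :=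
  <<s \bigcup_t preimage_set_system setT (X t) measurable >>.

End gaussian.

Section standard_borel.
Context (R : realType).

(* [T] is isomorphic, as a measurable space, to a separable complete metric
   space with its Borel sigma-algebra. *)
Definition standard_borel d (T : measurableType d) : Prop :=
  exists (U : completePseudoMetricType R) (g : T -> U),
    [/\ hausdorff_space U,
        exists2 D : set U, countable D & dense D,
        bijective g
      & forall A : set T,
          measurable A <-> exists2 B : set U, <<s open >> B & A = g @^-1` B].

End standard_borel.

Section privacy.
Context {R : realType}.

Definition private_kernel (alpha : R) d (Y : measurableType d)
    (K : R.-pker (measurableTypeR R) ~> Y) : Prop :=
  forall (x x' : R) (S : set Y), measurable S ->
    (K x S <= (expR alpha)%:E * K x' S)%E.

(* Each of the N mechanisms has an output space of its own. *)
Record mechanisms (N : nat) (alpha : R) := Mechanisms {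
  out_display : 'I_N -> measure_display;
  out : forall i, measurableType (out_display i);
  mech : forall i, R.-pker (measurableTypeR R) ~> out i;
  out_standard : forall i, standard_borel R (out i);
  mech_private : forall i, private_kernel alpha (mech i)
}.

Context (N : nat) (alpha : R) (K : mechanisms N alpha).

Definition cylinders : set (set (forall i, out K i)) :=
  \bigcup_i preimage_set_system setT (fun z : forall i, out K i => z i)
              measurable.

Definition output_space : measurableType cylinders.-sigma :=
  g_sigma_algebraType cylinders.

Definition randomized_test : set (output_space -> R) :=
  [set phi : output_space -> R |
     measurable_fun setT phi /\ forall z, 0 <= phi z <= 1].

(* Conditionally on the whole process [X], the [Z_i] are independent with
   Z_i ~ K_i(. | X_i).  The index [i] starts at 0 here, hence the shift. *)
Definition privatized_view d (T : measurableType d) (P : probability T R)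
    (X : int -> {RV P >-> R}) (Z : {RV P >-> output_space}) : Prop :=
  forall (B : set T) (S : forall i, set (out K i)),
    sigma_process X B -> (forall i, measurable (S i)) ->
    P (B `&` [set w | forall i, S i (Z w i)]) =
    (\int[P]_(w in B) \prod_(i < N) mech K i (X i.+1%:Z w) (S i))%E.

(* E_{g,K}[psi(Z)].  The law of (X, Z), hence the expectation, is the same for
   all realizations (X, Z) on all probability spaces, and realizations exist
   when [g] is a spectral density, so that the infimum below is their common
   value. *)
Definition model_expectation (g : R -> R) (psi : output_space -> R) : \bar R :=
  ereal_inf [set e | exists d (T : measurableType d) (P : probability T R)
      (X : int -> {RV P >-> R}) (Z : {RV P >-> output_space}),
    [/\ gaussian_process X, centered X, stationary X
      & has_spectral_density X g] /\
    privatized_view X Z /\ e = 'E_P[psi \o Z]%E].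

Definition testing_risk (f : R -> R) (h : nat) (eps : R)
    (phi : output_space -> R) : \bar R :=
  maxe (model_expectation (f_minus f h eps) phi)
       (model_expectation (f_plus f h eps) (fun z => 1 - phi z)).

End privacy.

Arguments randomized_test {R N alpha} K _.
Arguments model_expectation {R N alpha} K g psi.
Arguments testing_risk {R N alpha} K f h eps phi.

Definition eps_low {R : realType} (c alpha : R) (N h : nat) : R :=
  c * Num.min 1 ((Num.min (alpha ^+ 4) 1 * (N - h)%:R) `^ (- 2^-1)).

(* Main.v *)
From HB Require Import structures.
Require Import Defs.
From mathcomp Require Import all_boot all_order all_algebra.
From mathcomp Require Import all_classical all_reals all_analysis measurable_realfun.
From mathcomp Require Import ring lra.
Import Order.TTheory GRing.Theory Num.Theory.
Import numFieldNormedType.Exports.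
Local Open Scope classical_set_scope.
Local Open Scope ring_scope.

Set Implicit Arguments.
Unset Strict Implicit.
Unset Printing Implicit Defensive.

(** The law of the privatized data depends on the spectral density only through
    the covariance matrix of (X_1, ..., X_N), and f_+ and f_- change it by
    [+ eps] and [- eps] at lag [h] only.  As f >= fmin, the covariance matrix
    of [f] is at least 2 pi fmin times the identity.  With a = 2 pi fmin / 3 and
    rho = eps / a, this leaves room to write X as the sum of a Gaussian vector
    that is the same for both signs and of independent Gaussian pairs, one for
    each edge (i, i + h), with quadratic form
    a (u_i^2 +- 2 rho u_i u_(i+h) + (1 + rho^2) u_(i+h)^2).  The edges split into
    two matchings, whose signs are flipped one after the other.  Given all the
    rest, a matching is a family of independent pairs, and the privatized views
    of one pair under the two signs have Hellinger affinity at least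
    1 - C min(alpha^4, 1) rho^2: the marginals being equal, only the product of
    the oscillations of two channels, each of order alpha, sees the sign.
    Tensorization bounds the difference of the probabilities of any event, first
    for finitely many outcomes, then by a monotone class argument, and the layer
    cake formula extends the bound to randomized tests. *)

(** * The standard normal law *)

(** The obstacle is the dependence along the chains i, i + h, i + 2h, ..., because of which neither
    law of the observations is a product. Splitting the Gaussian vector replaces the chains by
    independent pairs, and conditioning on all but one matching makes these pairs disjoint. Up to
    scale a pair is (x, y + rho x), with x and y independent standard normals: this shear explains
    the asymmetric quadratic form, and it is chosen because its density is elementary and both of
    its marginals are unchanged when rho becomes - rho.

    Gaussian vectors are kept as lists of columns, one per independent standard normal, and
    expectations as iterated integrals: conditioning on some of the columns then only moves the base
    point of the remaining integral. That two lists with the same covariance have the same law is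
    needed to insert the pairs and to reorder the matchings; it is derived from rotation invariance
    in the plane. The variance of a standard normal is carried along as a constant. *)

Section density.
Local Open Scope ereal_scope.
Context d (T : measurableType d) (R : realType).
Variables (mu nu : {measure set T -> \bar R}) (g : T -> R).
Hypotheses (mg : measurable_fun setT g) (g0 : forall x, (0 <= g x)%R).
Hypothesis nuE : forall A, measurable A -> nu A = \int[mu]_(x in A) (g x)%:E.
Import HBNNSimple.

Let density_nnsfun (f : {nnsfun T >-> R}) :
  \int[nu]_x (f x)%:E = \int[mu]_x ((f x)%:E * (g x)%:E).
Proof.
under [LHS]eq_integral do rewrite fimfunE -fsumEFin//.
rewrite [LHS]ge0_integral_fsum//; last 2 first.
  - by move=> r; exact/measurable_EFinP/measurableT_comp.
  - by move=> n x _; rewrite EFinM nnfun_muleindic_ge0.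
under [RHS]eq_integral.
  move=> x xD; rewrite fimfunE -fsumEFin// muleC ge0_mule_fsumr; last first.
    by move=> r; rewrite EFinM nnfun_muleindic_ge0.
  over.
rewrite [RHS]ge0_integral_fsum//; last 2 first.
  - move=> r; apply: emeasurable_funM; first exact/measurable_EFinP.
    by apply/measurable_EFinP; do 2 apply/measurableT_comp => //.
  - move=> n x _; rewrite EFinM mule_ge0//; last by rewrite nnfun_muleindic_ge0.
    by rewrite lee_fin.
apply: eq_fsbigr => r rf.
have r0 : (0 <= r)%R by move: rf; rewrite inE => -[x _ <-].
under eq_integral do rewrite EFinM.
rewrite ge0_integralZl//; last exact/measurable_EFinP/measurable_indic.
under [RHS]eq_integral do rewrite EFinM muleCA.
rewrite ge0_integralZl//.
- rewrite integral_indic// setIT nuE// [in LHS]integral_mkcond.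
  congr (_ * _); apply: eq_integral => x _; rewrite patchE indicE.
  by case: ifPn => _; rewrite ?mule1 ?mule0.
- apply: emeasurable_funM; first exact/measurable_EFinP.
  exact/measurable_EFinP/measurable_indic.
- by move=> x _; rewrite mule_ge0 ?lee_fin.
Qed.

Lemma ge0_integral_density (f : T -> \bar R) :
  measurable_fun setT f -> (forall x, 0 <= f x) ->
  \int[nu]_x f x = \int[mu]_x (f x * (g x)%:E).
Proof.
move=> mf f0; pose f_ := nnsfun_approx measurableT mf.
transitivity (lim (\int[nu]_x (f_ n x)%:E @[n --> \oo])).
  rewrite -monotone_convergence//=.
  - apply: eq_integral => ? /[!inE] xD; apply/esym/cvg_lim => //=.
    exact: cvg_nnsfun_approx.
  - by move=> n; exact/measurable_EFinP/measurable_funTS.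
  - by move=> n ? _; rewrite lee_fin.
  - by move=> ? _ ? ? mn; rewrite lee_fin; exact/lefP/nd_nnsfun_approx.
under eq_fun do rewrite density_nnsfun.
rewrite -monotone_convergence//=.
- apply: eq_integral => x _; apply/cvg_lim => //.
  apply: cvgeZr => //; exact: cvg_nnsfun_approx.
- by move=> n; apply: emeasurable_funM; exact/measurable_EFinP.
- by move=> n x _; rewrite mule_ge0 ?lee_fin.
- move=> x _ m n mn; rewrite lee_wpmul2r ?lee_fin//.
  exact/lefP/nd_nnsfun_approx.
Qed.

End density.

Section gauss1d.
Context {R : realType}.
Local Open Scope ereal_scope.
Local Notation leb := (@lebesgue_measure R).

Definition gam : probability (measurableTypeR R) R := normal_prob (0 : R) 1.

(** The image of Lebesgue measure under a translation gives half-open intervals their length, which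
    characterizes Lebesgue measure. *)
Lemma ge0_integral_lebesgue_shift (c : R) (f : R -> \bar R) :
  measurable_fun setT f -> (forall x, 0 <= f x) ->
  \int[leb]_x f (x + c)%R = \int[leb]_x f x.
Proof.
move=> mf f0.
pose s := (fun x : R => (x + c)%R) : measurableTypeR R -> measurableTypeR R.
have ms : measurable_fun setT s by exact: measurable_funD.
have := @ge0_integral_pushforward _ _ _ _ _ _ ms leb setT f measurableT mf.
rewrite preimage_setT => <-; last by move=> x _; exact: f0.
apply: eq_measure_integral => A mA _; apply/esym.
apply: (@lebesgue_measure_unique _ (pushforward leb s)) => //.
move=> _ [[a b]] _ <-.
transitivity (leb `](a - c)%R, (b - c)%R]%classic); last first.
  congr (leb _).
  by apply/seteqP; split => x /=; rewrite !in_itv/= ltrBlDr lerBrDr.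
rewrite /= !lebesgue_measure_itv/= !lte_fin ltrD2r.
case: ifP => // _; by rewrite -!EFinB; congr EFin; ring.
Qed.

Lemma ge0_integral_lebesgueN (f : R -> \bar R) :
  measurable_fun setT f -> (forall x, 0 <= f x) ->
  \int[leb]_x f (- x)%R = \int[leb]_x f x.
Proof.
move=> mf f0.
pose s := -%R : measurableTypeR R -> measurableTypeR R.
have ms : measurable_fun setT s by exact: oppr_measurable.
have := @ge0_integral_pushforward _ _ _ _ _ _ ms leb setT f measurableT mf.
rewrite preimage_setT => <-; last by move=> x _; exact: f0.
apply: eq_measure_integral => A mA _; exact: lebesgue_measureN.
Qed.

Lemma ge0_integral_gam (f : R -> \bar R) :
  measurable_fun setT f -> (forall x, 0 <= f x) ->
  \int[gam]_x f x = \int[leb]_x (f x * (normal_pdf 0 1 x)%:E).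
Proof.
move=> mf f0; apply: ge0_integral_density => //.
  exact: measurable_normal_pdf.
exact: normal_pdf_ge0.
Qed.

Lemma normal_pdf01E (x : R) :
  normal_pdf 0 1 x = (normal_peak 1 * expR (- x ^+ 2 / 2))%R.
Proof.
by rewrite normal_pdfE ?oner_neq0//= /normal_fun subr0 expr1n.
Qed.

(** Cameron-Martin formula, by completing the square in the density. It yields both the density of a
    correlated pair and the exponential moments. *)
Lemma gam_shift (c : R) (f : R -> \bar R) :
  measurable_fun setT f -> (forall x, 0 <= f x) ->
  \int[gam]_x f (x + c)%R =
  \int[gam]_x (f x * (expR (c * x - c ^+ 2 / 2))%:E).
Proof.
move=> mf f0.
have mfe : measurable_fun setT (fun x => f x * (expR (c * x - c ^+ 2 / 2))%:E).
  apply: emeasurable_funM => //; apply/measurable_EFinP.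
  apply: measurableT_comp => //; apply: measurable_funB => //.
rewrite ge0_integral_gam//; last first.
  by apply: measurableT_comp => //; exact: measurable_funD.
rewrite ge0_integral_gam//; last by move=> x; rewrite mule_ge0// lee_fin expR_ge0.
rewrite -(@ge0_integral_lebesgue_shift c (fun x =>
   f x * (expR (c * x - c ^+ 2 / 2))%:E * (normal_pdf 0 1 x)%:E)).
- apply: eq_integral => x _; rewrite -muleA -EFinM !normal_pdf01E mulrCA -expRD.
  by do 4 congr (_ _); field.
- apply: emeasurable_funM => //; apply/measurable_EFinP.
  exact: measurable_normal_pdf.
- move=> x; rewrite !mule_ge0// lee_fin ?expR_ge0//; exact: normal_pdf_ge0.
Qed.

Lemma gamN (f : R -> \bar R) :
  measurable_fun setT f -> (forall x, 0 <= f x) ->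
  \int[gam]_x f (- x)%R = \int[gam]_x f x.
Proof.
move=> mf f0.
rewrite ge0_integral_gam//; last exact: measurableT_comp.
rewrite ge0_integral_gam//.
rewrite -(@ge0_integral_lebesgueN (fun x => f x * (normal_pdf 0 1 x)%:E)).
- by apply: eq_integral => x _; rewrite !normal_pdf01E sqrrN.
- apply: emeasurable_funM => //; apply/measurable_EFinP.
  exact: measurable_normal_pdf.
- move=> x; rewrite !mule_ge0// lee_fin; exact: normal_pdf_ge0.
Qed.

End gauss1d.

(** * Rotation invariance of the standard normal law of the plane *)

Section gauss2d.
Context {R : realType}.
Local Open Scope ereal_scope.
Local Notation leb := (@lebesgue_measure R).
Implicit Types K H : R * R -> \bar R.

Let leb_shearx (t : R) K : measurable_fun setT K -> (forall p, 0 <= K p) ->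
  \int[leb]_x \int[leb]_y K ((x + t * y)%R, y) = \int[leb]_x \int[leb]_y K (x, y).
Proof.
move=> mK K0.
rewrite (@fubini_tonelli _ _ _ _ _ leb leb (fun p => K ((p.1 + t * p.2)%R, p.2)))//.
  rewrite (@fubini_tonelli _ _ _ _ _ leb leb K)//.
  apply: eq_integral => y _.
  apply: (@ge0_integral_lebesgue_shift _ (t * y) (fun x => K (x, y))) => //.
  exact: measurableT_comp.
apply: measurableT_comp => //; apply: measurable_fun_pair => //.
by apply: measurable_funD => //; exact: measurable_funM.
Qed.

Let leb_sheary (t : R) K : measurable_fun setT K -> (forall p, 0 <= K p) ->
  \int[leb]_x \int[leb]_y K (x, (y + t * x)%R) = \int[leb]_x \int[leb]_y K (x, y).
Proof.
move=> mK K0; apply: eq_integral => x _.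
apply: (@ge0_integral_lebesgue_shift _ (t * x) (fun y => K (x, y))) => //.
exact: measurableT_comp.
Qed.

(* A rotation by an angle other than pi is a product of three shears. *)
Let leb_rotation (c s : R) K : (0 <= c)%R -> (c ^+ 2 + s ^+ 2 = 1)%R ->
  measurable_fun setT K -> (forall p, 0 <= K p) ->
  \int[leb]_x \int[leb]_y K ((c * x - s * y)%R, (s * x + c * y)%R) =
  \int[leb]_x \int[leb]_y K (x, y).
Proof.
(* The tangent of the half-angle: the shears have slopes [- t], [s] and [- t], and [0 <= c] keeps
   the denominator away from zero. *)
move=> c0 cs mK K0; pose t := (s / (1 + c))%R.
have c1 : (1 + c != 0)%R by rewrite gt_eqF// ltr_pwDl.
have mKx u : measurable_fun setT (fun p : R * R => K ((p.1 + u * p.2)%R, p.2)).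
  apply: measurableT_comp => //; apply: measurable_fun_pair => //.
  by apply: measurable_funD => //; exact: measurable_funM.
have mKyx u w : measurable_fun setT
    (fun p : R * R => K ((p.1 + u * (p.2 + w * p.1))%R, (p.2 + w * p.1)%R)).
  apply: measurableT_comp => //; apply: measurable_fun_pair => //.
    apply: measurable_funD => //; apply: measurable_funM => //.
    by apply: measurable_funD => //; exact: measurable_funM.
  by apply: measurable_funD => //; exact: measurable_funM.
have st : (s * t = 1 - c)%R.
  rewrite /t mulrA -expr2 (_ : s ^+ 2 = (1 - c) * (1 + c))%R ?mulfK//.
  by lra.
have t1c : (t * (1 + c) = s)%R by rewrite /t divfK.
transitivity (\int[leb]_x \int[leb]_y
    K ((x + - t * y + - t * (y + s * (x + - t * y)))%R, (y + s * (x + - t * y))%R)).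
  apply: eq_integral => x _; apply: eq_integral => y _; congr (K (_, _)).
    have -> : (x + - t * y + - t * (y + s * (x + - t * y)) =
      x * (1 - s * t) - y * (t * (2 - s * t)))%R by ring.
    by rewrite st -[s in LHS]t1c; ring.
  have -> : (y + s * (x + - t * y) = s * x + (1 - s * t) * y)%R by ring.
  by rewrite st; ring.
rewrite (@leb_shearx (- t) (fun p =>
  K ((p.1 + - t * (p.2 + s * p.1))%R, (p.2 + s * p.1)%R)))//.
rewrite (@leb_sheary s (fun p => K ((p.1 + - t * p.2)%R, p.2)))//.
exact: leb_shearx.
Qed.

Let gam2E H : measurable_fun setT H -> (forall p, 0 <= H p) ->
  \int[gam]_x \int[gam]_y H (x, y) =
  \int[leb]_x \int[leb]_y
    (H (x, y) * (normal_peak 1 ^+ 2 * expR (- (x ^+ 2 + y ^+ 2) / 2))%:E).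
Proof.
move=> mH H0.
rewrite ge0_integral_gam; first last.
- by move=> x; apply: integral_ge0.
- exact: (@measurable_fun_fubini_tonelli_F _ _ _ _ _ gam).
apply: eq_integral => x _.
have mHx : measurable_fun setT (fun y => H (x, y)) by exact: measurableT_comp.
rewrite (@ge0_integral_gam _ (fun y => H (x, y)))// -ge0_integralZr//.
- apply: eq_integral => y _; rewrite -muleA -EFinM !normal_pdf01E.
  by rewrite mulrACA -expr2 -expRD; do 3 congr (_ _); congr expR; field.
- apply: emeasurable_funM => //; apply/measurable_EFinP.
  exact: measurable_normal_pdf.
- by move=> y _; rewrite mule_ge0// lee_fin normal_pdf_ge0.
- by rewrite lee_fin normal_pdf_ge0.
Qed.

Lemma gam_rotation (c s : R) H : (0 <= c)%R -> (c ^+ 2 + s ^+ 2 = 1)%R ->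
  measurable_fun setT H -> (forall p, 0 <= H p) ->
  \int[gam]_x \int[gam]_y H ((c * x - s * y)%R, (s * x + c * y)%R) =
  \int[gam]_x \int[gam]_y H (x, y).
Proof.
move=> c0 cs mH H0.
pose H' (p : R * R) := H ((c * p.1 - s * p.2)%R, (s * p.1 + c * p.2)%R).
have mH' : measurable_fun setT H'.
  apply: measurableT_comp => //; apply: measurable_fun_pair.
    by apply: measurable_funB; exact: measurable_funM.
  by apply: measurable_funD; exact: measurable_funM.
apply: etrans (gam2E mH' (fun p => H0 _)) _.
apply/esym; apply: etrans (gam2E mH H0) _; apply/esym.
pose K p := H p * (normal_peak 1 ^+ 2 * expR (- (p.1 ^+ 2 + p.2 ^+ 2) / 2))%:E.
apply: etrans (@leb_rotation c s K c0 cs _ _); first last.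
- by move=> p; rewrite mule_ge0// lee_fin mulr_ge0 ?expR_ge0 ?exprn_ge0 ?normal_peak_ge0.
- apply: emeasurable_funM => //; apply/measurable_EFinP; apply: measurable_funM => //.
  apply: measurableT_comp => //; apply: measurable_funM => //.
  apply: measurableT_comp => //.
  by apply: measurable_funD; apply: measurable_funX.
apply: eq_integral => x _; apply: eq_integral => y _; rewrite /K /=.
have -> : ((c * x - s * y) ^+ 2 + (s * x + c * y) ^+ 2 = x ^+ 2 + y ^+ 2)%R.
  by rewrite -[RHS]mul1r -cs; ring.
by [].
Qed.

End gauss2d.

Lemma integral_gam_cst {R : realType} (e : \bar R) : (\int[gam]_x e = e)%E.
Proof.
have h : (gam [set: R] = 1%E :> \bar R) by exact: probability_setT.
by rewrite integral_cst//= h mule1.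
Qed.

(** * Gaussian expectations *)

Section gaussian_iterated_integral.
Context {R : realType} {I : Type}.
Local Open Scope ereal_scope.
Implicit Types (A : seq (I -> R)) (G : (I -> R) -> \bar R) (a b : I -> R).

(* Measurability for the product sigma-algebra, without introducing it. *)
Definition vmeasurable G := forall d (T : measurableType d) (v : I -> T -> R),
  (forall i, measurable_fun setT (v i)) ->
  measurable_fun setT (fun t => G (v ^~ t)).

(* The expectation of [G (b + \sum_a xi_a a)] for independent standard normal
   [xi_a], [a] in [A]. *)
Fixpoint gint A G b : \bar R :=
  if A is a :: A' then \int[gam]_x gint A' G (fun i => b i + x * a i)%R
  else G b.

Lemma gint_ge0 A G b : (forall c, 0 <= G c) -> 0 <= gint A G b.
Proof.
by move=> G0; elim: A b => [|a A IH] b //=; apply: integral_ge0 => x _; exact: IH.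
Qed.

Lemma vmeasurable_gint A G : vmeasurable G -> (forall c, 0 <= G c) ->
  vmeasurable (gint A G).
Proof.
move=> mG G0; elim: A => [//|a A IH] d T v mv /=.
apply: (@measurable_fun_fubini_tonelli_F _ _ _ _ _ gam
  (fun p => gint A G (fun i => v i p.1 + p.2 * a i)%R)).
  apply: (IH _ _ (fun i (p : T * measurableTypeR R) => v i p.1 + p.2 * a i)%R) => i.
  apply: measurable_funD; first exact: measurableT_comp.
  exact: measurable_funM.
by move=> p; exact: gint_ge0.
Qed.

Lemma gint_line_measurable A G a b : vmeasurable G -> (forall c, 0 <= G c) ->
  measurable_fun setT (fun x : R => gint A G (fun i => b i + x * a i)%R).
Proof.
move=> mG G0; apply: (@vmeasurable_gint A _ mG G0 _ _ (fun i (x : R) => b i + x * a i)%R _).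
by move=> i; apply: measurable_funD => //; exact: measurable_funM.
Qed.

Lemma gint_plane_measurable A G a1 a2 b :
  vmeasurable G -> (forall c, 0 <= G c) ->
  measurable_fun setT (fun p : R * R =>
    gint A G (fun i => b i + p.1 * a1 i + p.2 * a2 i)%R).
Proof.
move=> mG G0; apply: (@vmeasurable_gint A _ mG G0 _ _
  (fun i (p : R * R) => b i + p.1 * a1 i + p.2 * a2 i)%R _).
move=> i; apply: measurable_funD; last exact: measurable_funM.
by apply: measurable_funD => //; exact: measurable_funM.
Qed.

(** Conditioning: once the variables of [A1] are drawn, they only move the base point of the
    integral over [A2]. *)
Lemma gint_cat A1 A2 G b : gint (A1 ++ A2) G b = gint A1 (gint A2 G) b.
Proof. by elim: A1 b => [//|a A IH] b /=; apply: eq_integral => x _. Qed.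

(** An error that is uniform in the base point survives averaging unchanged, each standard normal
    law having mass one. *)
Lemma le_gint A G G' b (e : R) :
  vmeasurable G -> vmeasurable G' -> (forall c, 0 <= G c) ->
  (forall c, 0 <= G' c) -> (0 <= e)%R -> (forall c, G c <= G' c + e%:E) ->
  gint A G b <= gint A G' b + e%:E.
Proof.
move=> mG mG' G0 G'0 e0 GG'; elim: A b => [|a A IH] b //=.
apply: (@le_trans _ _ (\int[gam]_x (gint A G' (fun i => b i + x * a i)%R + e%:E))).
  apply: ge0_le_integral => //.
  - by move=> x _; exact: gint_ge0.
  - exact: gint_line_measurable.
  - by apply: emeasurable_funD => //; exact: gint_line_measurable.
rewrite ge0_integralD//; first by rewrite integral_gam_cst.
- by move=> x _; exact: gint_ge0.
- exact: gint_line_measurable.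
Qed.

Lemma gint_sum (J : Type) (s : seq J) (P : pred J) A
    (G : J -> (I -> R) -> \bar R) b :
  (forall j, vmeasurable (G j)) -> (forall j c, 0 <= G j c) ->
  gint A (fun c => \sum_(j <- s | P j) G j c) b =
  \sum_(j <- s | P j) gint A (G j) b.
Proof.
move=> mG G0; elim: A b => [|a A IH] b //=.
rewrite -big_filter; under eq_integral do rewrite IH -big_filter.
rewrite ge0_integral_sum//.
- by move=> j; exact: gint_line_measurable.
- by move=> j x _; exact: gint_ge0.
Qed.

Lemma gint_rotate (c s : R) a1 a2 A G b : vmeasurable G ->
  (forall c, 0 <= G c) -> (0 <= c)%R -> (c ^+ 2 + s ^+ 2 = 1)%R ->
  gint [:: a1, a2 & A] G b =
  gint [:: (fun i => c * a1 i + s * a2 i)%R,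
           (fun i => - s * a1 i + c * a2 i)%R & A] G b.
Proof.
move=> mG G0 c0 cs /=.
pose H (p : R * R) := gint A G (fun i => b i + p.1 * a1 i + p.2 * a2 i)%R.
have := @gam_rotation R c s H c0 cs _ _ => <-.
- apply: eq_integral => x _; apply: eq_integral => y _.
  by rewrite /H /=; congr (gint A G _); apply: funext => i; ring.
- exact: gint_plane_measurable.
- by move=> p; exact: gint_ge0.
Qed.

Lemma gint_opp a A G b : vmeasurable G -> (forall c, 0 <= G c) ->
  gint ((fun i => - a i)%R :: A) G b = gint (a :: A) G b.
Proof.
move=> mG G0 /=.
rewrite -(@gamN _ (fun x => gint A G (fun i => b i + x * a i)%R)).
- apply: eq_integral => x _; congr (gint A G _).
  by apply: funext => i; ring.
- exact: gint_line_measurable.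
- by move=> x; exact: gint_ge0.
Qed.

Lemma gint0 a A G b : (forall i, a i = 0%R) -> gint (a :: A) G b = gint A G b.
Proof.
move=> a0 /=; under eq_integral.
  move=> x _; rewrite (_ : (fun i => _) = b); last first.
    by apply: funext => i; rewrite a0 mulr0 addr0.
  over.
exact: integral_gam_cst.
Qed.

End gaussian_iterated_integral.

(** * A centered Gaussian law is determined by its covariance *)

Section quadratic_form.
Context {R : realType} {N : nat}.
Implicit Types (A : seq ('I_N -> R)) (a b u : 'I_N -> R).

Definition dotp u a : R := \sum_i u i * a i.

(** The quadratic form of the sum of the matrices a a^T; up to the factor [gam_pow2], the variance
    of the linear form [u] under the Gaussian law with columns [A]. *)
Definition qform A u : R := \sum_(a <- A) dotp u a ^+ 2.

Lemma dotpDr u a b : dotp u (fun i => a i + b i) = dotp u a + dotp u b.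
Proof. by rewrite /dotp -big_split; apply: eq_bigr => i _; rewrite /= mulrDr. Qed.

Lemma dotpZr u (c : R) a : dotp u (fun i => c * a i) = c * dotp u a.
Proof. by rewrite /dotp mulr_sumr; apply: eq_bigr => i _; rewrite mulrCA. Qed.

Lemma dotpDl u v a : dotp (fun i => u i + v i) a = dotp u a + dotp v a.
Proof. by rewrite /dotp -big_split; apply: eq_bigr => i _; rewrite /= mulrDl. Qed.

Lemma dotpZl u (c : R) a : dotp (fun i => c * u i) a = c * dotp u a.
Proof. by rewrite /dotp mulr_sumr; apply: eq_bigr => i _; rewrite mulrA. Qed.

Definition basis_fun (k : 'I_N) : 'I_N -> R := fun i => (i == k)%:R.

Lemma dotp_basisl k a : dotp (basis_fun k) a = a k.
Proof.
rewrite /dotp (bigD1 k)//= /basis_fun eqxx mul1r big1 ?addr0// => i ik.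
by rewrite (negbTE ik) mul0r.
Qed.

Lemma dotp_basisr u k : dotp u (basis_fun k) = u k.
Proof.
rewrite -[RHS](dotp_basisl k); apply: eq_bigr => i _; exact: mulrC.
Qed.

Let vanish (k : nat) a := forall i : 'I_N, (k <= i)%N -> a i = 0.

(* Two lists of columns with the same Gaussian law, the second one vanishing
   wherever the first one does. *)
Let gequiv A A' :=
  [/\ forall G b, vmeasurable G -> (forall c, 0 <= G c)%E ->
        gint A G b = gint A' G b,
      forall u, qform A u = qform A' u
    & forall i, List.Forall (fun a => a i = 0) A ->
        List.Forall (fun a => a i = 0) A'].

Let gequiv_trans A1 A2 A3 : gequiv A1 A2 -> gequiv A2 A3 -> gequiv A1 A3.
Proof.
move=> [g12 q12 z12] [g23 q23 z23]; split => [G b mG G0|u|i /z12 /z23//].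
  by rewrite g12// g23.
by rewrite q12 q23.
Qed.

Let gequiv_cons a A A' : gequiv A A' -> gequiv (a :: A) (a :: A').
Proof.
move=> [g q z]; split => [G b mG G0 /=|u|i].
- by apply: eq_integral => x _; exact: g.
- by rewrite /qform !big_cons -/(qform A u) q.
- by move=> /List.Forall_cons_iff [ai /z]; exact: List.Forall_cons.
Qed.

Let gequiv_rotate c s a1 a2 A : 0 <= c -> c ^+ 2 + s ^+ 2 = 1 ->
  gequiv [:: a1, a2 & A] [:: (fun i => c * a1 i + s * a2 i),
           (fun i => - s * a1 i + c * a2 i) & A].
Proof.
move=> c0 cs; split => [G b mG G0|u|i].
- exact: gint_rotate.
- rewrite /qform !big_cons !dotpDr !dotpZr !addrA; congr (_ + _).
  rewrite -[LHS]mul1r -cs; ring.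
- move=> /List.Forall_cons_iff [a1i /List.Forall_cons_iff [a2i Ai]].
  by repeat (apply: List.Forall_cons => //); rewrite a1i a2i !mulr0 addr0.
Qed.

Let gequiv_zero A : gequiv A ((fun=> 0) :: A).
Proof.
split => [G b mG G0|u|i Ai]; first by rewrite gint0.
  rewrite /qform big_cons (_ : dotp _ _ = 0) ?expr0n ?add0r//.
  by rewrite /dotp big1// => i _; rewrite mulr0.
exact: List.Forall_cons.
Qed.

Let gequiv_opp a A : gequiv (a :: A) ((fun i => - a i) :: A).
Proof.
split => [G b mG G0|u|i]; first by rewrite gint_opp.
  rewrite /qform !big_cons (_ : dotp u (fun i => - a i) = - dotp u a) ?sqrrN//.
  by rewrite /dotp -sumrN; apply: eq_bigr => i _; rewrite mulrN.
move=> /List.Forall_cons_iff [ai Ai]; apply: List.Forall_cons => //.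
by rewrite ai oppr0.
Qed.

(** A Givens rotation, carrying (p, q) to the first axis. For negative [p] both [c] and [s] change
    sign, so that [0 <= c] as [gam_rotation] requires. *)
Let givens (p q : R) : exists c s : R,
  [/\ 0 <= c, c ^+ 2 + s ^+ 2 = 1 & - s * p + c * q = 0].
Proof.
have [/andP[/eqP -> /eqP ->]|pq0] := boolP ((p == 0) && (q == 0)).
  by exists 1, 0; rewrite expr1n expr0n/= !mulr0 !addr0.
pose r := Num.sqrt (p ^+ 2 + q ^+ 2).
have r2 : r ^+ 2 = p ^+ 2 + q ^+ 2 by rewrite sqr_sqrtr// addr_ge0// sqr_ge0.
have r0 : r != 0.
  rewrite -sqrf_eq0 r2 paddr_eq0 ?sqr_ge0// !sqrf_eq0.
  by [].
have [p0|p0] := leP 0 p.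
  exists (p / r), (q / r); split; last by field.
    by rewrite divr_ge0// sqrtr_ge0.
  by rewrite !expr_div_n -mulrDl -r2 divff// sqrf_eq0.
exists (- p / r), (- q / r); split; last by field.
  by rewrite divr_ge0 ?oppr_ge0 ?(ltW p0)// sqrtr_ge0.
by rewrite !expr_div_n !sqrrN -mulrDl -r2 divff// sqrf_eq0.
Qed.

(** A sweep of Givens rotations, as in a QR factorization, gathers the [k]-th coordinates of all
    columns into one. The empty list receives a zero column, so that there is always a pivot. *)
Let gequiv_pivot k A : exists a A', gequiv A (a :: A') /\
  List.Forall (fun a => a k = 0) A'.
Proof.
elim: A => [|a A [a1 [A1 [AA1 A10]]]].
  by exists (fun=> 0), [::]; split; [exact: gequiv_zero|exact: List.Forall_nil].
have [c [s [c0 cs csa]]] := givens (a k) (a1 k).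
exists (fun i => c * a i + s * a1 i), ((fun i => - s * a i + c * a1 i) :: A1).
split; last exact: List.Forall_cons.
apply: gequiv_trans (gequiv_cons _ AA1) _.
exact: gequiv_rotate.
Qed.

Let qform_polar A u v : qform A (fun i => u i + v i) =
  qform A u + qform A v + 2 * \sum_(a <- A) dotp u a * dotp v a.
Proof.
rewrite /qform mulr_sumr -!big_split; apply: eq_bigr => a _.
by rewrite dotpDl /=; ring.
Qed.

Let qform_basis k a A : List.Forall (fun a => a k = 0) A ->
  forall u, \sum_(b <- a :: A) dotp (basis_fun k) b * dotp u b = a k * dotp u a.
Proof.
move=> Ak u; rewrite big_cons dotp_basisl.
suff -> : \sum_(b <- A) dotp (basis_fun k) b * dotp u b = 0 by rewrite addr0.
elim: A Ak => [|b A IH]; first by rewrite big_nil.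
move=> /List.Forall_cons_iff [bk /IH Ak].
by rewrite big_cons dotp_basisl bk mul0r add0r.
Qed.

Let vanish_pivot n a A (k : 'I_N) : val k = n ->
  List.Forall (vanish n.+1) (a :: A) ->
  List.Forall (fun a => a k = 0) (a :: A) ->
  List.Forall (vanish n) (a :: A).
Proof.
move=> kn /List.Forall_forall An /List.Forall_forall Ak.
apply/List.Forall_forall => c cA i; rewrite leq_eqVlt => /orP[/eqP ni|].
  by rewrite (_ : i = k) ?Ak//; apply: val_inj; rewrite kn.
exact: An.
Qed.

(* A centered Gaussian law is determined by its covariance: eliminating the
   coordinates from the last one, rotations bring both families of columns to
   a form whose first columns agree. *)
Lemma gint_qform A A' G b : vmeasurable G -> (forall c, 0 <= G c)%E ->
  (forall u, qform A u = qform A' u) -> gint A G b = gint A' G b.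
Proof.
move=> mG G0.
have H n : (n <= N)%N -> forall A A' b, List.Forall (vanish n) A ->
    List.Forall (vanish n) A' -> (forall u, qform A u = qform A' u) ->
    gint A G b = gint A' G b.
  elim: n => [_|n IH nN] {}A {}A' {}b.
    have gG B : List.Forall (vanish 0) B -> gint B G b = G b.
      elim: B => [//|a B IH /List.Forall_cons_iff [a0 B0]].
      by rewrite gint0 ?IH// => i; exact: a0.
    by move=> A0 A'0 _; rewrite !gG.
  pose k := Ordinal nN.
  move=> An A'n qq.
  have [a [B [[gB qB zB] Bk]]] := gequiv_pivot k A.
  have [a' [B' [[gB' qB' zB'] B'k]]] := gequiv_pivot k A'.
  have zero C C' : (forall i, List.Forall (fun a => a i = 0) C ->
      List.Forall (fun a => a i = 0) C') ->
      List.Forall (vanish n.+1) C -> List.Forall (vanish n.+1) C'.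
    move=> zC /List.Forall_forall Cn; apply/List.Forall_forall => c cC' i ni.
    have /zC/List.Forall_forall : List.Forall (fun a => a i = 0) C.
      by apply/List.Forall_forall => e eC; exact: Cn.
    exact.
  have {zB An} Bn := zero _ _ zB An.
  have {zB' A'n} B'n := zero _ _ zB' A'n.
  rewrite gB// gB'//.
  have {gB gB' qB qB'} qq' u : qform (a :: B) u = qform (a' :: B') u.
    by rewrite -qB -qB'.
  have qk c C : List.Forall (fun a => a k = 0) C ->
      qform (c :: C) (basis_fun k) = c k ^+ 2.
    move=> /(qform_basis c)/(_ (basis_fun k)); rewrite dotp_basisl => E.
    by rewrite expr2 -E; apply: eq_bigr => i _; rewrite expr2.
  (* With equal pivots, polarizing at [basis_fun k] shows that [a k * dotp u a] is the same for both
     lists. Either [a k] is zero and coordinate [k] has disappeared from all columns, or the first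
     columns coincide and can be integrated last, leaving shorter vectors. *)
  have main a1 : List.Forall (vanish n.+1) (a1 :: B') -> a k = a1 k ->
      (forall u, qform (a :: B) u = qform (a1 :: B') u) ->
      gint (a :: B) G b = gint (a1 :: B') G b.
    move=> a1n aa1 qq1; have [ak0|ak0] := eqVneq (a k) 0.
      apply: IH => //; first exact: ltnW.
        by apply: (@vanish_pivot _ _ _ k) => //; exact: List.Forall_cons.
      apply: (@vanish_pivot _ _ _ k) => //; apply: List.Forall_cons => //.
      by rewrite -aa1.
    have E u : dotp u a = dotp u a1.
      have := qq1 (fun i => basis_fun k i + u i).
      rewrite !qform_polar !qq1 => /addrI/mulfI.
      rewrite pnatr_eq0 => /(_ isT).
      by rewrite !qform_basis// -aa1 => /mulfI; exact.
    have {E} E : a = a1.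
      by apply: funext => i; rewrite -!(dotp_basisl i) E.
    rewrite E in Bn qq1 ak0 *.
    move: Bn a1n => /List.Forall_cons_iff [_ Bn] /List.Forall_cons_iff [_ B'n'].
    rewrite /=; apply: eq_integral => x _; apply: IH; first exact: ltnW.
    - case: B Bk Bn {qq' qq1} => [//|c C] Bk Bn; exact: (@vanish_pivot _ _ _ k).
    - case: B' B'k B'n' {qq' qq1 B'n} => [//|c C] B'k B'n'.
      exact: (@vanish_pivot _ _ _ k).
    - by move=> u; have := qq1 u; rewrite /qform !big_cons => /addrI.
  (* The variance of coordinate [k] determines its pivot up to sign, and opposite columns give the
     same law. *)
  have /eqP : a k ^+ 2 = a' k ^+ 2 by rewrite -(qk _ _ Bk) -(qk _ _ B'k).
  rewrite eqf_sqr => /orP[/eqP aa'|/eqP aa']; first exact: main.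
  have [gN qN zN] := gequiv_opp a' B'.
  rewrite gN//; apply: main => //; last by move=> u; rewrite qq' qN.
  exact: zero zN _.
move=> qq; apply: (H N) => //; apply/List.Forall_forall => a _ i;
  by rewrite leqNgt ltn_ord.
Qed.

End quadratic_form.

(** * Nonnegative quadratic forms as sums of squares *)

Section lagrange_reduction.
Context {R : realType} {N : nat}.
Implicit Types (M : 'I_N -> 'I_N -> R) (u v : 'I_N -> R).

Definition bform M u v : R := \sum_i u i * dotp v (M i).

Let bformDl M u1 u2 v :
  bform M (fun i => u1 i + u2 i) v = bform M u1 v + bform M u2 v.
Proof. by rewrite /bform -big_split; apply: eq_bigr => i _; rewrite mulrDl. Qed.

Let bformZl M c u v : bform M (fun i => c * u i) v = c * bform M u v.
Proof. by rewrite /bform mulr_sumr; apply: eq_bigr => i _; rewrite mulrA. Qed.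

Let bformC M u v : (forall i j, M i j = M j i) -> bform M u v = bform M v u.
Proof.
move=> MC; rewrite /bform /dotp; under eq_bigr do rewrite mulr_sumr.
rewrite exchange_big /=; apply: eq_bigr => i _; rewrite mulr_sumr.
by apply: eq_bigr => j _; rewrite MC mulrCA.
Qed.

Let bform_basisl M k v : bform M (basis_fun k) v = dotp v (M k).
Proof.
rewrite /bform (bigD1 k)//= {1}/basis_fun eqxx mul1r big1 ?addr0// => i ik.
by rewrite /basis_fun (negbTE ik) mul0r.
Qed.

Let bform_sqr M c u v : (forall i j, M i j = M j i) ->
  bform M (fun i => u i + c * v i) (fun i => u i + c * v i) =
  bform M u u + 2 * c * bform M v u + c ^+ 2 * bform M v v.
Proof.
move=> MC; rewrite !bformDl !bformZl !(bformC _ (fun i => _ + _) MC).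
rewrite !bformDl !bformZl (bformC u v MC); ring.
Qed.

(** Lagrange reduction, from the last coordinate down: a zero pivot forces its row to vanish, and a
    positive pivot is split off as the square of one column, the Schur complement remaining
    nonnegative. *)
Lemma psd_qform M : (forall i j, M i j = M j i) ->
  (forall u, 0 <= bform M u u) ->
  exists A : seq ('I_N -> R), forall u, qform A u = bform M u u.
Proof.
suff H n : (n <= N)%N -> forall M, (forall i j, M i j = M j i) ->
    (forall i j : 'I_N, (n <= i)%N -> M i j = 0) -> (forall u, 0 <= bform M u u) ->
    exists A : seq ('I_N -> R), forall u, qform A u = bform M u u.
  by move=> MC M0; apply: (H N) => // i j; rewrite leqNgt ltn_ord.
elim: n => [_|n IH nN] {}M MC Mn M0.
  exists [::] => u; rewrite /qform big_nil /bform big1// => i _.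
  by rewrite /dotp big1 ?mulr0// => j _; rewrite Mn// mulr0.
pose k := Ordinal nN.
have Mkk : 0 <= M k k by have := M0 (basis_fun k); rewrite bform_basisl dotp_basisl.
have [Mk0|Mk0] := eqVneq (M k k) 0.
  apply: IH => //; first exact: ltnW.
  move=> i j; rewrite leq_eqVlt => /orP[/eqP ni|]; last exact: Mn.
  rewrite (_ : i = k); last exact: val_inj.
  apply/eqP/negPn/negP => Mkj.
  (* As [M k k] is zero, the form is affine in the coefficient of [basis_fun k], which is chosen to
     give the value -1. *)
  have := M0 (fun l => basis_fun j l + (- (M j j + 1) / (2 * M k j)) * basis_fun k l).
  rewrite bform_sqr// !bform_basisl !dotp_basisl Mk0.
  rewrite mulr0 addr0 (_ : _ + _ = -1) ?oppr_ge0 ?ler10//.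
  by field.
have m0 : 0 < M k k by rewrite lt_neqAle eq_sym Mk0.
pose s := Num.sqrt (M k k).
have s0 : 0 < s by rewrite sqrtr_gt0.
have ss : s * s = M k k by rewrite -expr2 sqr_sqrtr.
pose b i := M k i / s.
have bk : b k = s by rewrite /b -ss mulfK// gt_eqF.
pose M' i j := M i j - b i * b j.
have M'C i j : M' i j = M' j i by rewrite /M' MC [b i * _]mulrC.
have M'k j : M' k j = 0 by rewrite /M' bk mulrC divfK ?subrr// gt_eqF.
have M'E u v : bform M' u v = bform M u v - dotp u b * dotp v b.
  rewrite /bform {2}/dotp mulr_suml -sumrB; apply: eq_bigr => i _.
  rewrite -mulrA -mulrBr; congr (_ * _).
  rewrite /dotp mulr_sumr -sumrB; apply: eq_bigr => j _; rewrite /M'; ring.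
have [||A AE] := IH (ltnW nN) M' M'C.
- move=> i j; rewrite leq_eqVlt => /orP[/eqP ni|ni].
    by rewrite (_ : i = k) ?M'k//; exact: val_inj.
  by rewrite /M' Mn// /b MC Mn// !mul0r subrr.
(* Moving [u] along [basis_fun k] leaves the form of [M'] unchanged, its [k]-th row being zero. This
   [t] makes the vector orthogonal to [b], where [M'] and [M] agree. *)
- move=> u; pose t := - (dotp u b / s).
  have bke v : bform M' (basis_fun k) v = 0.
    by rewrite bform_basisl /dotp big1// => i _; rewrite M'k mulr0.
  have := bform_sqr t u (basis_fun k) M'C; rewrite !bke !mulr0 !addr0 => <-.
  rewrite M'E (_ : dotp _ b = 0) ?mul0r ?subr0//.
  by rewrite dotpDl dotpZl dotp_basisl bk /t mulNr divfK ?subrr// gt_eqF.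
- exists (b :: A) => u; rewrite /qform big_cons -/(qform A u) AE M'E.
  by rewrite expr2 addrC subrK.
Qed.

End lagrange_reduction.

(** * Privatized pairs and matchings *)

Section affinity.
Context {R : realType}.

(** From 4 P Q = (P + Q)^2 - (P - Q)^2. Summed over the outcomes of two probability laws, it bounds
    their affinity below by one minus half the sum of the [E]. *)
Lemma affinity_ge (P Q E : R) : 0 <= P -> 0 <= Q -> 0 <= E ->
  (P - Q) ^+ 2 <= (P + Q) * E -> (P + Q) / 2 - E / 2 <= Num.sqrt (P * Q).
Proof.
move=> P0 Q0 E0 PQE; have [EPQ|/ltW PQ0] := leP E (P + Q); last first.
  by apply: le_trans (sqrtr_ge0 _); lra.
have h : 0 <= (P + Q) / 2 - E / 2 by lra.
rewrite -(ger0_norm h) -sqrtr_sqr ler_sqrt ?mulr_ge0//.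
have : E ^+ 2 <= (P + Q) * E by rewrite expr2 ler_wpM2r.
by lra.
Qed.

(** Write p - q = d s with d and s the difference and the sum of the square roots, and bound d s by
    (theta d^2 + s^2 / theta) / 2. The squares d^2 add up to at most 2 x, and the squares s^2 to at
    most 4. Keeping [theta] free avoids a square root in the error. *)
Lemma test_affinity (T : finType) (p q : T -> R) (S : pred T) (theta x : R) :
  (forall t, 0 <= p t) -> (forall t, 0 <= q t) ->
  \sum_t p t = 1 -> \sum_t q t = 1 -> 0 < theta ->
  1 - x <= \sum_t Num.sqrt (p t * q t) ->
  \sum_(t | S t) p t <= \sum_(t | S t) q t + (theta * x + 2 / theta).
Proof.
move=> p0 q0 p1 q1 th0 BC.
pose d t := Num.sqrt (p t) - Num.sqrt (q t).
pose s t := Num.sqrt (p t) + Num.sqrt (q t).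
have dE t : d t ^+ 2 = p t + q t - 2 * Num.sqrt (p t * q t).
  by rewrite sqrrB !sqr_sqrtr// sqrtrM//; ring.
have sE t : s t ^+ 2 = p t + q t + 2 * Num.sqrt (p t * q t).
  by rewrite sqrrD !sqr_sqrtr// sqrtrM//; ring.
have pq t : p t <= q t + (theta * d t ^+ 2 + s t ^+ 2 / theta) / 2.
  rewrite -lerBlDl; have -> : p t - q t = d t * s t.
    by rewrite -[in LHS](sqr_sqrtr (p0 t)) -[in LHS](sqr_sqrtr (q0 t)) subr_sqr.
  rewrite -subr_ge0.
  have -> : (theta * d t ^+ 2 + s t ^+ 2 / theta) / 2 - d t * s t =
      (theta * d t - s t) ^+ 2 / (2 * theta) by field; rewrite gt_eqF.
  by rewrite divr_ge0 ?sqr_ge0// mulr_ge0// ltW.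
apply: (le_trans (ler_sum _ (fun t _ => pq t))).
rewrite big_split lerD2l /=.
apply: (@le_trans _ _ (\sum_t (theta * d t ^+ 2 + s t ^+ 2 / theta) / 2)).
  rewrite [leRHS](bigID S) /= lerDl sumr_ge0// => t _.
  by rewrite divr_ge0// addr_ge0// mulr_ge0 ?sqr_ge0 ?invr_ge0 ?(ltW th0).
rewrite -mulr_suml big_split /= -mulr_sumr -mulr_suml.
under eq_bigr do rewrite dE.
under [X in _ + X / _]eq_bigr do rewrite sE.
rewrite sumrB !big_split/= -!mulr_sumr p1 q1.
set B := \sum_t Num.sqrt _ in BC *.
have B1 : B <= 1.
  have : 0 <= \sum_t d t ^+ 2 by apply: sumr_ge0 => t _; exact: sqr_ge0.
  under eq_bigr do rewrite dE.
  by rewrite sumrB big_split/= -mulr_sumr p1 q1 -/B; lra.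
have h1 : theta * (1 + 1 - 2 * B) <= theta * (2 * x).
  by rewrite ler_wpM2l ?(ltW th0)//; lra.
have h2 : (1 + 1 + 2 * B) / theta <= 4 / theta.
  by rewrite ler_wpM2r ?invr_ge0 ?(ltW th0)//; lra.
lra.
Qed.

Lemma prod_ge_1Bsum (I : Type) (s : seq I) (B : I -> R) :
  (forall i, 0 <= B i <= 1) ->
  1 - \sum_(i <- s) (1 - B i) <= \prod_(i <- s) B i.
Proof.
move=> B01.
suff : (0 <= \prod_(i <- s) B i <= 1) /\
  1 - \sum_(i <- s) (1 - B i) <= \prod_(i <- s) B i by case.
elim: s => [|i s [/andP[P0 P1] IH]]; first by rewrite !big_nil subr0 ler01 lexx.
rewrite !big_cons; have /andP[Bi0 Bi1] := B01 i.
split; first by rewrite mulr_ge0 ?mulr_ile1.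
set P := \prod_(j <- s) B j in P0 P1 IH *; set X := \sum_(j <- s) _ in IH *.
have : 0 <= (1 - B i) * (1 - P) by rewrite mulr_ge0// subr_ge0.
by lra.
Qed.

End affinity.

(** * Sums over outcomes that factorize along a matching *)

Section sum_over_pairs.
Context {R : realType} {N : nat} {K : finType}.
Implicit Types (i j : 'I_N) (k : {ffun 'I_N -> K}).

Let upd i j k (a b : K) : {ffun 'I_N -> K} :=
  [ffun l => if l == i then a else if l == j then b else k l].

(** The constant [C], a sum over the other letters, is the same for all [phi]; it is left implicit
    because a single well-chosen [phi] identifies it. *)
Let sum_free_pair i j (F : {ffun 'I_N -> K} -> R) : i != j ->
  (forall k a b, F (upd i j k a b) = F k) ->
  exists C, forall phi : K -> K -> R,
    \sum_k F k * phi (k i) (k j) = (\sum_a \sum_b phi a b) * C.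
Proof.
move=> ij Fupd; have [a0 _|noK] := pickP (@predT K); last first.
  exists 0 => phi; rewrite mulr0 big1// => k _.
  by have := noK (k i).
exists (\sum_(k : {ffun 'I_N -> K} | (k i == a0) && (k j == a0)) F k) => phi.
rewrite (partition_big (fun k => (k i, k j)) predT)//=.
rewrite pair_big /= mulr_suml; apply: eq_bigr => -[a b] _ /=.
rewrite mulr_sumr.
have ji : (j == i) = false by rewrite eq_sym (negbTE ij).
have updi k c e : upd i j k c e i = c by rewrite ffunE eqxx.
have updj k c e : upd i j k c e j = e by rewrite ffunE eqxx ji.
have updK k c e c' e' : k i = c -> k j = e ->
    upd i j (upd i j k c' e') c e = k.
  move=> ki kj; apply/ffunP => l; rewrite !ffunE.
  by case: eqP => [->//|_]; case: eqP => [->//|_].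
rewrite (reindex_onto (fun k => upd i j k a b) (fun k => upd i j k a0 a0)).
  apply: eq_big => [k|k _].
    rewrite updi updj eqxx /=; apply/eqP/andP => [<-|[/eqP ki /eqP kj]].
      by rewrite updi updj !eqxx.
    exact: updK.
  by rewrite updi updj Fupd mulrC.
by move=> k /= /eqP[ki kj]; exact: updK.
Qed.

Definition endpoints (es : seq ('I_N * 'I_N)) : seq 'I_N :=
  flatten [seq [:: e.1; e.2] | e <- es].

Lemma sum_prod_pairs (phi : 'I_N * 'I_N -> K -> K -> R) (psi : 'I_N -> K -> R)
    (es : seq ('I_N * 'I_N)) : uniq (endpoints es) ->
  (forall l, \sum_a psi l a = 1) ->
  \sum_(k : {ffun 'I_N -> K}) (\prod_(l | l \notin endpoints es) psi l (k l)) *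
     \prod_(e <- es) phi e (k e.1) (k e.2) =
  \prod_(e <- es) \sum_a \sum_b phi e a b.
Proof.
move=> + psi1; elim: es => [_|[i j] es IH].
  rewrite big_nil; under eq_bigr do rewrite big_nil mulr1.
  transitivity (\prod_(l : 'I_N) \sum_a psi l a); last by rewrite big1.
  by rewrite bigA_distr_bigA.
rewrite /endpoints /= -/(endpoints es) inE negb_or => /and3P[/andP[ij iN] jN ues].
rewrite big_cons /=.
pose F (k : {ffun 'I_N -> K}) :=
  (\prod_(l | l \notin endpoints ((i, j) :: es)) psi l (k l)) *
  \prod_(e <- es) phi e (k e.1) (k e.2).
have Fupd k a b : F (upd i j k a b) = F k.
  congr (_ * _).
    apply: eq_bigr => l; rewrite /endpoints/= !inE !negb_or => /and3P[li lj _].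
    by rewrite ffunE (negbTE li) (negbTE lj).
  rewrite big_seq [RHS]big_seq; apply: eq_bigr => e ees.
  have h l : l \in [:: e.1; e.2] -> (l != i) && (l != j).
    move=> le; have les : l \in endpoints es.
      by apply/flattenP; exists [:: e.1; e.2] => //; apply/mapP; exists e.
    by apply/andP; split; [apply: contraNneq iN => <-|apply: contraNneq jN => <-].
  have /andP[/negbTE e1i /negbTE e1j] := h e.1 (mem_head _ _).
  have /andP[/negbTE e2i /negbTE e2j] : (e.2 != i) && (e.2 != j).
    by apply: h; rewrite !inE eqxx orbT.
  by rewrite !ffunE e1i e1j e2i e2j.
have [C CE] := sum_free_pair ij Fupd.
transitivity (\sum_k F k * phi (i, j) (k i) (k j)).
  by apply: eq_bigr => k _; rewrite big_cons/= /F mulrAC mulrA.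
rewrite CE; congr (_ * _).
(* A product of two laws has total mass one, so this choice equates [C] with the sum over the
   remaining pairs, where [i] and [j] count as free vertices. *)
have := CE (fun a b => psi i a * psi j b).
have -> : \sum_a \sum_b psi i a * psi j b = 1.
  by under eq_bigr do rewrite -mulr_sumr psi1 mulr1; rewrite psi1.
rewrite mul1r => <-; rewrite -(IH ues); apply: eq_bigr => k _.
rewrite /F mulrAC; congr (_ * _).
rewrite [in RHS](bigD1 i)//= [in RHS](bigD1 j)/=; last by rewrite jN eq_sym.
rewrite mulrA mulrC; congr (_ * _).
apply: eq_bigl => l; rewrite /endpoints/= -/(endpoints es) !inE !negb_or.
by case: (l == i); case: (l == j); rewrite ?andbF ?andbT.
Qed.

End sum_over_pairs.

(** * Exponential and fourth moments *)

Section gauss_moments.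
Context {R : realType}.
Local Open Scope ereal_scope.

Lemma gam_expR (c : R) : \int[gam]_x (expR (c * x))%:E = (expR (c ^+ 2 / 2))%:E.
Proof.
have := @gam_shift R c (cst 1) (measurable_cst _) (fun=> lee01).
rewrite /= integral_gam_cst => E.
transitivity (\int[gam]_x ((expR (c ^+ 2 / 2))%:E *
    (1 * (expR (c * x - c ^+ 2 / 2))%:E))).
  by apply: eq_integral => x _; rewrite mul1e -EFinM -expRD addrC subrK.
rewrite ge0_integralZl ?lee_fin ?expR_ge0//; first by rewrite -E mule1.
- apply: emeasurable_funM => //; apply/measurable_EFinP.
  by apply: measurableT_comp => //; apply: measurable_funB => //.
Qed.

(** The inequality t <= expR t at t = y / 4, raised to the fourth power; hence 256 = 4^4. *)
Let pow4_le_expR (x : R) : (x ^+ 4 <= 256 * (expR x + expR (- x)))%R.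
Proof.
have H (y : R) : (0 <= y -> y ^+ 4 <= 256 * expR y)%R.
  move=> y0; rewrite -[X in expR X](@divfK _ 4)%R ?pnatr_eq0//.
  rewrite [(y / 4 * 4)%R]mulrC expRM_natl.
  have -> : (256 = 4 ^+ 4 :> R)%R by ring.
  rewrite -exprMn lerXn2r ?nnegrE ?mulr_ge0 ?expR_ge0//.
  have := expR_ge1Dx (y / 4); lra.
have [x0|x0] := leP 0%R x.
  by apply: (le_trans (H x x0)); rewrite ler_wpM2l// lerDl expR_ge0.
apply: (@le_trans _ _ ((- x) ^+ 4)%R); first by rewrite exprNn -signr_odd expr0 mul1r.
have nx0 : (0 <= - x)%R by rewrite oppr_ge0 ltW.
by apply: (le_trans (H _ nx0)); rewrite ler_wpM2l// lerDr expR_ge0.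
Qed.

Lemma gam_pow4_fin : \int[@gam R]_x (x ^+ 4)%:E < +oo.
Proof.
apply: (@le_lt_trans _ _ (\int[gam]_x
  (256%:E * ((expR (1 * x))%:E + (expR (- 1 * x))%:E)))).
  apply: ge0_le_integral => //.
  - by move=> x _; rewrite lee_fin exprn_even_ge0.
  - by apply/measurable_EFinP; exact: measurable_funX.
  - apply/measurable_EFinP; apply: measurable_funM => //.
    by apply: measurable_funD; apply: measurableT_comp.
  - by move=> x _; rewrite -EFinD -EFinM lee_fin mul1r mulN1r.
rewrite ge0_integralZl//; last 2 first.
- by apply/measurable_EFinP; apply: measurable_funD; apply: measurableT_comp.
- by move=> x _; rewrite adde_ge0// lee_fin expR_ge0.
rewrite ge0_integralD//; try by move=> x _; rewrite lee_fin expR_ge0.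
  2, 3: by apply/measurable_EFinP; apply: measurableT_comp.
by rewrite !gam_expR -EFinD -EFinM ltry.
Qed.

Definition gam_pow4 : R := fine (\int[@gam R]_x (x ^+ 4)%:E).

Lemma gam_pow4E : \int[@gam R]_x (x ^+ 4)%:E = gam_pow4%:E.
Proof.
rewrite /gam_pow4 fineK// ge0_fin_numE ?gam_pow4_fin//.
by apply: integral_ge0 => x _; rewrite lee_fin exprn_even_ge0.
Qed.

Lemma gam_pow4_ge0 : (0 <= gam_pow4)%R.
Proof.
by apply/fine_ge0/integral_ge0 => x _; rewrite lee_fin exprn_even_ge0.
Qed.

End gauss_moments.

(** * A correlated Gaussian pair and the sign of its correlation *)

Section correlated_pair.
Context {R : realType}.
Local Open Scope ereal_scope.
Local Notation M2 := (@gam R \x @gam R).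
Local Notation R2 := (measurableTypeR R * measurableTypeR R)%type.
Implicit Types (rho : R) (H D : R2 -> R).

(* Density, with respect to two independent standard normals, of the pair
   (x, y + rho x). *)
Definition pair_density rho (p : R2) : R :=
  expR (rho * p.1 * p.2 - (rho * p.1) ^+ 2 / 2).

Definition pair_integral rho H : \bar R :=
  \int[M2]_p (H (p.1, p.2 + rho * p.1)%R)%:E.

Lemma pair_density_ge0 rho p : (0 <= pair_density rho p)%R.
Proof. exact: expR_ge0. Qed.

Lemma measurable_pair_density rho : measurable_fun setT (pair_density rho).
Proof.
apply: measurableT_comp => //; apply: measurable_funB.
  by apply: measurable_funM => //; exact: measurable_funM.
apply: measurable_funM => //; apply: measurable_funX; exact: measurable_funM.
Qed.

Let measurable_shear rho H : measurable_fun setT H ->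
  measurable_fun setT (fun p : R2 => H (p.1, p.2 + rho * p.1)%R).
Proof.
move=> mH; apply: measurableT_comp => //; apply: measurable_fun_pair => //.
by apply: measurable_funD => //; exact: measurable_funM.
Qed.

Lemma pair_integralE rho H : measurable_fun setT H -> (forall p, (0 <= H p)%R) ->
  pair_integral rho H = \int[M2]_p (H p * pair_density rho p)%:E.
Proof.
move=> mH H0; rewrite /pair_integral.
rewrite fubini_tonelli1; first last.
- by move=> p; rewrite lee_fin.
- by apply/measurable_EFinP; exact: measurable_shear.
rewrite fubini_tonelli1; first last.
- by move=> p; rewrite lee_fin mulr_ge0// pair_density_ge0.
- apply/measurable_EFinP; apply: measurable_funM => //.
  exact: measurable_pair_density.
apply: eq_integral => x _; rewrite /fubini_F /=.
have := @gam_shift R (rho * x) (fun y => (H (x, y))%:E); apply.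
  by apply/measurable_EFinP; exact: measurableT_comp.
by move=> y; rewrite lee_fin.
Qed.

Lemma pair_integral_fst rho (f : R -> R) : measurable_fun setT f ->
  (forall x, (0 <= f x)%R) ->
  pair_integral rho (fun p => f p.1) = \int[gam]_x (f x)%:E.
Proof.
move=> mf f0; rewrite /pair_integral fubini_tonelli1.
- by apply: eq_integral => x _; rewrite /fubini_F /= integral_gam_cst.
- by apply/measurable_EFinP; exact: (measurableT_comp mf measurable_fst).
- by move=> p; rewrite lee_fin.
Qed.

Lemma pair_integral0_snd (f : R -> R) : measurable_fun setT f ->
  (forall x, (0 <= f x)%R) ->
  \int[M2]_p (f p.2)%:E = \int[gam]_x (f x)%:E.
Proof.
move=> mf f0; rewrite fubini_tonelli1.
- under eq_integral do rewrite /fubini_F /=.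
  by rewrite integral_gam_cst.
- by apply/measurable_EFinP; exact: (measurableT_comp mf measurable_snd).
- by move=> p; rewrite lee_fin.
Qed.

(** The second coordinate is y + rho x, and x is symmetric: together with [pair_integral_fst], the
    marginals do not see the sign. *)
Lemma pair_integral_sndN rho (f : R -> R) : measurable_fun setT f ->
  (forall x, (0 <= f x)%R) ->
  pair_integral (- rho) (fun p => f p.2) = pair_integral rho (fun p => f p.2).
Proof.
move=> mf f0; rewrite /pair_integral.
have h (r : R) : measurable_fun setT (fun p : R2 => (f (p.2 + r * p.1)%R)%:E).
  apply/measurable_EFinP; apply: measurableT_comp => //.
  by apply: measurable_funD => //; exact: measurable_funM.
have E (r : R) : \int[M2]_p (f (p.2 + r * p.1)%R)%:E =
    \int[gam]_x \int[gam]_y (f (y + r * x)%R)%:E.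
  by rewrite fubini_tonelli1// => p; rewrite lee_fin.
rewrite /= !E.
rewrite -(@gamN _ (fun x => \int[gam]_y (f (y + rho * x)%R)%:E)).
- by apply: eq_integral => x _; apply: eq_integral => y _; rewrite mulrN mulNr.
- apply: (@measurable_fun_fubini_tonelli_F _ _ _ _ _ gam
    (fun p : R2 => (f (p.2 + rho * p.1)%R)%:E)) => //.
  by move=> p; rewrite lee_fin.
- by move=> x; apply: integral_ge0 => y _; rewrite lee_fin.
Qed.

Lemma pair_integral_ge0 rho H : (forall p, (0 <= H p)%R) ->
  0 <= pair_integral rho H.
Proof. by move=> H0; apply: integral_ge0 => p _; rewrite lee_fin. Qed.

Lemma le_pair_integral rho H D : measurable_fun setT H -> measurable_fun setT D ->
  (forall p, (0 <= H p)%R) -> (forall p, (H p <= D p)%R) ->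
  pair_integral rho H <= pair_integral rho D.
Proof.
move=> mH mD H0 HD; apply: ge0_le_integral => //.
- by move=> p _; rewrite lee_fin.
- by apply/measurable_EFinP; exact: measurable_shear.
- by apply/measurable_EFinP; exact: measurable_shear.
- by move=> p _; rewrite lee_fin.
Qed.

Lemma pair_integral_cst rho (c : R) : (0 <= c)%R ->
  pair_integral rho (cst c) = c%:E.
Proof.
move=> c0.
rewrite /pair_integral fubini_tonelli1.
- under eq_integral do rewrite /fubini_F /= integral_gam_cst.
  exact: integral_gam_cst.
- by apply/measurable_EFinP.
- by move=> p; rewrite lee_fin.
Qed.

Lemma pair_integralD rho H D : measurable_fun setT H -> measurable_fun setT D ->
  (forall p, (0 <= H p)%R) -> (forall p, (0 <= D p)%R) ->
  pair_integral rho (fun p => H p + D p)%R =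
  pair_integral rho H + pair_integral rho D.
Proof.
move=> mH mD H0 D0; rewrite /pair_integral -ge0_integralD//.
- by move=> p _; rewrite lee_fin.
- by apply/measurable_EFinP; exact: measurable_shear.
- by move=> p _; rewrite lee_fin.
- by apply/measurable_EFinP; exact: measurable_shear.
Qed.

Lemma pair_integralZ rho (c : R) H : measurable_fun setT H -> (0 <= c)%R ->
  (forall p, (0 <= H p)%R) ->
  pair_integral rho (fun p => c * H p)%R = c%:E * pair_integral rho H.
Proof.
move=> mH c0 H0; rewrite /pair_integral -ge0_integralZl//.
- by apply/measurable_EFinP; exact: measurable_shear.
- by move=> p _; rewrite lee_fin.
Qed.

(** For u = rho x y, the two densities are expR u and expR (- u) times a common factor. The bound is
    relative to the densities themselves, so that integrating it only calls for moments under the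
    same two pair laws. *)
Lemma pair_density_diff rho p : (0 <= rho)%R ->
  (`|pair_density rho p - pair_density (- rho) p| <=
   2 * rho * `|p.1 * p.2| * (pair_density rho p + pair_density (- rho) p))%R.
Proof.
move=> rho0; pose u := (rho * p.1 * p.2)%R.
have uE : (rho * `|p.1 * p.2| = `|u|)%R.
  by rewrite /u -mulrA [in RHS]normrM (ger0_norm rho0).
have -> : (2 * rho * `|p.1 * p.2| = 2 * `|u|)%R by rewrite -uE mulrA.
pose g := expR (- ((rho * p.1) ^+ 2 / 2)).
have -> : pair_density rho p = (expR u * g)%R by rewrite -expRD.
have -> : pair_density (- rho) p = (expR (- u) * g)%R.
  by rewrite -expRD /pair_density /u !mulNr sqrrN.
have H (t : R) : (0 <= t -> `|expR t - expR (- t)| <= 2 * `|t| * (expR t + expR (- t)))%R.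
  move=> t0; rewrite (ger0_norm t0) ger0_norm; last by rewrite subr_ge0 ler_expR; lra.
  have h1 := expR_ge1Dx (- (2 * t)).
  have h2 : (expR (- t) = expR t * expR (- (2 * t)))%R by rewrite -expRD; congr expR; ring.
  have h3 : (expR t * (1 - 2 * t) <= expR (- t))%R by rewrite h2 ler_pM2l ?expR_gt0.
  have h4 : (0 <= 2 * t * expR (- t))%R by rewrite mulr_ge0 ?expR_ge0// mulr_ge0.
  by lra.
rewrite -mulrBl -mulrDl normrM (@ger0_norm _ g) ?expR_ge0//.
have {H} H : (`|expR u - expR (- u)| <= 2 * `|u| * (expR u + expR (- u)))%R.
  have [u0|/ltW u0] := leP 0%R u; first exact: H.
  by have := H (- u)%R; rewrite oppr_ge0 opprK normrN distrC [(expR (- u) + _)%R]addrC; apply.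
by rewrite mulrA ler_wpM2r// expR_ge0.
Qed.

End correlated_pair.

(** * Hellinger affinity of a privatized pair under the two signs *)

Section private_pair.
Context {R : realType}.
Local Notation M2 := (@gam R \x @gam R)%E.
Local Notation R2 := (measurableTypeR R * measurableTypeR R)%type.
Implicit Types (rho : R).

(** Recovers the Cauchy-Schwarz form from the additive one by taking theta = x / A; when A is zero,
    a large theta makes the bound smaller than a positive x. *)
Let sqr_le_of_scaled (x A B : R) : 0 <= x -> 0 <= A -> 0 <= B ->
  (forall theta, 0 < theta -> x <= (theta * A + B / theta) / 2) ->
  x ^+ 2 <= A * B.
Proof.
move=> x0 A0 B0 H; have [->|xn0] := eqVneq x 0; first by rewrite expr0n mulr_ge0.
have xp : 0 < x by rewrite lt_neqAle eq_sym xn0.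
have [A00|An0] := eqVneq A 0.
  have := H ((B + 1) / x); rewrite A00 mulr0 add0r divr_gt0//; last by lra.
  move=> /(_ isT); rewrite invf_div mulrA.
  have : B * x / (B + 1) <= x by rewrite ler_pdivrMr//; nra.
  by lra.
have Ap : 0 < A by rewrite lt_neqAle eq_sym An0.
have := H (x / A); rewrite divr_gt0// => /(_ isT).
rewrite divfK// invf_div mulrA => h.
have {}h : x <= B * A / x by lra.
by move: h; rewrite ler_pdivlMr// expr2 mulrC [B * A]mulrC.
Qed.

(** The integral of 5 + 3 x^4 + 2 y^4 over two independent standard normals, a common bound for the
    two pair moments used below. *)
Let mom : R := 5 * (1 + @gam_pow4 R).

Let mom_ge0 : 0 <= mom.
Proof. by rewrite mulr_ge0// addr_ge0// gam_pow4_ge0. Qed.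

Let measurable_pow4 : measurable_fun setT (fun x : R => x ^+ 4).
Proof. exact: measurable_funX. Qed.

Let pair_moment_le rho (H : R2 -> R) : measurable_fun setT H ->
  (forall p, 0 <= H p) ->
  (forall x y, H (x, y + rho * x) <= 5 + (3 * x ^+ 4 + 2 * y ^+ 4)) ->
  (pair_integral rho H <= mom%:E)%E.
Proof.
move=> mH H0 Hle.
have m1 : measurable_fun setT (fun p : R2 => (p.1 ^+ 4)%:E).
  by apply/measurable_EFinP; exact: (measurableT_comp measurable_pow4 measurable_fst).
have m2 : measurable_fun setT (fun p : R2 => (p.2 ^+ 4)%:E).
  by apply/measurable_EFinP; exact: (measurableT_comp measurable_pow4 measurable_snd).
have p0 (x : R) : 0 <= x ^+ 4 by rewrite exprn_even_ge0.
have p0E (x : R) : (0 <= (x ^+ 4)%:E)%E by rewrite lee_fin.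
have I1 : (\int[M2]_p (p.1 ^+ 4)%:E = (@gam_pow4 R)%:E)%E.
  by rewrite -gam_pow4E -(pair_integral_fst 0 measurable_pow4).
have I2 : (\int[M2]_p (p.2 ^+ 4)%:E = (@gam_pow4 R)%:E)%E.
  by rewrite -gam_pow4E -(pair_integral0_snd measurable_pow4).
have I0 : (\int[M2]_p (5 : R)%:E = (5 : R)%:E)%E.
  exact: (@pair_integral_cst R 0 5).
apply: (@le_trans _ _ (\int[M2]_p ((5 : R)%:E + ((3 : R)%:E * (p.1 ^+ 4)%:E + (2 : R)%:E * (p.2 ^+ 4)%:E))))%E.
  apply: ge0_le_integral => //.
  - by move=> p _; rewrite lee_fin.
  - apply/measurable_EFinP; apply: measurableT_comp => //.
    apply: measurable_fun_pair => //.
    by apply: measurable_funD => //; exact: measurable_funM.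
  - by apply: emeasurable_funD => //; apply: emeasurable_funD;
      apply: emeasurable_funM.
  - by move=> [x y] _; rewrite -!EFinM -!EFinD lee_fin /=.
rewrite ge0_integralD//; last 2 first.
- by move=> p _; rewrite adde_ge0// mule_ge0.
- by apply: emeasurable_funD; apply: emeasurable_funM.
rewrite ge0_integralD//; last 4 first.
- by move=> p _; rewrite mule_ge0.
- by apply: emeasurable_funM.
- by move=> p _; rewrite mule_ge0.
- by apply: emeasurable_funM.
rewrite !ge0_integralZl// I0 I1 I2 -!EFinM -!EFinD lee_fin /mom; lra.
Qed.

Let measurable_fst2 : measurable_fun setT (fun p : R2 => p.1 : R).
Proof. exact: measurable_fst. Qed.

Let measurable_snd2 : measurable_fun setT (fun p : R2 => p.2 : R).
Proof. exact: measurable_snd. Qed.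

Let measurable_sumsq : measurable_fun setT (fun p : R2 => p.1 ^+ 2 + p.2 ^+ 2).
Proof. by apply: measurable_funD; apply: measurable_funX. Qed.

Let measurable_prodsq : measurable_fun setT (fun p : R2 => (p.1 * p.2) ^+ 2).
Proof. by apply: measurable_funX; apply: measurable_funM. Qed.

Let pair_sumsq_le rho : `|rho| <= 1 ->
  (pair_integral rho (fun p => (p.1 ^+ 2 + p.2 ^+ 2)%R) <= mom%:E)%E.
Proof.
move=> /ler_normlP[r1 r2]; apply: pair_moment_le => //.
  by move=> p; rewrite addr_ge0// sqr_ge0.
move=> x y /=; have rr : rho ^+ 2 <= 1 by nra.
have h1 : (rho * x) ^+ 2 <= x ^+ 2.
  by rewrite exprMn ler_piMl ?sqr_ge0.
have := sqr_ge0 (y - rho * x).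
have := sqr_ge0 (x ^+ 2 - 1); have := sqr_ge0 (y ^+ 2 - 1).
have := sqr_ge0 (x ^+ 2); have := sqr_ge0 (y ^+ 2).
by move: h1; rewrite !exprMn; nra.
Qed.

Let pair_prodsq_le rho : `|rho| <= 1 ->
  (pair_integral rho (fun p => ((p.1 * p.2) ^+ 2)%R) <= mom%:E)%E.
Proof.
move=> /ler_normlP[r1 r2]; apply: pair_moment_le => //.
  by move=> p; rewrite sqr_ge0.
move=> x y /=; have rr : rho ^+ 2 <= 1 by nra.
have h1 : (rho * x ^+ 2) ^+ 2 <= x ^+ 4.
  by rewrite exprMn -exprM ler_piMl// exprn_even_ge0.
have := sqr_ge0 (x * y - rho * x ^+ 2).
have := sqr_ge0 (x ^+ 2 - y ^+ 2).
have -> : (x * (y + rho * x)) ^+ 2 = (x * y + rho * x ^+ 2) ^+ 2 by ring.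
rewrite !sqrrD !sqrrN.
have -> : (x * y) ^+ 2 = x ^+ 2 * y ^+ 2 by ring.
have -> : (x ^+ 2) ^+ 2 = x ^+ 4 by ring.
have -> : (y ^+ 2) ^+ 2 = y ^+ 4 by ring.
have : 0 <= y ^+ 4 by rewrite exprn_even_ge0.
by lra.
Qed.

(** Integrating [pair_density_diff] against [H]. Both signs of [sg] are covered because the absolute
    value of the difference is needed. *)
Let pair_diff_le rho sg (H D : R2 -> R) : 0 <= rho -> (sg = rho \/ sg = - rho) ->
  measurable_fun setT H -> measurable_fun setT D ->
  (forall p, 0 <= H p) ->
  (forall p, 2 * rho * `|p.1 * p.2| * H p <= D p) ->
  (pair_integral sg H <= pair_integral (- sg) H +
     (pair_integral rho D + pair_integral (- rho) D))%E.
Proof.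
move=> r0 sgE mH mD H0 HD.
have D0 p : 0 <= D p by apply: le_trans (HD p); rewrite !mulr_ge0.
have mW s (F : R2 -> R) : measurable_fun setT F ->
    measurable_fun setT (fun p : R2 => (F p * pair_density s p)%:E).
  move=> mF; apply/measurable_EFinP; apply: measurable_funM => //.
  exact: measurable_pair_density.
have W0 s (F : R2 -> R) : (forall p, 0 <= F p) ->
    forall p, (0 <= (F p * pair_density s p)%:E)%E.
  by move=> F0 p; rewrite lee_fin mulr_ge0// pair_density_ge0.
rewrite !pair_integralE// -!ge0_integralD//; try exact: mW;
  try by move=> p _; exact: W0.
2: by move=> p _; rewrite adde_ge0// W0.
2: by apply: emeasurable_funD; exact: mW.
apply: ge0_le_integral => //; try by move=> p _; exact: W0.
- exact: mW.
- by apply: emeasurable_funD; [|apply: emeasurable_funD]; exact: mW.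
move=> p _; rewrite -!EFinD lee_fin -mulrDr.
have h : `|pair_density sg p - pair_density (- sg) p| <=
    2 * rho * `|p.1 * p.2| * (pair_density rho p + pair_density (- rho) p).
  case: sgE => ->; first exact: pair_density_diff.
  by rewrite opprK distrC; exact: pair_density_diff.
rewrite -lerBlDl -mulrBr.
apply: (@le_trans _ _ (H p * `|pair_density sg p - pair_density (- sg) p|)).
  by rewrite ler_wpM2l// ler_norm.
apply: (le_trans (ler_wpM2l (H0 p) h)).
rewrite mulrA ler_wpM2r ?addr_ge0 ?pair_density_ge0//.
by rewrite mulrC.
Qed.

Context {K : finType} (alpha : R) (q q' : K -> R -> R).
Hypotheses (alpha0 : 0 < alpha).
Hypotheses (mq : forall a, measurable_fun setT (q a))
  (q0 : forall a x, 0 <= q a x) (q1 : forall x, \sum_a q a x = 1)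
  (qp : forall a x y, q a x <= expR alpha * q a y).
Hypotheses (mq' : forall a, measurable_fun setT (q' a))
  (q'0 : forall a x, 0 <= q' a x) (q'1 : forall x, \sum_a q' a x = 1)
  (q'p : forall a x y, q' a x <= expR alpha * q' a y).

Let qq a b (p : R2) := q a p.1 * q' b p.2.

Definition pair_prob rho a b : R := fine (pair_integral rho (qq a b)).

Let qq0 a b p : 0 <= qq a b p. Proof. exact: mulr_ge0. Qed.

Let mqq a b : measurable_fun setT (qq a b).
Proof.
by apply: measurable_funM; [exact: (measurableT_comp (mq a) measurable_fst)|
  exact: (measurableT_comp (mq' b) measurable_snd)].
Qed.

Let pair_integral_total rho (g : R2 -> R) : measurable_fun setT g ->
  (forall p, 0 <= g p) ->
  (\sum_a \sum_b pair_integral rho (fun p => qq a b p * g p)%R =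
   pair_integral rho g)%E.
Proof.
move=> mg g0.
have mh a b : measurable_fun setT
    (fun p : R2 => (qq a b (p.1, p.2 + rho * p.1) * g (p.1, p.2 + rho * p.1))%:E).
  apply/measurable_EFinP.
  apply: (measurableT_comp (measurable_funM (mqq a b) mg)).
  apply: measurable_fun_pair => //.
  by apply: measurable_funD => //; exact: measurable_funM.
have h0 a b p : (0 <= (qq a b (p.1, p.2 + rho * p.1) *
    g (p.1, p.2 + rho * p.1))%:E)%E by rewrite lee_fin mulr_ge0.
rewrite /pair_integral.
under eq_bigr do rewrite -ge0_integral_sum//.
rewrite -ge0_integral_sum//; last 2 first.
- by move=> a; apply: emeasurable_sum => b; exact: mh.
- by move=> a p _; apply: sume_ge0 => b _; exact: h0.
apply: eq_integral => p _.
under eq_bigr do rewrite sumEFin.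
rewrite sumEFin; congr EFin.
under eq_bigr do rewrite -mulr_suml.
rewrite -mulr_suml.
under eq_bigr do rewrite /qq /= -mulr_sumr q'1 mulr1.
by rewrite q1 mul1r.
Qed.

Let q_le1 a x : q a x <= 1.
Proof. by rewrite -(q1 x) (bigD1 a)//= lerDl sumr_ge0. Qed.

Let q'_le1 a x : q' a x <= 1.
Proof. by rewrite -(q'1 x) (bigD1 a)//= lerDl sumr_ge0. Qed.

Lemma pair_probE rho a b : pair_integral rho (qq a b) = (pair_prob rho a b)%:E.
Proof.
rewrite /pair_prob fineK// ge0_fin_numE; last exact: pair_integral_ge0.
apply: (@le_lt_trans _ _ (pair_integral rho (cst 1))).
  by apply: le_pair_integral => // p; rewrite mulr_ile1.
by rewrite pair_integral_cst// ltry.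
Qed.

Lemma pair_prob_ge0 rho a b : 0 <= pair_prob rho a b.
Proof. by apply: fine_ge0; exact: pair_integral_ge0. Qed.

Lemma sum_pair_prob rho : \sum_a \sum_b pair_prob rho a b = 1.
Proof.
have := @pair_integral_total rho (cst 1) (measurable_cst _) (fun=> ler01).
rewrite pair_integral_cst// => E; apply: EFin_inj; rewrite -E -sumEFin.
apply: eq_bigr => a _; rewrite -sumEFin; apply: eq_bigr => b _.
by rewrite -pair_probE; congr pair_integral; apply: funext => p; rewrite mulr1.
Qed.

Section with_correlation.
Variable rho : R.
Hypotheses (rho0 : 0 <= rho) (rho1 : rho <= 1).

Let P a b := pair_prob rho a b.
Let Q a b := pair_prob (- rho) a b.

Let rho_norm : `|rho| <= 1. Proof. by rewrite ger0_norm. Qed.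
Let rhoN_norm : `|- rho| <= 1. Proof. by rewrite normrN ger0_norm. Qed.

Let affinity_of_bound (E : K -> K -> R) (B : R) :
  (forall a b, 0 <= E a b) ->
  (forall a b, (P a b - Q a b) ^+ 2 <= (P a b + Q a b) * E a b) ->
  \sum_a \sum_b E a b <= B ->
  1 - B / 2 <= \sum_a \sum_b Num.sqrt (P a b * Q a b).
Proof.
move=> E0 PQE EB.
apply: (@le_trans _ _ (\sum_a \sum_b ((P a b + Q a b) / 2 - E a b / 2))).
  under eq_bigr do rewrite sumrB -!mulr_suml big_split/=.
  rewrite sumrB -!mulr_suml big_split/= !sum_pair_prob.
  by lra.
apply: ler_sum => a _; apply: ler_sum => b _.
by apply: affinity_ge; rewrite ?pair_prob_ge0.
Qed.

(* The channel is ignored: the bound for the unprivatized pair. *)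
Let affinity_large : 1 - 4 * mom * rho ^+ 2 <= \sum_a \sum_b Num.sqrt (P a b * Q a b).
Proof.
pose S s a b := fine (pair_integral s (fun p => qq a b p * (p.1 * p.2) ^+ 2)).
have m2 a b : measurable_fun setT (fun p => qq a b p * (p.1 * p.2) ^+ 2).
  exact: measurable_funM.
have g2 a b p : 0 <= qq a b p * (p.1 * p.2) ^+ 2 by rewrite mulr_ge0 ?sqr_ge0.
have SE s a b : `|s| <= 1 ->
    pair_integral s (fun p => qq a b p * (p.1 * p.2) ^+ 2) = (S s a b)%:E.
  move=> s1; rewrite /S fineK// ge0_fin_numE; last exact: pair_integral_ge0.
  apply: le_lt_trans (ltry mom); apply: le_trans (pair_prodsq_le s1).
  apply: le_pair_integral => // p; rewrite ler_piMl ?sqr_ge0//.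
  exact: mulr_ile1.
have S0 s a b : 0 <= S s a b by apply/fine_ge0/pair_integral_ge0.
have Ssum s : `|s| <= 1 -> \sum_a \sum_b S s a b <= mom.
  move=> s1; rewrite -lee_fin -sumEFin.
  apply: le_trans (pair_prodsq_le s1).
  rewrite -(@pair_integral_total s (fun p => (p.1 * p.2) ^+ 2))//; last first.
    by move=> p; rewrite sqr_ge0.
  by apply: lee_sum => a _; rewrite -sumEFin; apply: lee_sum => b _; rewrite SE.
pose E a b := 4 * rho ^+ 2 * (S rho a b + S (- rho) a b).
have -> : 4 * mom * rho ^+ 2 = (8 * mom * rho ^+ 2) / 2 by lra.
apply: (@affinity_of_bound E).
- by move=> a b; rewrite !mulr_ge0 ?sqr_ge0 ?addr_ge0.
- move=> a b; rewrite -real_normK ?num_real//.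
  apply: sqr_le_of_scaled => //.
  + by rewrite addr_ge0 ?pair_prob_ge0.
  + by rewrite !mulr_ge0 ?sqr_ge0 ?addr_ge0.
  (* The factor 2 rho |x y| is at most [c1 + c2 * (x * y) ^+ 2] by the arithmetic-geometric
     inequality; [sqr_le_of_scaled] then optimizes over [th]. *)
  move=> th th0; pose c1 := th / 2; pose c2 := 2 * rho ^+ 2 / th.
  have c10 : 0 <= c1 by rewrite divr_ge0 ?(ltW th0).
  have c20 : 0 <= c2 by rewrite divr_ge0 ?(ltW th0)// mulr_ge0 ?sqr_ge0.
  pose D (p : R2) := c1 * qq a b p + c2 * (qq a b p * (p.1 * p.2) ^+ 2).
  have mD : measurable_fun setT D.
    by apply: measurable_funD; exact: measurable_funM.
  have HD p : 2 * rho * `|p.1 * p.2| * qq a b p <= D p.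
    have -> : D p = (c1 + c2 * (p.1 * p.2) ^+ 2) * qq a b p by rewrite /D; ring.
    rewrite ler_wpM2r//.
    rewrite -subr_ge0 /c1 /c2 -[(p.1 * p.2) ^+ 2]real_normK ?num_real//.
    set t := `|_|.
    have -> : th / 2 + 2 * rho ^+ 2 / th * t ^+ 2 - 2 * rho * t =
      (th - 2 * rho * t) ^+ 2 / (2 * th) by field; rewrite gt_eqF.
    by rewrite divr_ge0 ?sqr_ge0// mulr_ge0// ltW.
  have DE s : `|s| <= 1 -> pair_integral s D =
      (c1 * pair_prob s a b + c2 * S s a b)%:E.
    move=> s1; rewrite pair_integralD//; last 4 first.
    - exact: measurable_funM.
    - exact: measurable_funM.
    - by move=> p; rewrite mulr_ge0.
    - by move=> p; rewrite mulr_ge0.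
    by rewrite !pair_integralZ// pair_probE SE.
  have tE : (th * (P a b + Q a b) + E a b / th) / 2 =
      (c1 * P a b + c2 * S rho a b) + (c1 * Q a b + c2 * S (- rho) a b).
    by rewrite /E /c1 /c2; field; rewrite gt_eqF.
  have := @pair_diff_le rho rho (qq a b) D rho0 (or_introl erefl) (mqq a b) mD
    (qq0 a b) HD.
  have := @pair_diff_le rho (- rho) (qq a b) D rho0 (or_intror erefl) (mqq a b) mD
    (qq0 a b) HD.
  rewrite opprK !DE// !pair_probE -!EFinD !lee_fin -tE => h1 h2.
  by rewrite ler_norml -/(P a b) -/(Q a b) in h1 h2 *; apply/andP; split; lra.
- rewrite /E; under eq_bigr do rewrite -mulr_sumr big_split/=.
  rewrite -mulr_sumr big_split/= -mulrA mulrC.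
  have := Ssum _ rho_norm; have := Ssum _ rhoN_norm.
  set s1 := \sum_a _; set s2 := \sum_a _ => h1 h2.
  have -> : 8 * mom * rho ^+ 2 = (rho ^+ 2 * (2 * mom)) * 4 by ring.
  by rewrite ler_wpM2r// ler_wpM2l ?sqr_ge0//; lra.
Qed.

(* The channels see only the interaction of the two coordinates, the marginals
   being the same for both signs, whence the fourth power. *)
Let affinity_small : 1 - (expR (2 * alpha) - 1) ^+ 4 * mom ^+ 2 * rho ^+ 2 <=
  \sum_a \sum_b Num.sqrt (P a b * Q a b).
Proof.
pose del := expR (2 * alpha) - 1.
have del0 : 0 <= del.
  by rewrite subr_ge0 -[leLHS]expR0 ler_expR mulr_ge0// ltW.
(* By privacy [c a] lies below [q a] everywhere, the base point 0 being arbitrary, and the excess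
   [u a] stays between 0 and [del * c a]. The same holds for [c'] and [u']. *)
pose c a := expR (- alpha) * q a 0; pose c' b := expR (- alpha) * q' b 0.
have c0 a : 0 <= c a by rewrite mulr_ge0 ?expR_ge0.
have c'0 a : 0 <= c' a by rewrite mulr_ge0 ?expR_ge0.
have clow (r r' : R) : r <= expR alpha * r' -> expR (- alpha) * r <= r'.
  by rewrite expRN [_^-1 * _]mulrC ler_pdivrMr ?expR_gt0// [r' * _]mulrC.
have cup (r r' : R) : r <= expR alpha * r' ->
    r - expR (- alpha) * r' <= del * (expR (- alpha) * r').
  move=> h; rewrite mulrBl mul1r lerD2r mulrA -expRD.
  by rewrite (_ : 2 * alpha + - alpha = alpha)//; ring.
pose u a x := q a x - c a; pose u' b x := q' b x - c' b.
have u0 a x : 0 <= u a x by rewrite subr_ge0; exact: clow.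
have u'0 a x : 0 <= u' a x by rewrite subr_ge0; exact: clow.
have udel a x : u a x <= del * c a by exact: cup.
have u'del a x : u' a x <= del * c' a by exact: cup.
have mu a : measurable_fun setT (fun p : R2 => u a p.1).
  by apply: measurable_funB => //; exact: (measurableT_comp (mq a) measurable_fst).
have mu' a : measurable_fun setT (fun p : R2 => u' a p.2).
  by apply: measurable_funB => //; exact: (measurableT_comp (mq' a) measurable_snd).
have m1 a : measurable_fun setT (u a) by apply: measurable_funB.
have m1' a : measurable_fun setT (u' a) by apply: measurable_funB.
pose h a b (p : R2) := u a p.1 * u' b p.2.
have mh a b : measurable_fun setT (h a b) by exact: measurable_funM.
have h0 a b p : 0 <= h a b p by rewrite mulr_ge0.
(* The product of the two channels is a function of the first coordinate, plus one of the second,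
   plus the product [h] of the two excesses. Only [h] feels the sign of the correlation, and all
   three terms are nonnegative. *)
pose f a b (x : R) := c a * c' b + c' b * u a x.
pose g a b (x : R) := c a * u' b x.
have qqE a b : qq a b = fun p => f a b p.1 + (g a b p.2 + h a b p).
  by apply: funext => p; rewrite /qq /f /g /h /u /u'; ring.
have mf a b : measurable_fun setT (f a b).
  by apply: measurable_funD => //; exact: measurable_funM.
have mg a b : measurable_fun setT (g a b) by exact: measurable_funM.
have f0 a b x : 0 <= f a b x by rewrite addr_ge0 ?mulr_ge0.
have g0 a b x : 0 <= g a b x by rewrite mulr_ge0.
pose B a b : R := del ^+ 2 * (c a * c' b).
pose D a b (p : R2) := (rho * B a b) * (p.1 ^+ 2 + p.2 ^+ 2).
have B0 a b : 0 <= B a b by rewrite !mulr_ge0 ?sqr_ge0.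
have hB a b p : h a b p <= B a b.
  have -> : B a b = (del * c a) * (del * c' b) by rewrite /B; ring.
  by rewrite ler_pM.
have HD a b p : 2 * rho * `|p.1 * p.2| * h a b p <= D a b p.
  have -> : 2 * rho * `|p.1 * p.2| * h a b p =
      rho * (h a b p * (2 * `|p.1 * p.2|)) by ring.
  rewrite /D -mulrA ler_wpM2l//.
  have t1 : 2 * `|p.1 * p.2| <= p.1 ^+ 2 + p.2 ^+ 2.
    rewrite normrM -[p.1 ^+ 2]real_normK ?num_real//.
    rewrite -[p.2 ^+ 2]real_normK ?num_real//.
    by have := sqr_ge0 (`|p.1| - `|p.2|); rewrite sqrrB; lra.
  by rewrite ler_pM.
have mD a b : measurable_fun setT (D a b) by exact: measurable_funM.
have DE s a b : `|s| <= 1 ->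
    (pair_integral s (D a b) <= (rho * B a b * mom)%:E)%E.
  move=> s1; rewrite pair_integralZ//; last 2 first.
  - by rewrite mulr_ge0.
  - by move=> p; rewrite addr_ge0 ?sqr_ge0.
  rewrite [(rho * B a b * mom)%:E]EFinM lee_wpmul2l ?lee_fin ?mulr_ge0//.
  exact: pair_sumsq_le.
have PE s a b : pair_integral s (qq a b) =
   (pair_integral s (fun p => f a b p.1) + (pair_integral s (fun p => g a b p.2) +
    pair_integral s (h a b)))%E.
  have mf1 := measurableT_comp (mf a b) measurable_fst2.
  have mg2 := measurableT_comp (mg a b) measurable_snd2.
  rewrite qqE pair_integralD//.
  - by congr (_ + _)%E; rewrite pair_integralD// => p; exact: g0.
  - exact: measurable_funD.
  - by move=> p; rewrite addr_ge0.
have diff s a b : s = rho \/ s = - rho ->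
    pair_prob s a b <= pair_prob (- s) a b + 2 * (rho * B a b * mom).
  move=> sE; rewrite -lee_fin EFinD -!pair_probE !PE !pair_integral_fst//.
  rewrite pair_integral_sndN//.
  have le_h : (pair_integral s (h a b) <=
      pair_integral (- s) (h a b) + (2 * (rho * B a b * mom))%:E)%E.
    apply: (le_trans (pair_diff_le rho0 sE (mh a b) (mD a b) (h0 a b) (HD a b))).
    rewrite leeD2l// (_ : 2 * _ = rho * B a b * mom + rho * B a b * mom).
      by rewrite EFinD leeD// DE.
    by ring.
  move: le_h; move: (pair_integral s (h a b)) (pair_integral (- s) (h a b)) => x y.
  move: (\int[gam]_x0 _)%E (pair_integral s _) => z t xy.
  by rewrite -(addeA z) leeD2l// -addeA leeD2l.
have Plow s a b : c a * c' b <= pair_prob s a b.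
  rewrite -lee_fin -pair_probE -(@pair_integral_cst _ s); last by rewrite mulr_ge0.
  apply: le_pair_integral => //.
  - by move=> p; rewrite mulr_ge0.
  - by move=> p; rewrite /qq /= ler_pM//; exact: clow.
pose E a b := 2 * (del ^+ 4 * mom ^+ 2 * rho ^+ 2) * (c a * c' b).
have -> : (expR (2 * alpha) - 1) ^+ 4 * mom ^+ 2 * rho ^+ 2 =
  2 * (del ^+ 4 * mom ^+ 2 * rho ^+ 2) / 2 by rewrite /del; lra.
have k0 : 0 <= 2 * (del ^+ 4 * mom ^+ 2 * rho ^+ 2).
  by rewrite mulr_ge0// mulr_ge0 ?sqr_ge0// mulr_ge0 ?sqr_ge0// exprn_ge0.
apply: (@affinity_of_bound E).
- by move=> a b; rewrite mulr_ge0// mulr_ge0.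
- move=> a b; have cc0 : 0 <= c a * c' b by rewrite mulr_ge0.
  have d1 := diff rho a b (or_introl erefl).
  have d2 := diff (- rho) a b (or_intror erefl).
  rewrite opprK in d2.
  have h1 : `|P a b - Q a b| <= 2 * (rho * B a b * mom).
    by rewrite ler_norml /P /Q; apply/andP; split; lra.
  have h2 : (P a b - Q a b) ^+ 2 <= (2 * (rho * B a b * mom)) ^+ 2.
    rewrite -[leLHS]real_normK ?num_real// lerXn2r ?nnegrE//.
    exact: le_trans (normr_ge0 _) h1.
  apply: (le_trans h2).
  have -> : (2 * (rho * B a b * mom)) ^+ 2 = (c a * c' b + c a * c' b) * E a b.
    by rewrite /E /B; ring.
  by rewrite ler_wpM2r ?lerD ?Plow// mulr_ge0.
(* Both [c] and [c'] have total mass [expR (- alpha)], at most one, so the bound does not grow with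
   the number of outcomes. *)
- rewrite /E; under eq_bigr do rewrite -mulr_sumr -mulr_sumr.
  rewrite -mulr_sumr -[leRHS]mulr1 ler_wpM2l//.
  have s1 : \sum_a c a = expR (- alpha) by rewrite -mulr_sumr q1 mulr1.
  have s1' : \sum_a c' a = expR (- alpha) by rewrite -mulr_sumr q'1 mulr1.
  rewrite s1' -mulr_suml s1 -expRD -[leRHS]expR0 ler_expR.
  by rewrite -opprD oppr_le0 addr_ge0 ?(ltW alpha0).
Qed.

(** The first term serves [alpha <= 1], where expR (2 alpha) - 1 <= 2 alpha expR 2 turns the fourth
    power of the oscillation into 16 expR 2 ^ 4 alpha ^ 4; the second term serves [alpha > 1], where
    the unprivatized bound suffices. *)
Definition pair_const : R := 16 * expR 2 ^+ 4 * mom ^+ 2 + 4 * mom.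

Lemma private_pair_affinity : 1 - pair_const * Num.min (alpha ^+ 4) 1 * rho ^+ 2 <=
  \sum_a \sum_b Num.sqrt (pair_prob rho a b * pair_prob (- rho) a b).
Proof.
have k1 : 0 <= 16 * expR 2 ^+ 4 * mom ^+ 2.
  by rewrite mulr_ge0 ?sqr_ge0// mulr_ge0// exprn_ge0// expR_ge0.
have k2 : 0 <= 4 * mom by rewrite mulr_ge0.
have [a1|a1] := leP alpha 1; last first.
  have -> : Num.min (alpha ^+ 4) 1 = 1.
    by apply/min_idPr; rewrite exprn_ege1// ltW.
  apply: le_trans affinity_large; rewrite mulr1 lerD2l lerN2.
  by rewrite ler_wpM2r ?sqr_ge0// /pair_const lerDr.
have -> : Num.min (alpha ^+ 4) 1 = alpha ^+ 4.
  by apply/min_idPl; rewrite exprn_ile1// ltW.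
apply: le_trans affinity_small; rewrite lerD2l lerN2 ler_wpM2r ?sqr_ge0//.
apply: (@le_trans _ _ (16 * expR 2 ^+ 4 * mom ^+ 2 * alpha ^+ 4)); last first.
  by rewrite ler_wpM2r ?exprn_ge0 ?(ltW alpha0)// /pair_const lerDl.
have -> : 16 * expR 2 ^+ 4 * mom ^+ 2 * alpha ^+ 4 =
  (2 * alpha * expR 2) ^+ 4 * mom ^+ 2 by ring.
rewrite ler_wpM2r ?sqr_ge0//.
have h1 : 1 <= expR (2 * alpha).
  by rewrite -[leLHS]expR0 ler_expR mulr_ge0// ltW.
have h2 : expR (2 * alpha) <= expR 2 by rewrite ler_expR; lra.
have h3 := expR_ge1Dx (- (2 * alpha)).
have h4 : expR (2 * alpha) * expR (- (2 * alpha)) = 1 by rewrite -expRD subrr expR0.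
have a0 := ltW alpha0.
rewrite lerXn2r ?nnegrE ?subr_ge0 ?mulr_ge0 ?expR_ge0//.
by nra.
Qed.

End with_correlation.

Lemma pair_const_ge0 : 0 <= pair_const.
Proof.
by rewrite addr_ge0// mulr_ge0 ?sqr_ge0// mulr_ge0// exprn_ge0// expR_ge0.
Qed.

End private_pair.

(** * Tensorization along a matching *)

Section matching.
Context {R : realType} {N : nat} {K : finType} (alpha sa : R).
Implicit Types (es : seq ('I_N * 'I_N)) (b : 'I_N -> R) (rho : R)
  (k : {ffun 'I_N -> K}).

Variable q : 'I_N -> K -> R -> R.
Hypotheses (alpha0 : 0 < alpha)
  (mq : forall i a, measurable_fun setT (q i a))
  (q0 : forall i a x, 0 <= q i a x) (q1 : forall i x, \sum_a q i a x = 1)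
  (qp : forall i a x y, q i a x <= expR alpha * q i a y).

(** The pair (x, y + rho x), scaled by [sa] and placed on the endpoints of an edge: the first column
    carries x and the second one y. *)
Definition edge_cols rho (e : 'I_N * 'I_N) : seq ('I_N -> R) :=
  [:: (fun i => sa * (basis_fun e.1 i + rho * basis_fun e.2 i));
      (fun i => sa * basis_fun e.2 i)].

Definition matching_cols rho es := flatten [seq edge_cols rho e | e <- es].

Definition channel_prob k (v : 'I_N -> R) : \bar R :=
  (\prod_i q i (k i) (v i))%:E.

Lemma vmeasurable_channel_prob k : vmeasurable (channel_prob k).
Proof.
move=> d T v mv; apply/measurable_EFinP; apply: measurable_prod => i _.
exact: measurableT_comp.
Qed.

Lemma channel_prob_ge0 k v : (0 <= channel_prob k v)%E.
Proof. by rewrite lee_fin prodr_ge0. Qed.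

(** The channels after conditioning: the contribution of all other columns is frozen in [b]. An
    affine change of input preserves privacy, so the pair bound holds uniformly in [b]. *)
Let qs b (i : 'I_N) : K -> R -> R := fun a x => q i a (b i + sa * x).

Let mqs b i a : measurable_fun setT (qs b i a).
Proof.
by apply: measurableT_comp => //; apply: measurable_funD.
Qed.

Let qs0 b i a x : 0 <= qs b i a x. Proof. exact: q0. Qed.

Let qs1 b i x : \sum_a qs b i a x = 1. Proof. exact: q1. Qed.

Let qsp b i a x y : qs b i a x <= expR alpha * qs b i a y.
Proof. exact: qp. Qed.

Let edge_prob b rho (e : 'I_N * 'I_N) := pair_prob (qs b e.1) (qs b e.2) rho.

Let edge_probE b rho e a c :
  pair_integral rho (fun p => qs b e.1 a p.1 * qs b e.2 c p.2) =
  (edge_prob b rho e a c)%:E.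
Proof. by rewrite -(pair_probE (mqs b e.1) (qs0 b e.1) (qs1 b e.1) (mqs b e.2) (qs0 b e.2) (qs1 b e.2)). Qed.

Let matching_prob b rho es k : R :=
  (\prod_(l | l \notin endpoints es) q l (k l) (b l)) *
  \prod_(e <- es) edge_prob b rho e (k e.1) (k e.2).

(** Given [b], the inputs outside the matching are frozen, and disjoint edges are driven by disjoint
    sets of variables. *)
Let gint_matching rho es b k : uniq (endpoints es) ->
  gint (matching_cols rho es) (channel_prob k) b = (matching_prob b rho es k)%:E.
Proof.
elim: es b => [|[i j] es IH] b.
  by move=> _; rewrite /matching_prob big_nil mulr1.
rewrite /endpoints /= -/(endpoints es) inE negb_or => /and3P[/andP[ij iN] jN ues].
pose C := (\prod_(l | l \notin endpoints ((i, j) :: es)) q l (k l) (b l)) *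
  \prod_(e <- es) edge_prob b rho e (k e.1) (k e.2).
have C0 : 0 <= C.
  rewrite mulr_ge0 ?prodr_ge0// => e _; exact: pair_prob_ge0.
have ji : (j == i) = false by rewrite eq_sym (negbTE ij).
transitivity (\int[gam]_x \int[gam]_y
    (C * (qs b i (k i) x * qs b j (k j) (y + rho * x)))%:E)%E.
  apply: eq_integral => x _; apply: eq_integral => y _.
  rewrite -/(matching_cols rho es) IH//; congr EFin.
  set b' := fun l => _.
  have b'E l : l != i -> l != j -> b' l = b l.
    move=> /negbTE li /negbTE lj.
    by rewrite /b' /basis_fun li lj !(mulr0, addr0).
  have b'i : b' i = b i + sa * x.
    by rewrite /b' /basis_fun eqxx (negbTE ij) !(mulr0, addr0, mulr1) mulrC.
  have b'j : b' j = b j + sa * (y + rho * x).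
    by rewrite /b' /basis_fun eqxx ji !(mulr0, addr0, mulr1, add0r); ring.
  rewrite /matching_prob (bigD1 i)//= (bigD1 j)/=; last by rewrite jN ji.
  rewrite b'i b'j /C /qs.
  have -> : \prod_(l | (l \notin endpoints es) && (l != i) && (l != j))
      q l (k l) (b' l) =
    \prod_(l | l \notin endpoints ((i, j) :: es)) q l (k l) (b l).
    apply: eq_big => [l|l /andP[/andP[_ li] lj]]; last by rewrite b'E.
    rewrite /endpoints /= -/(endpoints es) !inE !negb_or.
    by case: (l == i); case: (l == j); rewrite ?andbF ?andbT.
  have -> : \prod_(e <- es) edge_prob b' rho e (k e.1) (k e.2) =
      \prod_(e <- es) edge_prob b rho e (k e.1) (k e.2).
    rewrite big_seq [RHS]big_seq; apply: eq_bigr => e ees.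
    have h l : l \in [:: e.1; e.2] -> b' l = b l.
      move=> le; have les : l \in endpoints es.
        by apply/flattenP; exists [:: e.1; e.2] => //; apply/mapP; exists e.
      by apply: b'E; [apply: contraNneq iN => <-|apply: contraNneq jN => <-].
    rewrite /edge_prob; congr pair_prob; apply: funext => a; apply: funext => z.
      by rewrite /qs h// mem_head.
    by rewrite /qs h// !inE eqxx orbT.
  ring.
have mh : measurable_fun setT (fun p : measurableTypeR R * measurableTypeR R =>
    qs b i (k i) p.1 * qs b j (k j) p.2).
  by apply: measurable_funM;
    [exact: (measurableT_comp (mqs b i (k i)) measurable_fst)|
     exact: (measurableT_comp (mqs b j (k j)) measurable_snd)].
have := edge_probE b rho (i, j) (k i) (k j).
have h0 p : 0 <= qs b i (k i) p.1 * qs b j (k j) p.2 by rewrite mulr_ge0.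
move=> E; have := pair_integralZ rho mh C0 h0; rewrite /= in E.
rewrite E -EFinM /matching_prob big_cons /= => E2.
rewrite [RHS](_ : _ = (C * edge_prob b rho (i, j) (k i) (k j))%:E); last first.
  by congr EFin; rewrite /C; ring.
rewrite -E2 /pair_integral fubini_tonelli1//.
- apply/measurable_EFinP; apply: measurable_funM => //.
  apply: (measurableT_comp mh); apply: measurable_fun_pair => //.
  by apply: measurable_funD => //; exact: measurable_funM.
- by move=> p; rewrite lee_fin mulr_ge0 ?h0//; have := h0 (p.1, p.2 + rho * p.1).
Qed.

Let matching_prob_ge0 b rho es k : 0 <= matching_prob b rho es k.
Proof. by rewrite mulr_ge0 ?prodr_ge0// => e _; exact: pair_prob_ge0. Qed.

Let sum_matching_prob b rho es : uniq (endpoints es) ->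
  \sum_k matching_prob b rho es k = 1.
Proof.
move=> ues.
rewrite (@sum_prod_pairs _ _ _ (edge_prob b rho) (fun l a => q l a (b l)))//.
rewrite big1// => e _; exact: sum_pair_prob.
Qed.

Let sqrt_prod (I : Type) (s : seq I) (F G : I -> R) :
  (forall i, 0 <= F i) -> (forall i, 0 <= G i) ->
  Num.sqrt ((\prod_(i <- s) F i) * \prod_(i <- s) G i) =
  \prod_(i <- s) Num.sqrt (F i * G i).
Proof.
move=> F0 G0; elim: s => [|i s IH]; first by rewrite !big_nil mulr1 sqrtr1.
by rewrite !big_cons mulrACA sqrtrM ?mulr_ge0// IH.
Qed.

(** The affinity of product laws is the product of the affinities. Frozen vertices behave alike
    under both signs and contribute a factor one; [prod_ge_1Bsum] makes the losses of the edges
    additive. *)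
Let matching_affinity b rho es : 0 <= rho -> rho <= 1 -> uniq (endpoints es) ->
  1 - (size es)%:R * (pair_const * Num.min (alpha ^+ 4) 1 * rho ^+ 2) <=
  \sum_k Num.sqrt (matching_prob b rho es k * matching_prob b (- rho) es k).
Proof.
move=> rho0 rho1 ues.
pose aff e a c := Num.sqrt (edge_prob b rho e a c * edge_prob b (- rho) e a c).
have -> : \sum_k Num.sqrt (matching_prob b rho es k * matching_prob b (- rho) es k) =
    \prod_(e <- es) \sum_a \sum_c aff e a c.
  rewrite -(@sum_prod_pairs _ _ _ aff (fun l a => q l a (b l)))//.
  apply: eq_bigr => k _; rewrite /matching_prob mulrACA sqrtrM; last first.
    by rewrite mulr_ge0// prodr_ge0.
  rewrite -expr2 sqrtr_sqr ger0_norm ?prodr_ge0//; congr (_ * _).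
  by rewrite sqrt_prod// => e; exact: pair_prob_ge0.
have aff_le e a c : aff e a c <= (edge_prob b rho e a c + edge_prob b (- rho) e a c) / 2.
  rewrite /aff; set P := edge_prob b rho e a c; set Q := edge_prob b _ e a c.
  have P0' : 0 <= P by exact: pair_prob_ge0.
  have Q0' : 0 <= Q by exact: pair_prob_ge0.
  rewrite -[leRHS]ger0_norm; last by lra.
  rewrite -sqrtr_sqr ler_sqrt ?sqr_ge0//.
  by have := sqr_ge0 (P - Q); rewrite sqrrB expr_div_n sqrrD; lra.
apply: le_trans (prod_ge_1Bsum _ _); last first.
  move=> e; apply/andP; split.
    by apply: sumr_ge0 => a _; apply: sumr_ge0 => c _; exact: sqrtr_ge0.
  apply: (@le_trans _ _ (\sum_a \sum_c
    (edge_prob b rho e a c + edge_prob b (- rho) e a c) / 2)).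
    by apply: ler_sum => a _; apply: ler_sum.
  under eq_bigr do rewrite -mulr_suml big_split/=.
  rewrite -mulr_suml big_split/= !sum_pair_prob//.
  by lra.
rewrite lerD2l lerN2 -sum1_size natr_sum mulr_suml.
apply: ler_sum => e _; rewrite mul1r lerBlDr -lerBlDl.
exact: private_pair_affinity.
Qed.

Lemma matching_test (S : pred {ffun 'I_N -> K}) b rho es (theta : R) :
  0 <= rho -> rho <= 1 -> uniq (endpoints es) -> 0 < theta ->
  (gint (matching_cols rho es) (fun v => \sum_(k | S k) channel_prob k v) b <=
   gint (matching_cols (- rho) es) (fun v => \sum_(k | S k) channel_prob k v) b +
   (theta * ((size es)%:R *
      (pair_const * Num.min (alpha ^+ 4) 1 * rho ^+ 2)) + 2 / theta)%:E)%E.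
Proof.
move=> rho0 rho1 ues th0; set G := fun v => (\sum_(k | S k) channel_prob k v)%E.
have GE r : gint (matching_cols r es) G b =
    (\sum_(k | S k) matching_prob b r es k)%:E.
  rewrite gint_sum; last 2 first.
  - exact: vmeasurable_channel_prob.
  - exact: channel_prob_ge0.
  by rewrite -sumEFin; apply: eq_bigr => k _; exact: gint_matching.
have aff := matching_affinity b rho0 rho1 ues.
rewrite !GE -EFinD lee_fin; apply: test_affinity => //; exact: sum_matching_prob.
Qed.

End matching.

(** * Covariances of spectral processes *)

Section laws.
Context {R : realType}.
Local Open Scope ereal_scope.

(** Rectangles are stable under intersection and generate the product sigma-algebra, which tuples
    make available; two finite measures agreeing on them are equal. *)
Lemma eq_integral_law n d1 d2 (T1 : measurableType d1) (T2 : measurableType d2)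
    (P1 : {measure set T1 -> \bar R}) (P2 : {measure set T2 -> \bar R})
    (v1 : 'I_n -> T1 -> R) (v2 : 'I_n -> T2 -> R) :
  (forall i, measurable_fun setT (v1 i)) ->
  (forall i, measurable_fun setT (v2 i)) -> P1 setT < +oo ->
  (forall B : 'I_n -> set R, (forall i, measurable (B i)) ->
    P1 [set w | forall i, B i (v1 i w)] = P2 [set w | forall i, B i (v2 i w)]) ->
  forall G, vmeasurable G -> (forall c, 0 <= G c) ->
    \int[P1]_w G (v1 ^~ w) = \int[P2]_w G (v2 ^~ w).
Proof.
move=> mv1 mv2 P1fin PB G mG G0.
pose f1 w := [tuple v1 i w | i < n]; pose f2 w := [tuple v2 i w | i < n].
have mf1 : measurable_fun setT f1.
  apply/measurable_fun_tnthP => i; rewrite (_ : _ \o _ = v1 i)//.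
  by apply: funext => w /=; rewrite tnth_mktuple.
have mf2 : measurable_fun setT f2.
  apply/measurable_fun_tnthP => i; rewrite (_ : _ \o _ = v2 i)//.
  by apply: funext => w /=; rewrite tnth_mktuple.
pose F (t : n.-tuple R) := G (fun i => tnth t i).
have mF : measurable_fun setT F by apply: mG => i; exact: measurable_tnth.
have E1 : \int[P1]_w G (v1 ^~ w) = \int[pushforward P1 f1]_t F t.
  rewrite (ge0_integral_pushforward mf1)//; last by move=> t _; exact: G0.
  rewrite preimage_setT; apply: eq_integral => w _; rewrite /F /=; congr G.
  by apply: funext => i; rewrite tnth_mktuple.
have E2 : \int[P2]_w G (v2 ^~ w) = \int[pushforward P2 f2]_t F t.
  rewrite (ge0_integral_pushforward mf2)//; last by move=> t _; exact: G0.
  rewrite preimage_setT; apply: eq_integral => w _; rewrite /F /=; congr G.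
  by apply: funext => i; rewrite tnth_mktuple.
rewrite E1 E2; apply: eq_measure_integral => A mA _.
pose g1 : {mfun T1 >-> n.-tuple R} :=
  HB.pack f1 (isMeasurableFun.Build _ _ _ _ _ mf1).
pose g2 : {mfun T2 >-> n.-tuple R} :=
  HB.pack f2 (isMeasurableFun.Build _ _ _ _ _ mf2).
pose rect : set (set (n.-tuple R)) :=
  [set C | exists2 B : 'I_n -> set R, (forall i, measurable (B i)) &
     C = [set t | forall i, B i (tnth t i)]].
have rectT : rect setT by exists (fun=> setT) => //; apply/seteqP; split.
apply: (@measure_unique _ R _ rect (fun=> setT) _ _ _ _
    (pushforward P1 g1) (pushforward P2 g2)) => //.
- apply/seteqP; split.
    apply: smallest_sub; first exact: smallest_sigma_algebra.
    move=> C; rewrite -bigcup_seq => -[i /= _ [B mB <-]].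
    apply: sub_sigma_algebra; exists (fun j => if j == i then B else setT).
      by move=> j; case: ifP.
    rewrite setTI; apply/seteqP; split => [t /= Bt j|t /(_ i)].
      by case: eqP => [->|].
    by rewrite eqxx.
  apply: smallest_sub; first exact: sigma_algebra_measurable.
  move=> _ [B mB ->].
  rewrite (_ : [set t | _] = \bigcap_(i in [set: 'I_n]) ((@tnth _ R)^~ i @^-1` B i)).
    apply: fin_bigcap_measurable => // i _.
    by rewrite -[X in measurable X]setTI; exact: measurable_tnth.
  by apply/seteqP; split => [t Bt i _|t Bt i]; [exact: Bt|exact: Bt].
- move=> _ _ [B mB ->] [B' mB' ->].
  exists (fun i => B i `&` B' i); first by move=> i; exact: measurableI.
  apply/seteqP; split => [t [Bt B't] i|t Bt]; first by split.
  by split => i; have [] := Bt i.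
- by apply/seteqP; split => // t _; exists 0%N.
- move=> _ [B mB ->].
  have := PB B mB; congr (P1 _ = P2 _); apply/seteqP; split => w /= H i;
    by have := H i; rewrite tnth_mktuple.
Qed.

(** Presents the iterated integral as one integral over a product space, to which [eq_integral_law]
    can compare an abstract family of i.i.d. standard normals. *)
Lemma gint_realization (I : Type) (A : seq (I -> R)) :
  exists d (T : measurableType d) (P : subprobability T R)
    (V : I -> T -> R), (forall i, measurable_fun setT (V i)) /\
    forall b G, vmeasurable G -> (forall c, 0 <= G c) ->
      \int[P]_t G (fun i => b i + V i t)%R = gint A G b.
Proof.
elim: A => [|a A [d [T [P [V [mV VE]]]]]].
  exists _, (measurableTypeR R), (@gam R : subprobability _ R), (fun=> cst 0%R).
  split => // b G mG G0 /=.
  under eq_integral.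
    move=> x _; rewrite (_ : (fun i => _) = b); last first.
      by apply: funext => i; rewrite addr0.
    over.
  exact: integral_gam_cst.
pose V' i (p : measurableTypeR R * T) := (p.1 * a i + V i p.2)%R.
have mV' i : measurable_fun setT (V' i).
  apply: measurable_funD; first exact: measurable_funM.
  exact: measurableT_comp.
exists _, (measurableTypeR R * T)%type,
  (product_subprobability (@gam R : subprobability _ R, P)), V'.
split => // b G mG G0.
transitivity (\int[@gam R \x P]_p G (fun i => b i + V' i p)%R) => //.
rewrite fubini_tonelli1//=; last first.
  apply: (mG _ _ (fun i p => b i + V' i p)%R) => i.
  by apply: measurable_funD.
apply: eq_integral => x _; rewrite -VE//; apply: eq_integral => t _.
by rewrite /V' /=; congr G; apply: funext => i; rewrite addrA.
Qed.

(** The coordinates outside [s] sit in [b]; those of [s] must start from 0 in order to become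
    standard normal. *)
Lemma gint_indic n (B : 'I_n -> set R) (s : seq 'I_n) (b : 'I_n -> R) :
  (forall i, measurable (B i)) -> uniq s -> (forall j, j \in s -> b j = 0%R) ->
  gint [seq basis_fun j | j <- s] (fun c => (\prod_i \1_(B i) (c i))%:E) b =
  (\prod_(i | i \notin s) \1_(B i) (b i))%:E * \prod_(i <- s) @gam R (B i).
Proof.
move=> mB; elim: s b => [|j s IH] b; first by rewrite big_nil mule1.
move=> /= /andP[js us] b0.
pose C := (\prod_(i | i \notin j :: s) \1_(B i) (b i) : R)%R.
transitivity (\int[gam]_x ((C%:E * \prod_(i <- s) @gam R (B i)) * (\1_(B j) x)%:E)).
  apply: eq_integral => x _; rewrite IH//; last first.
    move=> i i_s; rewrite /basis_fun b0 ?inE ?i_s ?orbT//.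
    by rewrite (negbTE (_ : i != j)) ?mulr0 ?addr0//; apply: contraNneq js => <-.
  rewrite (bigD1 j)//= EFinM b0 ?mem_head// add0r {1}/basis_fun eqxx mulr1.
  rewrite -muleA muleC; set D := (\prod_(i | _ && _) _)%R.
  suff -> : D = C by [].
  apply: eq_big => [i|i /andP[_ ij]]; first by rewrite inE negb_or andbC.
  by rewrite /basis_fun (negbTE ij) mulr0 addr0.
rewrite ge0_integralZl//.
- have -> : \int[gam]_x (\1_(B j) x)%:E = @gam R (B j).
    apply: etrans (integral_indic (@gam R) measurableT (mB j)) _.
    by congr (gam _); exact: setIT.
  by rewrite big_cons -muleA [_ * gam _]muleC.
- by apply/measurable_EFinP; apply: measurable_indic; exact: mB.
- by rewrite mule_ge0 ?lee_fin ?prodr_ge0// prode_ge0.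
Qed.

Lemma gint_basis n I (s : seq 'I_n) (a : 'I_n -> I -> R) (b : I -> R) G c :
  gint [seq basis_fun j | j <- s]
    (fun x => G (fun i => b i + \sum_j a j i * x j)%R) c =
  gint [seq a j | j <- s] G (fun i => b i + \sum_j a j i * c j)%R.
Proof.
elim: s c => [//|j s IH] c /=; apply: eq_integral => x _; rewrite IH.
congr (gint _ _ _); apply: funext => i; rewrite -addrA; congr (_ + _)%R.
rewrite (eq_bigr (fun l => a l i * c l + a l i * ((x : R) * basis_fun j l))%R).
  2: by move=> l _; exact: mulrDr.
rewrite big_split/=; congr (_ + _)%R.
rewrite (bigD1 j)//= /basis_fun eqxx mulr1 mulrC big1 ?addr0// => l lj.
by rewrite (negbTE lj) !mulr0.
Qed.

Lemma iid_standard_normal_gint d (W : measurableType d) (Q : probability W R) m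
    (xi : 'I_m -> {RV Q >-> R}) G : iid_standard_normal xi ->
  vmeasurable G -> (forall c, 0 <= G c) ->
  \int[Q]_w G (fun j => xi j w) =
  gint [seq basis_fun j | j <- enum 'I_m] G (fun=> 0%R).
Proof.
move=> [law ind] mG G0.
have [d' [T [P [V [mV VE]]]]] := gint_realization [seq basis_fun j | j <- enum 'I_m].
rewrite -VE//.
have -> : (fun t => G (fun i => 0%R + V i t)%R) = (fun t => G (V ^~ t)).
  by apply: funext => t; congr G; apply: funext => i; rewrite add0r.
apply: (eq_integral_law (v1 := fun j w => xi j w)) => //.
  by rewrite -ge0_fin_numE// fin_num_measure.
move=> B mB.
have mC : measurable [set t | forall i, B i (V i t)].
  rewrite (_ : [set t | _] = \bigcap_(i in [set: 'I_m]) (V i @^-1` B i)).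
    apply: fin_bigcap_measurable => // i _.
    by rewrite -[X in measurable X]setTI; exact: mV.
  by apply/seteqP; split => [t Bt i _|t Bt i]; [exact: Bt|exact: Bt].
have mI : vmeasurable (fun c : 'I_m -> R => (\prod_i \1_(B i) (c i))%:E).
  move=> e S v mv; apply/measurable_EFinP; apply: measurable_prod => i _.
  have mBi : measurable_fun setT (\1_(B i) : R -> R) by exact: measurable_indic.
  exact: (measurableT_comp mBi (mv i)).
transitivity (\prod_(j < m) @gam R (B j)).
  transitivity (Q (\bigcap_(j in [set: 'I_m]) (xi j @^-1` B j))).
    congr (Q _); apply/seteqP; split => [t Bt i _|t Bt i]; [exact: Bt|exact: Bt].
  by rewrite ind//; apply: eq_bigr => j _; rewrite law.
transitivity (gint [seq basis_fun j | j <- enum 'I_m]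
    (fun c => (\prod_i \1_(B i) (c i))%:E) (fun=> 0%R)).
  rewrite gint_indic ?enum_uniq// big_pred0 ?mul1e; last first.
    by move=> i; rewrite mem_enum.
  by rewrite big_enum.
rewrite -VE//; last by move=> c; rewrite lee_fin prodr_ge0.
transitivity (\int[P]_t (\1_[set t | forall i, B i (V i t)] t)%:E); last first.
  by rewrite (integral_indic P measurableT mC) setIT.
apply: eq_integral => t _.
congr EFin; rewrite indicE; case: (boolP (t \in _)) => [|/negP tB].
  rewrite inE => Bt; rewrite big1// => i _.
  by rewrite add0r indicE mem_set.
have [i Bi] : exists i, ~ B i (V i t).
  by apply/existsNP => H; apply: tB; rewrite inE.
by rewrite (bigD1 i)//= add0r indicE memNset// mul0r.
Qed.

Lemma multivariate_normal_gint d (T : measurableType d) (P : probability T R) n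
    (Y : 'I_n -> {RV P >-> R}) : multivariate_normal Y ->
  exists (A : seq ('I_n -> R)) (b : 'I_n -> R),
    forall G, vmeasurable G -> (forall c, 0 <= G c) ->
      \int[P]_w G (fun i => Y i w) = gint A G b.
Proof.
move=> [m [b [A [d' [W [Q [xi [iid law]]]]]]]].
exists [seq (fun i => A i j) | j <- enum 'I_m], (fun i => b i ord0) => G mG G0.
pose H (x : 'I_m -> R) := G (fun i => b i ord0 + \sum_j A i j * x j)%R.
have mlin e (S : measurableType e) (v : 'I_m -> S -> R) i :
    (forall j, measurable_fun setT (v j)) ->
    measurable_fun setT (fun t => b i ord0 + \sum_(j < m) A i j * v j t)%R.
  move=> mv; apply: measurable_funD => //.
  by apply: measurable_sum => j; exact: measurable_funM.
have mH : vmeasurable H.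
  move=> e S v mv.
  by apply: (mG _ _ (fun i t => b i ord0 + \sum_j A i j * v j t)%R) => i; exact: mlin.
transitivity (\int[Q]_w H (fun j => xi j w)).
  apply: (eq_integral_law (v1 := fun i w => Y i w)
    (v2 := fun i w => b i ord0 + \sum_j A i j * xi j w)%R) => //.
  - by move=> i; exact: mlin.
  - by rewrite -ge0_fin_numE// fin_num_measure.
  move=> B mB; apply: etrans (law B mB); congr (P _).
  by apply/seteqP; split => [t Bt i _|t Bt i]; [exact: Bt|exact: Bt].
rewrite (iid_standard_normal_gint iid)//; last by move=> c; exact: G0.
rewrite /H.
rewrite (gint_basis _ (fun j i => A i j) (fun i => b i ord0)).
congr (gint _ _ _); apply: funext => i.
by rewrite big1 ?addr0// => j _; rewrite mulr0.
Qed.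

End laws.

(** * Second moments of Gaussian vectors *)

Section gint_second_moment.
Context {R : realType}.
Local Open Scope ereal_scope.

(** The variance of a standard normal, kept as an unknown factor between [qform] and covariances.
    Its positivity follows later from the lower bound on Toeplitz forms. *)
Definition gam_pow2 : R := fine (\int[@gam R]_x (x ^+ 2)%:E).

Lemma gam_pow2_ge0 : (0 <= gam_pow2)%R.
Proof. by apply/fine_ge0/integral_ge0 => x _; rewrite lee_fin sqr_ge0. Qed.

Let measurable_pow2 : measurable_fun setT (fun x : R => x ^+ 2)%R.
Proof. exact: measurable_funX. Qed.

Lemma gam_pow2E : \int[@gam R]_x (x ^+ 2)%:E = gam_pow2%:E.
Proof.
rewrite /gam_pow2 fineK// ge0_fin_numE; last first.
  by apply: integral_ge0 => x _; rewrite lee_fin sqr_ge0.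
apply: (@le_lt_trans _ _ (\int[@gam R]_x (1%:E + (x ^+ 4)%:E))).
  apply: ge0_le_integral => //.
  - by move=> x _; rewrite lee_fin sqr_ge0.
  - by apply/measurable_EFinP; exact: measurable_pow2.
  - apply: emeasurable_funD => //; apply/measurable_EFinP.
    exact: measurable_funX.
  - move=> x _; rewrite -EFinD lee_fin.
    have := sqr_ge0 (x ^+ 2 - 1)%R; have := sqr_ge0 (x ^+ 2)%R.
    by rewrite sqrrB -!exprM /=; nra.
rewrite ge0_integralD//; last 2 first.
- by move=> x _; rewrite lee_fin exprn_even_ge0.
- by apply/measurable_EFinP; exact: measurable_funX.
by rewrite gam_pow4E integral_gam_cst -EFinD ltry.
Qed.

(** Adding the integral to its image under x -> - x cancels the cross term while every integrand
    stays nonnegative. *)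
Lemma gam_affine_sqr (p q : R) :
  \int[gam]_x ((p + x * q) ^+ 2)%:E = (p ^+ 2 + gam_pow2 * q ^+ 2)%:E.
Proof.
have m (r : R) : measurable_fun setT (fun x : R => ((p + x * r) ^+ 2)%:E).
  apply/measurable_EFinP; apply: measurable_funX.
  by apply: measurable_funD => //; apply: measurable_funM.
have n (r x : R) : 0 <= ((p + x * r) ^+ 2)%:E by rewrite lee_fin sqr_ge0.
set I := \int[gam]_x _.
have IN : \int[@gam R]_x ((p + x * - q) ^+ 2)%:E = I.
  rewrite /I -(gamN (m q) (n q)); apply: eq_integral => x _.
  by rewrite mulrN mulNr.
have II : I + I = (2 * (p ^+ 2 + gam_pow2 * q ^+ 2))%:E.
  rewrite -{1}IN /I -ge0_integralD//; try exact: m.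
  transitivity (\int[@gam R]_x ((2 * p ^+ 2)%:E + (2 * q ^+ 2)%:E * (x ^+ 2)%:E)).
    by apply: eq_integral => x _; rewrite -EFinM -!EFinD; congr EFin; ring.
  have h0 : (0 <= 2 * q ^+ 2)%R by rewrite mulr_ge0 ?sqr_ge0.
  have mx : measurable_fun setT (fun x : R => (x ^+ 2)%:E).
    by apply/measurable_EFinP; exact: measurable_pow2.
  rewrite ge0_integralD//.
  - rewrite integral_gam_cst ge0_integralZl//.
      by rewrite gam_pow2E -EFinM -EFinD; congr EFin; ring.
    by move=> x _; rewrite lee_fin sqr_ge0.
  - by move=> x _; rewrite lee_fin mulr_ge0 ?sqr_ge0.
  - by move=> x _; rewrite mule_ge0 ?lee_fin ?sqr_ge0.
  - exact: emeasurable_funM.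
have : I \is a fin_num.
  rewrite ge0_fin_numE; last by apply: integral_ge0 => x _; exact: n.
  apply: (@le_lt_trans _ _ (I + I)); last by rewrite II ltry.
  by rewrite leeDl// integral_ge0.
move=> /fineK Ifin; rewrite -Ifin -EFinD in II *; move: II => -[II].
congr EFin; lra.
Qed.

(** The shift [t] makes the mean visible in second moments, which is how a centered process will be
    seen to have a zero base point. *)
Lemma gint_sqr N (A : seq ('I_N -> R)) (u : 'I_N -> R) (t : R) b :
  gint A (fun c => ((dotp u c + t) ^+ 2)%:E) b =
  ((dotp u b + t) ^+ 2 + gam_pow2 * qform A u)%:E.
Proof.
elim: A b => [|a A IH] b /=; first by rewrite /qform big_nil mulr0 addr0.
under eq_integral do rewrite IH dotpDr dotpZr.
transitivity (\int[gam]_x ((((dotp u b + t) + x * dotp u a) ^+ 2)%:E +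
    (gam_pow2 * qform A u)%:E)).
  by apply: eq_integral => x _; rewrite -EFinD; congr EFin; ring.
have q0 : (0 <= gam_pow2 * qform A u)%R.
  by rewrite mulr_ge0 ?gam_pow2_ge0// sumr_ge0// => ? _; rewrite sqr_ge0.
rewrite ge0_integralD//.
- rewrite integral_gam_cst gam_affine_sqr -EFinD; congr EFin.
  by rewrite /qform big_cons; ring.
- by move=> x _; rewrite lee_fin sqr_ge0.
- apply/measurable_EFinP; apply: measurable_funX.
  by apply: measurable_funD => //; apply: measurable_funM.
Qed.

End gint_second_moment.

(** * From a stationary Gaussian process to a list of columns *)

Section spectral_process.
Context {R : realType} d (T : measurableType d) (P : probability T R).
Implicit Types (Y : {RV P >-> R}).

Let integrable_mul Y1 Y2 :
  (\int[P]_w (Y1 w ^+ 2)%:E < +oo)%E -> (\int[P]_w (Y2 w ^+ 2)%:E < +oo)%E ->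
  P.-integrable setT (EFin \o (fun w => Y1 w * Y2 w)).
Proof.
move=> h1 h2.
have m1 : measurable_fun setT (fun w => Y1 w ^+ 2) by exact: measurable_funX.
have m2 : measurable_fun setT (fun w => Y2 w ^+ 2) by exact: measurable_funX.
apply: (@le_integrable _ _ _ P setT _ _ (EFin \o (fun w => Y1 w ^+ 2 + Y2 w ^+ 2))) => //.
- by apply/measurable_EFinP; exact: measurable_funM.
- move=> w _ /=; rewrite lee_fin [leRHS]ger0_norm ?addr_ge0 ?sqr_ge0// normrM.
  rewrite -[Y1 w ^+ 2]real_normK ?num_real// -[Y2 w ^+ 2]real_normK ?num_real//.
  have := sqr_ge0 (`|Y1 w| - `|Y2 w|); rewrite sqrrB.
  have := sqr_ge0 (`|Y1 w|); have := sqr_ge0 (`|Y2 w|); lra.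
- apply/integrableP; split; first by apply/measurable_EFinP; exact: measurable_funD.
  rewrite (_ : (fun _ => _) = (fun w => (Y1 w ^+ 2)%:E + (Y2 w ^+ 2)%:E)%E).
    rewrite ge0_integralD//; first exact: lte_add_pinfty.
    - by move=> w _; rewrite lee_fin sqr_ge0.
    - exact/measurable_EFinP.
    - by move=> w _; rewrite lee_fin sqr_ge0.
    - exact/measurable_EFinP.
  apply: funext => w /=; rewrite ger0_norm ?EFinD//.
  by rewrite addr_ge0 ?sqr_ge0.
Qed.

Let Ex (f : T -> R) : R := \int[P]_w f w.

Let Ex_sqrD Y1 Y2 :
  (\int[P]_w (Y1 w ^+ 2)%:E < +oo)%E -> (\int[P]_w (Y2 w ^+ 2)%:E < +oo)%E ->
  Ex (fun w => (Y1 w + Y2 w) ^+ 2) =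
  Ex (fun w => Y1 w ^+ 2) + Ex (fun w => Y2 w ^+ 2) + 2 * Ex (fun w => Y1 w * Y2 w).
Proof.
move=> h1 h2.
have i11 := integrable_mul h1 h1; have i22 := integrable_mul h2 h2.
have i12 := integrable_mul h1 h2.
have i12' : P.-integrable setT (EFin \o (fun w => 2 * (Y1 w * Y2 w))).
  have := @integrableZl _ _ _ P setT measurableT 2 _ i12.
  by apply: eq_integrable => // w _ /=; rewrite EFinM.
have e11 : P.-integrable setT (EFin \o (fun w => Y1 w ^+ 2)).
  by apply: eq_integrable i11 => // w _ /=; rewrite expr2.
have e22 : P.-integrable setT (EFin \o (fun w => Y2 w ^+ 2)).
  by apply: eq_integrable i22 => // w _ /=; rewrite expr2.
have e1122 : P.-integrable setT (EFin \o (fun w => Y1 w ^+ 2 + Y2 w ^+ 2)).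
  have := @integrableD _ _ _ P setT measurableT _ _ e11 e22.
  by apply: eq_integrable.
rewrite /Ex; transitivity (\int[P]_w ((Y1 w ^+ 2 + Y2 w ^+ 2) + 2 * (Y1 w * Y2 w))).
  by apply: eq_Rintegral => w _; ring.
by rewrite RintegralD// RintegralD// RintegralZl.
Qed.

Variables (X : int -> {RV P >-> R}) (g : R -> R) (N : nat).
Hypotheses (gp : gaussian_process X) (cX : centered X) (sX : stationary X)
  (hX : has_spectral_density X g).

Definition autocov (k : int) : R :=
  \int[@lebesgue_measure R]_(x in `[- pi, pi]) (g x * cos (k%:~R * x)).

Let sqr_integral n (t : 'I_n -> int) (A : seq ('I_n -> R)) b :
  (forall G, vmeasurable G -> (forall c, 0 <= G c)%E ->
    (\int[P]_w G (fun i => X (t i) w) = gint A G b)%E) ->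
  forall u s, (\int[P]_w ((dotp u (fun i => X (t i) w) + s) ^+ 2)%:E =
    ((dotp u b + s) ^+ 2 + gam_pow2 * qform A u)%:E)%E.
Proof.
move=> H u s; rewrite -gint_sqr -H//; last by move=> c; rewrite lee_fin sqr_ge0.
move=> e S v mv; apply/measurable_EFinP; apply: measurable_funX.
apply: measurable_funD => //; apply: measurable_sum => i.
exact: measurable_funM.
Qed.

Let X_L2 k : (\int[P]_w (X k w ^+ 2)%:E < +oo)%E.
Proof.
have [A [b H]] := multivariate_normal_gint (gp (fun _ : 'I_1 => k)).
have := sqr_integral H (basis_fun ord0) 0.
under eq_integral do rewrite dotp_basisl addr0.
by move=> ->; rewrite ltry.
Qed.

Let Ex_X k : Ex (fun w => X k w) = 0.
Proof. by have := cX k; rewrite expectation_def /Ex /Rintegral => ->. Qed.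

Let Ex_XX k : Ex (fun w => X 0 w * X k w) = autocov k.
Proof.
have [+ _] := hX k; rewrite covariance.unlock !cX => E.
rewrite /Ex /Rintegral.
have -> : (\int[P]_w (X 0 w * X k w)%:E)%E = (autocov k)%:E.
  rewrite /autocov -E expectation.unlock; apply: eq_integral => w _ /=.
  by rewrite -[RHS]/(((X 0 w - 0) * (X k w - 0))%:E) !subr0.
by [].
Qed.

Let Ex_stationary2 s k :
  Ex (fun w => (X s w + X (s + k) w) ^+ 2) = Ex (fun w => (X 0 w + X k w) ^+ 2).
Proof.
pose t (i : 'I_2) : int := if i == ord0 then 0 else k.
pose G (c : 'I_2 -> R) := (((c ord0 + c (lift ord0 ord0)) ^+ 2)%:E).
have mG : vmeasurable G.
  move=> e S v mv; apply/measurable_EFinP; apply: measurable_funX.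
  exact: measurable_funD.
have G0 c : (0 <= G c)%E by rewrite lee_fin sqr_ge0.
have := @eq_integral_law R 2 _ _ T T P P (fun i w => X (t i + s) w)
  (fun i w => X (t i) w) _ _ _ _ G mG G0.
rewrite /G /t /= add0r [k + s]addrC => E.
rewrite /Ex /Rintegral E//.
- by rewrite -ge0_fin_numE// fin_num_measure.
- move=> B mB; have := sX t s mB.
  by congr (P _ = P _); apply/seteqP; (split => w H i; [|move=> _]); exact: H.
Qed.

Let Ex_stationary1 s : Ex (fun w => X s w ^+ 2) = Ex (fun w => X 0 w ^+ 2).
Proof.
have := Ex_stationary2 s 0; rewrite addr0.
have E k : Ex (fun w => (X k w + X k w) ^+ 2) = 4 * Ex (fun w => X k w ^+ 2).
  rewrite Ex_sqrD//; set a := Ex _.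
  by ring.
by rewrite !E => /mulfI; apply; rewrite pnatr_eq0.
Qed.

(** The spectral density prescribes covariances with [X 0] only; stationarity of the second moments
    of sums moves them to any origin, by polarization. *)
Let Ex_XXs s k : Ex (fun w => X s w * X (s + k) w) = autocov k.
Proof.
have := Ex_stationary2 s k; rewrite !Ex_sqrD//.
rewrite (Ex_stationary1 s) (Ex_stationary1 (s + k)) (Ex_stationary1 k).
by move=> /addrI/mulfI; rewrite Ex_XX; apply; rewrite pnatr_eq0.
Qed.

Lemma spectral_gint : exists A : seq ('I_N -> R),
  (forall G, vmeasurable G -> (forall c, 0 <= G c)%E ->
    (\int[P]_w G (fun i : 'I_N => X i.+1%:Z w) = gint A G (fun=> 0%R))%E) /\
  forall u, gam_pow2 * qform A u =
    bform (fun i j : 'I_N => autocov (j%:Z - i%:Z)) u u.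
Proof.
pose t (i : 'I_N) : int := i.+1%:Z.
have [A [b H]] := multivariate_normal_gint (gp t).
have sq := sqr_integral H.
have ExE (f : T -> R) (r : R) : (\int[P]_w (f w)%:E)%E = r%:E -> Ex f = r.
  by rewrite /Ex /Rintegral => ->.
(* The second moment of X + s is computed once from centering and once from the columns; comparing s
   = 1 with s = -1 leaves only the term linear in [b i]. *)
have b0 i : b i = 0.
  have i1 : P.-integrable setT (EFin \o (fun w => X (t i) w)).
    have c1 : (\int[P]_w ((cst 1 : {RV P >-> R}) w ^+ 2)%:E < +oo)%E.
      by rewrite /= expr1n integral_cst// mul1e -ge0_fin_numE// fin_num_measure.
    have := integrable_mul (X_L2 (t i)) c1.
    by apply: eq_integrable => // w _ /=; rewrite mulr1.
  have e2 : P.-integrable setT (EFin \o (fun w => X (t i) w ^+ 2)).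
    have := integrable_mul (X_L2 (t i)) (X_L2 (t i)).
    by apply: eq_integrable => // w _ /=; rewrite expr2.
  have E s : Ex (fun w => (X (t i) w + s) ^+ 2) = Ex (fun w => X (t i) w ^+ 2) + s ^+ 2.
    have is1 : P.-integrable setT (EFin \o (fun w => 2 * s * X (t i) w)).
      have := @integrableZl _ _ _ P setT measurableT (2 * s) _ i1.
      by apply: eq_integrable => // w _ /=; rewrite EFinM.
    have is3 : P.-integrable setT (EFin \o (fun=> s ^+ 2) : T -> \bar R).
      by apply: finite_measure_integrable_cst.
    have is2 : P.-integrable setT (EFin \o (fun w => 2 * s * X (t i) w + s ^+ 2)).
      have := @integrableD _ _ _ P setT measurableT _ _ is1
        is3.
      by apply: eq_integrable.
    transitivity (Ex (fun w => X (t i) w ^+ 2 + (2 * s * X (t i) w + s ^+ 2))).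
      by apply: eq_Rintegral => w _; ring.
    rewrite /Ex RintegralD// RintegralD//.
    have E0 := Ex_X (t i); rewrite /Ex in E0.
    rewrite RintegralZl// E0 mulr0 add0r Rintegral_cst//.
    congr (_ + _); rewrite -[RHS]mulr1; congr (_ * _).
    exact: (congr1 fine (probability_setT P)).
  have F s : Ex (fun w => (X (t i) w + s) ^+ 2) =
      (b i + s) ^+ 2 + gam_pow2 * qform A (basis_fun i).
    apply: ExE; have := sq (basis_fun i) s; rewrite dotp_basisl => <-.
    by apply: eq_integral => w _; rewrite dotp_basisl.
  have := E 1; have := E (-1); rewrite !F; lra.
exists A; split.
  move=> G mG G0; rewrite H//; congr gint; exact: funext.
have dotb0 u : dotp u b = 0.
  by rewrite /dotp big1// => i _; rewrite b0 mulr0.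
have qE u : Ex (fun w => dotp u (fun i => X (t i) w) ^+ 2) = gam_pow2 * qform A u.
  apply: ExE; have := sq u 0; rewrite dotb0 addr0 expr0n add0r => <-.
  by apply: eq_integral => w _; rewrite addr0.
have cE i j : gam_pow2 * \sum_(a <- A) a i * a j = autocov (j%:Z - i%:Z).
  have ti : t j = t i + (j%:Z - i%:Z).
    by rewrite /t !intS -addrA; congr (_ + _); rewrite addrC subrK.
  have q1 k : Ex (fun w => X (t k) w ^+ 2) = gam_pow2 * qform A (basis_fun k).
    by rewrite -qE; apply: eq_Rintegral => w _; rewrite dotp_basisl.
  have q2 : Ex (fun w => (X (t i) w + X (t j) w) ^+ 2) =
      gam_pow2 * qform A (fun l => basis_fun i l + basis_fun j l).
    by rewrite -qE; apply: eq_Rintegral => w _; rewrite dotpDl !dotp_basisl.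
  move: q2; rewrite Ex_sqrD// !q1 [in X in _ + _ + X](_ : Ex _ = autocov (j%:Z - i%:Z)).
    have -> : qform A (fun l => basis_fun i l + basis_fun j l) =
      qform A (basis_fun i) + qform A (basis_fun j) + 2 * \sum_(a <- A) a i * a j.
      rewrite /qform mulr_sumr -!big_split; apply: eq_bigr => a _ /=.
      by rewrite dotpDl !dotp_basisl; ring.
    by set s := \sum_(a <- A) a i * a j; lra.
  by rewrite ti; exact: Ex_XXs.
move=> u.
transitivity (\sum_(a <- A) \sum_i \sum_j gam_pow2 * (u i * a i * (u j * a j))).
  rewrite /qform mulr_sumr; apply: eq_bigr => a _.
  rewrite expr2 {1}/dotp mulr_suml mulr_sumr; apply: eq_bigr => i _.
  by rewrite /dotp !mulr_sumr.
rewrite exchange_big /=; apply: eq_bigr => i _.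
rewrite exchange_big /= /dotp mulr_sumr; apply: eq_bigr => j _.
rewrite -cE !mulr_sumr; apply: eq_bigr => a _; ring.
Qed.

End spectral_process.

(** * Autocovariances of the perturbed densities and Toeplitz forms *)

Section trigonometric_integrals.
Context {R : realType}.
Local Notation I := (`[(- pi)%R, (pi : R)]%classic).
Local Notation mu := (@lebesgue_measure R).

Let pi_gtN : - pi < pi :> R.
Proof. by have := pi_gt0 R; lra. Qed.

Let mu_I : mu I = (2 * pi)%:E.
Proof.
rewrite lebesgue_measure_itv/= lte_fin pi_gtN -EFinB; congr EFin; ring.
Qed.

Let sin_natpi n : sin (n%:R * pi : R) = 0.
Proof.
elim: n => [|n IH]; first by rewrite mul0r sin0.
by rewrite -natr1 mulrDl mul1r sinD IH sinpi mulr0 mul0r addr0.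
Qed.

Let sin_intpi (k : int) : sin (k%:~R * pi : R) = 0.
Proof.
case: k => n; first exact: sin_natpi.
by rewrite NegzE mulrNz mulNr sinN sin_natpi oppr0.
Qed.

Let is_derive_sinM (c x : R) : is_derive x 1 (fun y => sin (c * y)) (c * cos (c * x)).
Proof.
have h : is_derive x 1 (fun y : R => c * y) c.
  by apply: is_derive_eq; rewrite /GRing.scale/= mulr1.
have := @is_derive1_comp R sin ( *%R c) x _ _ (is_derive_sin (c * x)) h.
by rewrite mulrC.
Qed.

Lemma Rintegral_cos_int (k : int) :
  \int[mu]_(x in I) cos (k%:~R * x) = if k == 0 then 2 * pi else 0.
Proof.
have [->|k0] := eqVneq k 0.
  rewrite (_ : (fun x => _) = cst 1); last first.
    by apply: funext => x; rewrite mul0r cos0.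
  by rewrite Rintegral_cst//= mul1r mu_I.
pose c : R := k%:~R.
have c0 : c != 0 by rewrite intr_eq0.
have dF (x : R) : is_derive x 1 (fun y : R => c^-1 * sin (c * y)) (cos (c * x)).
  have := @is_deriveZ _ _ _ _ c^-1 x 1 _ (is_derive_sinM c x).
  by rewrite /GRing.scale/= mulKf.
have cF (x : R) : {for x, continuous (fun y => c^-1 * sin (c * y))}.
  apply: differentiable_continuous; apply/derivable1_diffP.
  by have [] := dF x.
rewrite /Rintegral (@continuous_FTC2 _ _ (fun y => c^-1 * sin (c * y)))//=.
- by rewrite mulrN sinN !sin_intpi oppr0 mulr0 subrr.
- apply: continuous_subspaceT => x.
  apply: (@continuous_comp _ _ _ ( *%R c) cos); last exact: continuous_cos.
  exact: mulrl_continuous.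
- split.
  + by move=> x _; have [] := dF x.
  + by apply: cvg_at_right_filter; exact: cF.
  + by apply: cvg_at_left_filter; exact: cF.
- by move=> x _; rewrite derive1E; have [] := dF x.
Qed.

Let bounded_integrable (f b : R -> R) : mu.-integrable I (EFin \o f) ->
  measurable_fun setT b -> (forall x, `|b x| <= 1) ->
  mu.-integrable I (EFin \o (fun x => f x * b x)).
Proof.
move=> fi mb b1; apply: (le_integrable _ _ _ fi) => //.
  apply/measurable_EFinP; apply: measurable_funM; last exact: measurable_funTS.
  by apply/measurable_EFinP; exact: measurable_int fi.
by move=> x _ /=; rewrite lee_fin normrM ler_piMr.
Qed.

Let cst_integrable (r : R) : mu.-integrable I (EFin \o cst r).
Proof.
apply/integrableP; split; first exact/measurable_EFinP.
rewrite (_ : (fun _ => _) = cst `|r|%:E)//.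
by rewrite integral_cst//= mu_I -EFinM ltry.
Qed.

Let measurable_cosM (c : R) : measurable_fun setT (fun x : R => cos (c * x)).
Proof.
by apply: (measurableT_comp (f := cos)) => //; apply: continuous_measurable_fun;
  exact: continuous_cos.
Qed.

Let cos_integrable (c : R) : mu.-integrable I (EFin \o (fun x => cos (c * x))).
Proof.
have := bounded_integrable (cst_integrable 1) (measurable_cosM c)
  (fun x => cos_max (c * x)).
by apply: eq_integrable => // x _ /=; rewrite mul1r.
Qed.

Let Rintegral_coscos (h : nat) (k : int) : (0 < h)%N ->
  \int[mu]_(x in I) (cos (h%:R * x) * cos (k%:~R * x)) =
  if (`|k|%N == h)%N then pi else 0.
Proof.
move=> h0.
have E x : cos (h%:R * x) * cos (k%:~R * x) =
    2^-1 * cos ((h%:Z + k)%:~R * x) + 2^-1 * cos ((h%:Z - k)%:~R * x) :> R.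
  by rewrite intrD intrB mulrDl mulrBl cosD cosB; field.
transitivity (\int[mu]_(x in I) (2^-1 * cos ((h%:Z + k)%:~R * x) +
    2^-1 * cos ((h%:Z - k)%:~R * x))).
  by apply: eq_Rintegral => x _; exact: E.
have i2 c : mu.-integrable I (EFin \o (fun x => 2^-1 * cos (c * x))).
  have := @integrableZl _ _ _ mu I _ 2^-1 _ (cos_integrable c).
  by move=> /(_ (measurable_itv _)); apply: eq_integrable => // x _ /=; rewrite EFinM.
rewrite RintegralD// !RintegralZl// !Rintegral_cos_int.
have [kh|kh] := eqVneq `|k|%N h; last first.
  rewrite !ifF ?mulr0 ?addr0//; apply/negbTE; apply: contra_neq kh.
    by move=> /eqP; rewrite subr_eq0 => /eqP <-.
  by move=> /eqP; rewrite addrC addr_eq0 => /eqP ->; rewrite abszN.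
case: k kh E => n /= kh E.
  rewrite kh subrr eqxx ifF; last by apply/negbTE; rewrite -PoszD eqz_nat addn_eq0 negb_and -lt0n h0.
  by rewrite mulr0 add0r mulrA mulVf ?mul1r.
rewrite NegzE kh subrr eqxx opprK ifF; last by apply/negbTE; rewrite -PoszD eqz_nat addn_eq0 negb_and -lt0n h0.
by rewrite mulr0 addr0 mulrA mulVf ?mul1r.
Qed.

Let autocov_perturbed (f : R -> R) (h : nat) (e : R) (k : int) : (0 < h)%N ->
  mu.-integrable I (EFin \o f) ->
  autocov (fun x => f x + e / pi * cos (h%:R * x)) k =
  autocov f k + e * (`|k|%N == h)%:R.
Proof.
move=> h0 fi; rewrite /autocov.
have fc := bounded_integrable fi (measurable_cosM k%:~R) (fun x => cos_max _).
have hc : mu.-integrable I (EFin \o (fun x => cos (h%:R * x) * cos (k%:~R * x))).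
  exact: bounded_integrable (cos_integrable _) (measurable_cosM _) (fun x => cos_max _).
have ehc : mu.-integrable I
    (EFin \o (fun x => e / pi * (cos (h%:R * x) * cos (k%:~R * x)))).
  have := @integrableZl _ _ _ mu I _ (e / pi) _ hc.
  by move=> /(_ (measurable_itv _)); apply: eq_integrable => // x _ /=; rewrite EFinM.
transitivity (\int[mu]_(x in I) (f x * cos (k%:~R * x) +
    e / pi * (cos (h%:R * x) * cos (k%:~R * x)))).
  by apply: eq_Rintegral => x _; ring.
rewrite RintegralD// RintegralZl// Rintegral_coscos//; congr (_ + _).
case: eqP => _; last by rewrite !mulr0.
by rewrite divfK ?mulr1// gt_eqF// pi_gt0.
Qed.

Lemma autocov_f_plus (f : R -> R) h (e : R) k : (0 < h)%N ->
  mu.-integrable I (EFin \o f) ->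
  autocov (f_plus f h e) k = autocov f k + e * (`|k|%N == h)%:R.
Proof. exact: autocov_perturbed. Qed.

Lemma autocov_f_minus (f : R -> R) h (e : R) k : (0 < h)%N ->
  mu.-integrable I (EFin \o f) ->
  autocov (f_minus f h e) k = autocov f k - e * (`|k|%N == h)%:R.
Proof.
move=> h0 fi; rewrite -mulNr -autocov_perturbed//; apply: eq_Rintegral => x _.
by rewrite /f_minus !mulNr.
Qed.

(* The quadratic form of a Toeplitz matrix is the integral of the spectral
   density against the squared modulus of a trigonometric polynomial. *)
Lemma toeplitz_ge N (f : R -> R) (fmin : R) (u : 'I_N -> R) :
  mu.-integrable I (EFin \o f) -> (forall x, x \in `[- pi, pi] -> fmin <= f x) ->
  2 * pi * fmin * \sum_i u i ^+ 2 <=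
  bform (fun i j : 'I_N => autocov f (j%:Z - i%:Z)) u u.
Proof.
move=> fi f_ge.
pose T x : R := (\sum_i u i * cos (i%:R * x)) ^+ 2 + (\sum_i u i * sin (i%:R * x)) ^+ 2.
have TE x : T x = \sum_i \sum_j u i * u j * cos ((j%:Z - i%:Z)%:~R * x).
  rewrite /T !expr2 !mulr_suml -big_split; apply: eq_bigr => i _ /=.
  rewrite !mulr_sumr -big_split; apply: eq_bigr => j _ /=.
  by rewrite intrB mulrBl cosB; ring.
have T0 x : 0 <= T x by rewrite addr_ge0 ?sqr_ge0.
have toep (g : R -> R) : mu.-integrable I (EFin \o g) ->
    mu.-integrable I (EFin \o (fun x => g x * T x)) /\
    \int[mu]_(x in I) (g x * T x) =
    bform (fun i j : 'I_N => autocov g (j%:Z - i%:Z)) u u.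
  move=> gi.
  have gk k : mu.-integrable I (EFin \o (fun x => g x * cos (k%:~R * x))).
    exact: bounded_integrable gi (measurable_cosM _) (fun x => cos_max _).
  have gij i j : mu.-integrable I
      (fun x => (u i * u j)%:E * (g x * cos ((j%:Z - i%:Z)%:~R * x))%:E)%E.
    exact: integrableZl (gk _).
  have gi' i : mu.-integrable I (fun x => \sum_j
      (u i * u j)%:E * (g x * cos ((j%:Z - i%:Z)%:~R * x))%:E)%E.
    exact: integrable_sum.
  have E x : ((g x * T x)%:E = \sum_i \sum_j
      (u i * u j)%:E * (g x * cos ((j%:Z - i%:Z)%:~R * x))%:E)%E.
    under eq_bigr do under eq_bigr do rewrite -EFinM.
    under eq_bigr do rewrite sumEFin.
    rewrite sumEFin TE mulr_sumr; congr EFin; apply: eq_bigr => i _.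
    by rewrite mulr_sumr; apply: eq_bigr => j _; rewrite mulrCA.
  split.
    have : mu.-integrable I (fun x => \sum_i \sum_j
      (u i * u j)%:E * (g x * cos ((j%:Z - i%:Z)%:~R * x))%:E)%E.
      exact: integrable_sum.
    by apply: eq_integrable => // x _ /=; rewrite E.
  suff S : (\int[mu]_(x in I) (g x * T x)%:E =
      (bform (fun i j : 'I_N => autocov g (j%:Z - i%:Z)) u u)%:E)%E.
    by rewrite /Rintegral S.
  transitivity (\int[mu]_(x in I) \sum_i \sum_j
      (u i * u j)%:E * (g x * cos ((j%:Z - i%:Z)%:~R * x))%:E)%E.
    by apply: eq_integral => x _; exact: E.
  rewrite integral_sum// /bform -sumEFin; apply: eq_bigr => i _.
  rewrite integral_sum// /dotp mulr_sumr -sumEFin; apply: eq_bigr => j _.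
  rewrite integralZl//; last exact: gk.
  have aE : (\int[mu]_(x in I) (g x * cos ((j%:Z - i%:Z)%:~R * x))%:E =
      (autocov g (j%:Z - i%:Z))%:E)%E.
    by rewrite /autocov /Rintegral fineK// integrable_fin_num//; exact: gk.
  by rewrite aE -EFinM mulrA.
have [i1 <-] := toep f fi.
(* For the constant density, orthogonality of the cosines reduces the Toeplitz matrix to 2 pi fmin
   times the identity. *)
have [i2 E2] := toep (cst fmin) (cst_integrable fmin).
apply: (@le_trans _ _ (\int[mu]_(x in I) (cst fmin x * T x))); last first.
  by apply: le_Rintegral => // x xI; rewrite ler_wpM2r// f_ge.
rewrite E2 /bform mulr_sumr; apply: ler_sum => i _.
rewrite le_eqVlt; apply/orP; left; apply/eqP.
have aE k : autocov (cst fmin) k = fmin * (if k == 0 then 2 * pi else 0).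
  by rewrite -Rintegral_cos_int /autocov -RintegralZl//; exact: cos_integrable.
rewrite /dotp (bigD1 i)//= aE subrr eqxx big1 ?addr0; first by ring.
move=> j ji; rewrite aE ifF ?mulr0//; apply/negbTE; rewrite subr_eq0 eqz_nat.
exact: ji.
Qed.

Lemma spectral_density_perturbed (f : R -> R) (fmin : R) h (e : R) :
  spectral_density f -> (forall x, x \in `[- pi, pi] -> fmin <= f x) ->
  0 < e <= pi * fmin ->
  spectral_density (f_plus f h e) /\ spectral_density (f_minus f h e).
Proof.
move=> [f0 fi fev] f_ge /andP[e0 e_le].
have ep0 : 0 <= e / pi by rewrite divr_ge0 ?pi_ge0// ltW.
have ep : e / pi <= fmin by rewrite ler_pdivrMr ?pi_gt0// mulrC.
have ci (r : R) : mu.-integrable I (EFin \o (fun x => r * cos (h%:R * x))).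
  have := @integrableZl _ _ _ mu I _ r _ (cos_integrable h%:R).
  by move=> /(_ (measurable_itv _)); apply: eq_integrable => // x _ /=; rewrite EFinM.
have bnd x : - (e / pi) <= e / pi * cos (h%:R * x) <= e / pi.
  have c1 := cos_le1 (h%:R * x); have c2 := cos_geN1 (h%:R * x).
  by apply/andP; split; nra.
split; split.
- move=> x xI; have := f_ge x xI; have /andP[+ _] := bnd x; rewrite /f_plus; lra.
- have := @integrableD _ _ _ mu I _ _ _ fi (ci (e / pi)).
  by move=> /(_ (measurable_itv _)); apply: eq_integrable.
- by move=> x xI; rewrite /f_plus fev// mulrN cosN.
- move=> x xI; have := f_ge x xI; have /andP[_ +] := bnd x; rewrite /f_minus; lra.
- have := @integrableD _ _ _ mu I _ _ _ fi (ci (- (e / pi))).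
  move=> /(_ (measurable_itv _)); apply: eq_integrable => // x _ /=.
  by rewrite /f_minus mulNr EFinB EFinN.
- by move=> x xI; rewrite /f_minus fev// mulrN cosN.
Qed.

End trigonometric_integrals.

(** * Flipping the sign of the perturbation *)

Section edges.
Context {R : realType} {N h : nat}.
Hypothesis h0 : (0 < h)%N.

Let edge_proof (i : 'I_(N - h)) : (i + h < N)%N.
Proof. by rewrite addnC -ltn_subRL. Qed.

Definition edge (i : 'I_(N - h)) : 'I_N * 'I_N :=
  (widen_ord (leq_subr h N) i, Ordinal (edge_proof i)).

(* Consecutive edges [(i, i + h)] and [(i + h, i + 2 h)] share a vertex, but the
   blocks of length [h] in which they start have different parities. *)
Definition half_edges (p : bool) : seq ('I_N * 'I_N) :=
  [seq edge i | i : 'I_(N - h) <- enum 'I_(N - h) & odd (i %/ h) == p].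

Lemma size_half_edges p : (size (half_edges p) <= N - h)%N.
Proof.
rewrite size_map size_filter -[leqRHS]size_enum_ord; exact: count_size.
Qed.

Lemma uniq_endpoints (es : seq ('I_N * 'I_N)) :
  uniq ([seq e.1 | e <- es] ++ [seq e.2 | e <- es]) -> uniq (endpoints es).
Proof.
suff -> : uniq (endpoints es) = uniq ([seq e.1 | e <- es] ++ [seq e.2 | e <- es]) by [].
apply: perm_uniq; elim: es => [//|e es IH].
rewrite /endpoints /= -/(endpoints es) perm_cons perm_sym.
by rewrite -[_ :: [seq _ | _ <- es]]cat1s perm_catCA /= perm_cons perm_sym.
Qed.

Lemma uniq_half_edges p : uniq (endpoints (half_edges p)).
Proof.
apply: uniq_endpoints.
have ufil : uniq [seq i : 'I_(N - h) <- enum 'I_(N - h) | odd (i %/ h) == p].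
  by rewrite filter_uniq ?enum_uniq.
rewrite cat_uniq -!map_comp; apply/and3P; split.
- by rewrite map_inj_uniq// => i j /= [ij]; exact: val_inj.
- apply/hasPn => x /mapP[j]; rewrite mem_filter => /andP[/eqP jp _] ->.
  apply/mapP => -[i]; rewrite mem_filter => /andP[/eqP ip _].
  move=> /(congr1 val) /= E; move: ip; rewrite -E addnC.
  by rewrite -[X in (X + _)%N]mul1n divnMDl// oddD jp; case: (p).
- rewrite map_inj_uniq// => i j /= /(congr1 val) /= /eqP.
  by rewrite eqn_add2r => /eqP; exact: val_inj.
Qed.

Lemma sum_half_edges (F : 'I_N * 'I_N -> R) :
  \sum_(e <- half_edges true) F e + \sum_(e <- half_edges false) F e =
  \sum_(i < N - h) F (edge i).
Proof.
rewrite !big_map !big_filter !big_enum_cond /=.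
rewrite [RHS](bigID (fun i : 'I_(N - h) => odd (i %/ h))) /=.
by congr (_ + _); apply: eq_bigl => i; [rewrite eqb_id|rewrite eqbF_neg].
Qed.

Let sum_pick (x : 'I_N) (F : 'I_(N - h) -> 'I_N) : injective F ->
  \sum_i (x == F i)%:R <= 1 :> R.
Proof.
move=> Finj; have [/existsP[i0 /eqP xE]|no] := boolP [exists i, x == F i].
  rewrite (bigD1 i0)//= xE eqxx big1 ?addr0// => i ii0.
  by rewrite (inj_eq Finj) eq_sym (negbTE ii0).
rewrite big1// => i _; apply/eqP; rewrite pnatr_eq0 eqb0.
by apply: contraNN no => xi; apply/existsP; exists i.
Qed.

Let edge1_inj : injective (fun i => (edge i).1).
Proof. by move=> i j [ij]; exact: val_inj. Qed.

Let edge2_inj : injective (fun i => (edge i).2).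
Proof.
move=> i j /(congr1 val) /= /eqP; rewrite eqn_add2r => /eqP; exact: val_inj.
Qed.

Lemma sum_edge1_le (F : 'I_N -> R) : (forall x, 0 <= F x) ->
  \sum_i F (edge i).1 <= \sum_x F x.
Proof.
move=> F0; have -> : \sum_i F (edge i).1 = \sum_x F x * \sum_i (x == (edge i).1)%:R.
  under [RHS]eq_bigr do rewrite mulr_sumr; rewrite exchange_big.
  apply: eq_bigr => i _; rewrite (bigD1 (edge i).1)//= eqxx mulr1 big1 ?addr0//.
  by move=> x /negbTE ->; rewrite mulr0.
apply: ler_sum => x _; rewrite -[leRHS]mulr1 ler_wpM2l//; exact: sum_pick.
Qed.

Lemma sum_edge2_le (F : 'I_N -> R) : (forall x, 0 <= F x) ->
  \sum_i F (edge i).2 <= \sum_x F x.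
Proof.
move=> F0; have -> : \sum_i F (edge i).2 = \sum_x F x * \sum_i (x == (edge i).2)%:R.
  under [RHS]eq_bigr do rewrite mulr_sumr; rewrite exchange_big.
  apply: eq_bigr => i _; rewrite (bigD1 (edge i).2)//= eqxx mulr1 big1 ?addr0//.
  by move=> x /negbTE ->; rewrite mulr0.
apply: ler_sum => x _; rewrite -[leRHS]mulr1 ler_wpM2l//; exact: sum_pick.
Qed.

(** Each edge occurs once above the diagonal and once, transposed, below it; [0 < h] keeps the two
    occurrences apart. *)
Lemma bform_lag (u : 'I_N -> R) :
  bform (fun i j : 'I_N => (`|j%:Z - i%:Z|%N == h)%:R) u u =
  2 * \sum_i u (edge i).1 * u (edge i).2.
Proof.
pose D (i j : 'I_N) : R := \sum_k ((edge k).1 == i)%:R * ((edge k).2 == j)%:R.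
have DE i j : D i j = ((j : nat) == (i + h)%N)%:R.
  rewrite /D; have [jih|jih] := eqVneq (j : nat) (i + h)%N.
    have iN : (i < N - h)%N by rewrite ltn_subRL addnC -jih.
    pose k0 := Ordinal iN.
    have e1 : (edge k0).1 == i by apply/eqP/val_inj.
    have e2 : (edge k0).2 == j by apply/eqP/val_inj; rewrite /= jih.
    rewrite (big_only1 k0) ?e1 ?e2 ?mulr1// => k kk _.
    rewrite (_ : ((edge k).1 == i) = false) ?mul0r//; apply/negbTE.
    apply: contraNneq kk => E; apply/eqP/edge1_inj.
    by rewrite E (eqP e1).
  rewrite big1// => k _; have [ki|] := eqVneq (edge k).1 i; last by rewrite mul0r.
  have [kj|] := eqVneq (edge k).2 j; last by rewrite mulr0.
  by move: jih; rewrite -kj -ki eqxx.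
have DS (w : 'I_N -> 'I_N -> R) : \sum_i \sum_j w i j * D i j =
    \sum_k w (edge k).1 (edge k).2.
  transitivity (\sum_k \sum_i \sum_j w i j * (((edge k).1 == i)%:R * ((edge k).2 == j)%:R)).
    rewrite [RHS]exchange_big; apply: eq_bigr => i _ /=.
    by rewrite [RHS]exchange_big; apply: eq_bigr => j _ /=; rewrite mulr_sumr.
  apply: eq_bigr => k _; rewrite (big_only1 (edge k).1)//; last first.
    move=> i /negbTE ik _; rewrite big1// => j _.
    by rewrite [_ == i]eq_sym ik mul0r mulr0.
  rewrite (big_only1 (edge k).2) ?eqxx ?mulr1// => j /negbTE jk _.
  by rewrite [_ == j]eq_sym jk !mulr0.
have lagE (i j : 'I_N) : (`|j%:Z - i%:Z|%N == h)%:R = D i j + D j i.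
  rewrite !DE -natrD; congr (_%:R).
  have [ij|ji] := leqP i j.
    rewrite (_ : (i : nat) == j + h = false)%N; last first.
      by apply/negbTE; rewrite neq_ltn (leq_ltn_trans ij)// -addn1 leq_add2l.
    by rewrite addn0 distnEl// -(eqn_add2l i) subnKC.
  rewrite (_ : (j : nat) == i + h = false)%N; last first.
    by apply/negbTE; rewrite neq_ltn (ltn_trans ji)// -addn1 leq_add2l.
  by rewrite add0n distnEr ?(ltnW ji)// -(eqn_add2l j) subnKC ?(ltnW ji).
rewrite /bform.
transitivity (\sum_i \sum_j (u i * u j * D i j + u i * u j * D j i)).
  apply: eq_bigr => i _; rewrite /dotp mulr_sumr; apply: eq_bigr => j _.
  by rewrite lagE; ring.
under eq_bigr do rewrite big_split; rewrite big_split /= DS.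
rewrite [X in _ + X]exchange_big /= DS mulr_natl mulr2n; congr (_ + _).
by apply: eq_bigr => k _; rewrite mulrC.
Qed.

End edges.

Section qform_facts.
Context {R : realType} {N : nat}.
Implicit Types (A : seq ('I_N -> R)) (u : 'I_N -> R).

Lemma qform_cat A B u : qform (A ++ B) u = qform A u + qform B u.
Proof. by rewrite /qform big_cat. Qed.

Lemma qform_matching sa rho es u : qform (matching_cols sa rho es) u =
  \sum_(e <- es) sa ^+ 2 *
    (u e.1 ^+ 2 + 2 * rho * (u e.1 * u e.2) + (1 + rho ^+ 2) * u e.2 ^+ 2).
Proof.
elim: es => [|e es IH]; first by rewrite /qform !big_nil.
rewrite big_cons -IH /matching_cols /= -/(matching_cols sa rho es).
rewrite /qform !big_cons -/(qform _ _) !dotpZr dotpDr dotpZr !dotp_basisr.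
by rewrite addrA; congr (_ + _); ring.
Qed.

Lemma bformDm (M M' : 'I_N -> 'I_N -> R) u :
  bform (fun i j => M i j + M' i j) u u = bform M u u + bform M' u u.
Proof.
rewrite /bform -big_split; apply: eq_bigr => i _ /=.
by rewrite dotpDr mulrDr.
Qed.

Lemma bformZm (c : R) (M : 'I_N -> 'I_N -> R) u :
  bform (fun i j => c * M i j) u u = c * bform M u u.
Proof.
by rewrite /bform mulr_sumr; apply: eq_bigr => i _; rewrite dotpZr mulrCA.
Qed.

Lemma bform_diag (D : 'I_N -> R) u :
  bform (fun i j => D i * (i == j)%:R) u u = \sum_i D i * u i ^+ 2.
Proof.
apply: eq_bigr => i _; rewrite dotpZr.
have -> : dotp u (fun j => (i == j)%:R) = u i.
  rewrite -[RHS](dotp_basisr u i); congr dotp; apply: funext => j.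
  by rewrite /basis_fun eq_sym.
by rewrite expr2 mulrCA.
Qed.

End qform_facts.

(** * Splitting the covariance into a common part and edge pairs *)

Section spectral_perturbation.
Context {R : realType} {N h : nat} (f : R -> R) (fmin eps : R).
Local Notation I := (`[(- pi)%R, (pi : R)]%classic).
Local Notation v := (@gam_pow2 R).
Hypotheses (h0 : (0 < h)%N) (fmin0 : 0 < fmin)
  (fi : (@lebesgue_measure R).-integrable I (EFin \o f))
  (f_ge : forall x, x \in `[- pi, pi] -> fmin <= f x)
  (eps0 : 0 <= eps) (eps_le : eps <= 2 * pi * fmin / 3).

Local Notation a := (2 * pi * fmin / 3).
Local Notation rho := (eps / a).

Let a0 : 0 < a.
Proof. by rewrite !mulr_gt0 ?pi_gt0// invr_gt0. Qed.

Let autocovN (g : R -> R) k : autocov g (- k) = autocov g k.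
Proof. by apply: eq_Rintegral => x _; rewrite mulrNz mulNr cosN. Qed.

(* Every vertex lies in at most two edges, so the edges use at most
   [a + a (1 + rho ^ 2) <= 3 a = 2 pi fmin] of the diagonal. *)
Lemma perturbed_columns : 0 < v -> exists (B : seq ('I_N -> R)) sa, forall t A,
  t ^+ 2 = rho ^+ 2 ->
  (forall u, v * qform A u = bform (fun i j : 'I_N => autocov f (j%:Z - i%:Z)) u u +
     a * t * bform (fun i j : 'I_N => (`|j%:Z - i%:Z|%N == h)%:R) u u) ->
  forall u, qform A u =
    qform (B ++ matching_cols sa t (@half_edges N h true) ++
                matching_cols sa t (@half_edges N h false)) u.
Proof.
move=> v0.
have rho0 : 0 <= rho by rewrite divr_ge0// ltW.
have rho1 : rho <= 1 by rewrite ler_pdivrMr// mul1r.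
(* The part of the [i]-th diagonal entry that the edges at [i] consume: [a] as a first endpoint,
   [a * (1 + rho ^+ 2)] as a second one. *)
pose d (i : 'I_N) : R := \sum_(k < N - h)
  (a * ((edge k).1 == i)%:R + a * (1 + rho ^+ 2) * ((edge k).2 == i)%:R).
have dE u : \sum_i d i * u i ^+ 2 = \sum_(k < N - h)
    (a * u (edge k).1 ^+ 2 + a * (1 + rho ^+ 2) * u (edge k).2 ^+ 2).
  under eq_bigr do rewrite mulr_suml; rewrite exchange_big; apply: eq_bigr => k _ /=.
  under eq_bigr do rewrite mulrDl; rewrite big_split /=; congr (_ + _).
    rewrite (big_only1 (edge k).1) ?eqxx ?mulr1// => i ik _.
    by rewrite [_ == i]eq_sym (negbTE ik) mulr0 mul0r.
  rewrite (big_only1 (edge k).2) ?eqxx ?mulr1// => i ik _.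
  by rewrite [_ == i]eq_sym (negbTE ik) mulr0 mul0r.
(* The covariance left to the common vector, in units of [v] because [qform] is. It involves no
   sign, so the same [B] serves both perturbations. *)
pose M (i j : 'I_N) := v^-1 * (autocov f (j%:Z - i%:Z) + (-1) * (d i * (i == j)%:R)).
have ME u : bform M u u = v^-1 *
    (bform (fun i j : 'I_N => autocov f (j%:Z - i%:Z)) u u - \sum_i d i * u i ^+ 2).
  by rewrite /M bformZm bformDm bformZm bform_diag mulN1r.
have [||B BE] := @psd_qform _ _ M.
- move=> i j; rewrite /M -autocovN opprB; congr (_ * (_ + _ * _)).
  by rewrite [j == i]eq_sym; have [->|] := eqVneq i j; rewrite ?mulr0.
- move=> u; rewrite ME mulr_ge0 ?invr_ge0 ?(ltW v0)// subr_ge0.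
  apply: le_trans (toeplitz_ge u fi f_ge); rewrite dE big_split /= -!mulr_sumr.
  have s0 : forall x, 0 <= u x ^+ 2 by move=> x; exact: sqr_ge0.
  have s1 := @sum_edge1_le R N h _ s0.
  have s2 := @sum_edge2_le R N h _ s0.
  have r2 : rho ^+ 2 <= 1 by rewrite exprn_ile1.
  have S0 : 0 <= \sum_x u x ^+ 2 by apply: sumr_ge0.
  rewrite [leRHS](_ : _ = a * (\sum_x u x ^+ 2) + a * 2 * (\sum_x u x ^+ 2)); last by field.
  apply: lerD; first by rewrite ler_wpM2l// ltW.
  apply: ler_pM => //.
  + by rewrite mulr_ge0 ?(ltW a0)// addr_ge0// sqr_ge0.
  + by apply: sumr_ge0 => x _; exact: sqr_ge0.
  + by rewrite ler_wpM2l ?(ltW a0)//; lra.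
(* In units of [v], this scale gives the first coordinate of an edge pair the variance [a]. *)
exists B, (Num.sqrt (a / v)) => t A t2 AE u.
have vN0 : v != 0 by rewrite gt_eqF.
apply: (mulfI vN0); rewrite AE !qform_cat BE ME !qform_matching sum_half_edges.
rewrite sqr_sqrtr; last exact: divr_ge0 (ltW a0) (ltW v0).
rewrite [X in _ + _ * X = _](bform_lag h0 u) dE.
rewrite [RHS]mulrDr mulVKf// -[in RHS]addrA; congr (_ + _).
rewrite [in RHS]addrC; apply/eqP; rewrite eq_sym subr_eq; apply/eqP.
rewrite mulrA !mulr_sumr -big_split; apply: eq_bigr => k _ /=.
set x := u _; set y := u _; set A0 := (2 * pi * fmin / 3); rewrite -/A0 -t2; by field.
Qed.

End spectral_perturbation.

(** * Comparison of the two laws for channels with finitely many outcomes *)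

Section channel_test.
Context {R : realType} {N h : nat} {K : finType} (f : R -> R) (fmin eps alpha : R).
Local Notation I := (`[(- pi)%R, (pi : R)]%classic).
Local Notation v := (@gam_pow2 R).
Hypotheses (h0 : (0 < h)%N) (N0 : (0 < N)%N) (fmin0 : 0 < fmin)
  (fi : (@lebesgue_measure R).-integrable I (EFin \o f))
  (f_ge : forall x, x \in `[- pi, pi] -> fmin <= f x)
  (eps0 : 0 <= eps) (eps_le : eps <= 2 * pi * fmin / 3).
Variable q : 'I_N -> K -> R -> R.
Hypotheses (alpha0 : 0 < alpha)
  (mq : forall i a, measurable_fun setT (q i a))
  (q0 : forall i a x, 0 <= q i a x) (q1 : forall i x, \sum_a q i a x = 1)
  (qp : forall i a x y, q i a x <= expR alpha * q i a y).

Local Notation rho := (eps / (2 * pi * fmin / 3)).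

(** Twice the bound of [matching_test], once per matching, the number of edges of each being bounded
    by [N - h]. *)
Definition test_error theta : R := 2 * (theta * ((N - h)%:R *
  (pair_const * Num.min (alpha ^+ 4) 1 * rho ^+ 2)) + 2 / theta).

Lemma test_error_ge0 theta : 0 < theta -> 0 <= test_error theta.
Proof.
move=> th0; have a4 : 0 <= alpha ^+ 4 by rewrite exprn_even_ge0.
have m0 : 0 <= Num.min (alpha ^+ 4) 1 by rewrite le_min a4 ler01.
apply: mulr_ge0 => //; apply: addr_ge0; last by rewrite divr_ge0// ltW.
apply: mulr_ge0; first exact: ltW.
apply: mulr_ge0 => //; apply: mulr_ge0; last exact: sqr_ge0.
exact: mulr_ge0 pair_const_ge0 m0.
Qed.

Lemma channel_test (Ap Am : seq ('I_N -> R)) (S : pred {ffun 'I_N -> K}) b theta :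
  (forall u, v * qform Ap u =
     bform (fun i j : 'I_N => autocov (f_plus f h eps) (j%:Z - i%:Z)) u u) ->
  (forall u, v * qform Am u =
     bform (fun i j : 'I_N => autocov (f_minus f h eps) (j%:Z - i%:Z)) u u) ->
  0 < theta ->
  (gint Ap (fun v => \sum_(k | S k) channel_prob q k v) b <=
   gint Am (fun v => \sum_(k | S k) channel_prob q k v) b + (test_error theta)%:E)%E.
Proof.
move=> ApE AmE th0; set G := (fun v => (\sum_(k | S k) channel_prob q k v)%E).
have a0 : 0 < 2 * pi * fmin / 3 :> R by rewrite !mulr_gt0 ?pi_gt0// invr_gt0.
have rho0 : 0 <= rho by rewrite divr_ge0// ltW.
have rho1 : rho <= 1 by rewrite ler_pdivrMr// mul1r.
have {}ApE u : v * qform Ap u = bform (fun i j : 'I_N => autocov f (j%:Z - i%:Z)) u u +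
    (2 * pi * fmin / 3) * rho * bform (fun i j : 'I_N => (`|j%:Z - i%:Z|%N == h)%:R) u u.
  rewrite ApE [_ * rho]mulrC divfK ?gt_eqF// -bformZm -bformDm.
  by congr (bform _ u u); apply: funext => i; apply: funext => j; exact: autocov_f_plus.
have {}AmE u : v * qform Am u = bform (fun i j : 'I_N => autocov f (j%:Z - i%:Z)) u u +
    (2 * pi * fmin / 3) * - rho * bform (fun i j : 'I_N => (`|j%:Z - i%:Z|%N == h)%:R) u u.
  rewrite AmE mulrN [_ * rho]mulrC divfK ?gt_eqF// -bformZm -bformDm.
  congr (bform _ u u); apply: funext => i; apply: funext => j.
  by rewrite mulNr; exact: autocov_f_minus.
(* If [v] were zero, so would be the covariance form at the first basis vector. The lag form
   vanishes there because [0 < h], which contradicts the Toeplitz lower bound. *)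
have v0 : 0 < v.
  rewrite lt_def gam_pow2_ge0 andbT; apply/eqP => vE.
  pose u := basis_fun (Ordinal N0) : 'I_N -> R.
  have := toeplitz_ge u fi f_ge; have := ApE u.
  rewrite [X in _ + _ * X](_ : _ = 0) ?mulr0 ?addr0; last first.
    rewrite /bform (big_only1 (Ordinal N0)); last first => //.
      by move=> i /negbTE ik _; rewrite /u /basis_fun ik mul0r.
    by rewrite dotp_basisl subrr absz0 eq_sym eqn0Ngt h0 mulr0.
  rewrite vE mul0r => <-.
  rewrite (big_only1 (Ordinal N0))//; last first.
    by move=> i /negbTE ik _; rewrite /u /basis_fun ik expr0n.
  rewrite /u /basis_fun eqxx expr1n mulr1 leNgt => /negP; apply.
  by rewrite !mulr_gt0 ?pi_gt0.
have [B [sa BE]] := @perturbed_columns R N h f fmin eps h0 fmin0 fi f_ge eps0 eps_le v0.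
have {}ApE := BE rho Ap erefl ApE.
have {}AmE := BE (- rho) Am (sqrrN _) AmE.
have mG : vmeasurable G.
  move=> d T w mw; rewrite /G; under eq_fun do rewrite -big_filter.
  apply: emeasurable_sum => k; exact: vmeasurable_channel_prob.
have G0 c : (0 <= G c)%E by apply: sume_ge0 => k _; exact: channel_prob_ge0.
pose e := theta * ((N - h)%:R * (pair_const * Num.min (alpha ^+ 4) 1 * rho ^+ 2)) + 2 / theta.
have e0 : 0 <= e by have := test_error_ge0 th0; rewrite /test_error pmulr_rge0.
have step p c : (gint (matching_cols sa rho (@half_edges N h p)) G c <=
    gint (matching_cols sa (- rho) (@half_edges N h p)) G c + e%:E)%E.
  have M := matching_test sa alpha0 mq q0 q1 qp S c rho0 rho1 (uniq_half_edges h0 p) th0.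
  apply: le_trans M _; apply: leeD2l; rewrite lee_fin lerD2r.
  apply: ler_wpM2l; first exact: ltW.
  apply: ler_wpM2r; last by rewrite ler_nat size_half_edges.
  have a4 : 0 <= alpha ^+ 4 by rewrite exprn_even_ge0.
  have m0 : 0 <= Num.min (alpha ^+ 4) 1 by rewrite le_min a4 ler01.
  apply: mulr_ge0; last exact: sqr_ge0.
  exact: mulr_ge0 pair_const_ge0 m0.
(* The matching being flipped stands last, so that the outer integral over [C] conditions on
   everything else. *)
have flip C p : (gint (C ++ matching_cols sa rho (@half_edges N h p)) G b <=
    gint (C ++ matching_cols sa (- rho) (@half_edges N h p)) G b + e%:E)%E.
  rewrite !gint_cat; apply: (@le_gint R _ C _ _ b e _ _ _ _ e0 (step p)).
  - exact: vmeasurable_gint.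
  - exact: vmeasurable_gint.
  - by move=> c; exact: gint_ge0.
  - by move=> c; exact: gint_ge0.
rewrite (gint_qform b mG G0 ApE) (gint_qform b mG G0 AmE) catA.
apply: le_trans (flip _ _) _.
(* Exchanging the two matchings leaves the covariance unchanged, hence the law, and brings the
   second one to the end. *)
rewrite (@gint_qform _ _ _ ((B ++ matching_cols sa (- rho) (@half_edges N h false)) ++
  matching_cols sa rho (@half_edges N h true)) _ b mG G0); last first.
  by move=> u; rewrite !qform_cat addrAC.
rewrite (@gint_qform _ _ (B ++ _) ((B ++ matching_cols sa (- rho) (@half_edges N h false)) ++
  matching_cols sa (- rho) (@half_edges N h true)) _ b mG G0); last first.
  by move=> u; rewrite !qform_cat addrA addrAC.
apply: le_trans (leeD2r _ (flip _ _)) _.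
rewrite -addeA -EFinD /test_error -/e; apply: leeD2l.
by rewrite lee_fin mulr_natl mulr2n.
Qed.

End channel_test.

(** * From finitely many outcomes to randomized tests *)

Section extension.
Context {R : realType} d (Y : measurableType d) (P Q : probability Y R).
Local Open Scope ereal_scope.

(** An inequality with an additive error is not inherited by differences of sets, so Dynkin systems
    do not apply; it does pass to monotone limits. The monotone class theorem for rings gives a
    sigma-ring, which is a sigma-algebra because it contains [setT]. *)
Lemma le_measure_extension (G : set (set Y)) (e : R) :
  setring G -> G setT -> G `<=` measurable ->
  measurable `<=` <<s G >> -> (forall A, G A -> P A <= Q A + e%:E) ->
  forall A, measurable A -> P A <= Q A + e%:E.
Proof.
move=> rG GT Gm mG PQ.
pose C : set (set Y) := [set A | measurable A /\ P A <= Q A + e%:E].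
have cvgl (F : (set Y)^nat) L : Q (F n) @[n --> \oo] --> Q L ->
    (fun n => Q (F n) + e%:E) @ \oo --> Q L + e%:E.
  by move=> FL; apply: cvgeD => //; [exact: fin_num_adde_defl|exact: cvg_cst].
have mC : monotone C.
  split=> F mF CF; have mFn n : measurable (F n) by have [] := CF n.
    have mU : measurable (\bigcup_n F n) by exact: bigcup_measurable.
    split=> //; have c1 := nondecreasing_cvg_mu (mu := P) mFn mU mF.
    have c2 := cvgl _ _ (nondecreasing_cvg_mu (mu := Q) mFn mU mF).
    rewrite -(cvg_lim _ c1)// -(cvg_lim _ c2)//; apply: lee_lim.
    - by apply/cvg_ex; eexists; exact: c1.
    - by apply/cvg_ex; eexists; exact: c2.
    - by near=> n; have [] := CF n.
  have mU : measurable (\bigcap_n F n) by exact: bigcap_measurable.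
  have fin (mu : probability Y R) : mu (F 0%N) < +oo.
    by rewrite -ge0_fin_numE// fin_num_measure.
  split=> //; have c1 := nonincreasing_cvg_mu (mu := P) (fin _) mFn mU mF.
  have c2 := cvgl _ _ (nonincreasing_cvg_mu (mu := Q) (fin _) mFn mU mF).
  rewrite -(cvg_lim _ c1)// -(cvg_lim _ c2)//; apply: lee_lim.
  - by apply/cvg_ex; eexists; exact: c1.
  - by apply/cvg_ex; eexists; exact: c2.
  - by near=> n; have [] := CF n.
have GC : G `<=` C by move=> A GA; split; [exact: Gm|exact: PQ].
have srC := monotone_setring_sub_g_sigma_ring mC rG GC.
have sG : <<s G >> `<=` <<sr G >>.
  have [s0 sD sU] := @smallest_sigma_ring _ G.
  apply: smallest_sub => [|A GA]; last exact: sub_g_sigma_ring.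
  split=> // A sA; apply: sD => //; exact: sub_g_sigma_ring.
by move=> A /mG /sG /srC[].
Unshelve. all: by end_near. Qed.

Lemma le_expectation (phi : {RV P >-> R}) (psi : {RV Q >-> R}) (e : R) :
  (phi : Y -> R) = psi -> (forall z, 0 <= phi z <= 1)%R -> (0 <= e)%R ->
  (forall A, measurable A -> P A <= Q A + e%:E) ->
  'E_P[phi] <= 'E_Q[psi] + e%:E.
Proof.
move=> phipsi phi01 e0 PQ.
rewrite !ge0_expectation_ccdf; last 2 first.
  by move=> z; rewrite -phipsi; have /andP[] := phi01 z.
  by move=> z; have /andP[] := phi01 z.
(* The error is charged on levels in [0, 1] only: above 1 the level sets of the test are empty. Its
   integral is therefore [e]. *)
pose u := cst e%:E \_ (`[0%R, 1%R] : set R).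
have u0 r : 0 <= u r by apply: erestrict_ge0 => x _; rewrite lee_fin.
have mu : measurable_fun setT u by apply/(measurable_restrictT _ _).1.
have uE : \int[lebesgue_measure]_(r in `[0%R, +oo[) u r = e%:E.
  rewrite -integral_mkcondr.
  have -> : (`[0%R, +oo[ `&` `[0%R, 1%R] = `[0%R, 1%R] :> set R)%classic.
    by apply/setIidPr => x /=; rewrite !in_itv/= => /andP[->].
  by rewrite integral_cst//= lebesgue_measure_itv/= lte01 oppr0 adde0 mule1.
rewrite -uE -ge0_integralD//=.
- apply: ge0_le_integral => //.
  + by apply/measurable_funTS; exact: ccdf_measurable.
  + apply: emeasurable_funD; apply/measurable_funTS => //; exact: ccdf_measurable.
  move=> r /=; rewrite in_itv/= andbT => r0.
  have [r1|r1] := leP r 1%R.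
    rewrite /u patchE mem_set/= ?in_itv/= ?r0//.
    rewrite /ccdf /distribution /pushforward -phipsi; apply: PQ.
    by rewrite -[X in measurable X]setTI; exact: measurable_funPT.
  rewrite [leLHS](_ : _ = 0); last first.
    rewrite /ccdf /distribution /pushforward (_ : _ @^-1` _ = set0) ?measure0//.
    rewrite -subset0 => z /=; rewrite in_itv/= andbT => /(lt_trans r1).
    by rewrite ltNge; have /andP[_ ->] := phi01 z.
  by rewrite adde_ge0.
- by apply/measurable_funTS; exact: ccdf_measurable.
- exact: measurable_funTS.
Qed.

End extension.

(** * Finite labelings of the output space *)

Section labels.
Context {R : realType} {N : nat} {alpha : R} (K : mechanisms N alpha).
Local Open Scope ereal_scope.

Definition labels (L : finType) (kappa : forall i, out K i -> L)
  (z : output_space K) : {ffun 'I_N -> L} := [ffun i => kappa i (z i)].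

(* The finite unions of rectangles. *)
Definition label_system : set (set (output_space K)) := [set E |
  exists (L : finType) (kappa : forall i, out K i -> L) (S : pred {ffun 'I_N -> L}),
    (forall i a, measurable (kappa i @^-1` [set a])) /\
    E = [set z | S (labels kappa z)]].

(** Two labelings are refined by their pairs of labels, from which any Boolean combination of the
    two events can be read. *)
Lemma setring_label_system : setring label_system.
Proof.
have bin (op : bool -> bool -> bool) A B : label_system A -> label_system B ->
    exists2 E, label_system E & forall z, E z <-> op `[< A z >] `[< B z >].
  move=> [L1 [k1 [S1 [m1 ->]]]] [L2 [k2 [S2 [m2 ->]]]].
  exists [set z | op (S1 (labels k1 z)) (S2 (labels k2 z))]; last first.
    by move=> z; rewrite /= !asboolb.
  exists (L1 * L2)%type, (fun i y => (k1 i y, k2 i y)),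
    (fun l => op (S1 [ffun i => (l i).1]) (S2 [ffun i => (l i).2])); split.
    move=> i [a b].
    rewrite (_ : _ @^-1` _ = (k1 i @^-1` [set a]) `&` (k2 i @^-1` [set b])).
      exact: measurableI.
    by apply/seteqP; split => y /= [-> ->].
  apply/seteqP; split => z /=; congr (is_true (op (S1 _) (S2 _)));
    by apply/ffunP => i; rewrite !ffunE.
split.
- exists unit, (fun _ _ => tt), xpred0; split.
    by move=> i [] /=; rewrite (_ : _ @^-1` _ = setT)//; apply/seteqP; split.
  by apply/seteqP; split.
- move=> A B /(bin orb) H /H [E EL EE]; rewrite (_ : A `|` B = E)//.
  by apply/predeqP => z; rewrite EE -asbool_or asboolE.
- move=> A B /(bin (fun a b => a && ~~ b)) H /H [E EL EE].
  rewrite (_ : A `\` B = E)//.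
  by apply/predeqP => z; rewrite EE -asbool_neg -asbool_and asboolE.
Qed.

Lemma label_systemT : label_system setT.
Proof.
exists unit, (fun _ _ => tt), xpredT; split; last by apply/seteqP.
by move=> i [] /=; rewrite (_ : _ @^-1` _ = setT)//; apply/seteqP; split.
Qed.

Lemma measurable_rectangle (S : forall i, set (out K i)) :
  (forall i, measurable (S i)) ->
  measurable [set z : output_space K | forall i, S i (z i)].
Proof.
move=> mS; rewrite (_ : [set z | _] =
    \bigcap_(i in [set: 'I_N]) [set z : output_space K | S i (z i)]); last first.
  by apply/seteqP; split => z /= H i // => [_|]; exact: H.
apply: fin_bigcap_measurable => // i _; apply: sub_sigma_algebra.
by exists i => //; exists (S i) => //; rewrite setTI.
Qed.

Let fiber (L : finType) (kappa : forall i, out K i -> L) (k : {ffun 'I_N -> L}) :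
  set (output_space K) := [set z | forall i, (kappa i @^-1` [set k i]) (z i)].

Let fiberE (L : finType) (kappa : forall i, out K i -> L) k z :
  fiber kappa k z <-> labels kappa z = k.
Proof.
split => [H|<- i /=]; last by rewrite ffunE.
by apply/ffunP => i; rewrite ffunE; exact: H.
Qed.

Let indic_labels (L : finType) (kappa : forall i, out K i -> L)
    (S : pred {ffun 'I_N -> L}) z :
  \1_[set z | S (labels kappa z)] z = (\sum_(k | S k) \1_(fiber kappa k) z)%R :> R.
Proof.
rewrite indicE; have [Sz|Sz] := boolP (S (labels kappa z)).
  rewrite mem_set//= (bigD1 (labels kappa z))//= indicE mem_set; last exact/fiberE.
  rewrite big1 ?addr0// => k /andP[_ kz]; rewrite indicE memNset//.
  by move=> /fiberE E; move: kz; rewrite E eqxx.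
rewrite memNset /=; last exact/negP.
rewrite big1// => k Sk; rewrite indicE memNset// => /fiberE E.
by move: Sz; rewrite E Sk.
Qed.

Lemma label_system_measurable : label_system `<=` measurable.
Proof.
move=> E [L [kappa [S [mk ->]]]].
rewrite (_ : [set z | _] = \big[setU/set0]_(k | S k) fiber kappa k).
  by apply: bigsetU_measurable => k _; exact: (measurable_rectangle (fun i => mk i (k i))).
rewrite -bigcup_seq_cond; apply/seteqP; split => z /=.
  by move=> Sz; exists (labels kappa z) => /=; [rewrite mem_index_enum|exact/fiberE].
by move=> [k /= /andP[_ Sk] /fiberE ->].
Qed.

Lemma measurable_sub_label_system :
  @measurable _ (output_space K) `<=` <<s label_system >>.
Proof.
apply: smallest_sub; first exact: smallest_sigma_algebra.
move=> _ [i0 _ [B mB <-]]; rewrite setTI; apply: sub_sigma_algebra.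
pose S := @dfwith 'I_N (fun i => set (out K i)) (fun=> setT) i0 B.
exists bool, (fun i y => `[< S i y >]), (fun k : {ffun 'I_N -> bool} => k i0); split.
  move=> i a.
  have mS : measurable (S i) by rewrite /S; case: dfwithP.
  case: a.
    rewrite (_ : _ @^-1` _ = S i)//.
    by apply/seteqP; split => y /= /asboolP.
  rewrite (_ : _ @^-1` _ = ~` S i); first exact: measurableC.
  by apply/seteqP; split => y /= => [/asboolPn|/asboolPn/negbTE].
apply/seteqP; split => z /=; rewrite ffunE /S dfwithin => /asboolP//.
Qed.

(** The mechanism followed by the labeling: post-processing preserves privacy and leaves finitely
    many outcomes. *)
Definition cell_prob (L : finType) (kappa : forall i, out K i -> L) i a x : R :=
  fine (mech K i x (kappa i @^-1` [set a])).

Section cells.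
Context (L : finType) (kappa : forall i, out K i -> L).
Hypothesis mk : forall i a, measurable (@kappa i @^-1` [set a]).

Lemma cell_probE i a x :
  (cell_prob (@kappa) i a x)%:E = mech K i x (@kappa i @^-1` [set a]).
Proof.
rewrite /cell_prob fineK// ge0_fin_numE//.
apply: (@le_lt_trans _ _ (mech K i x setT)); last by rewrite prob_kernel ltry.
by apply: le_measure; rewrite ?inE.
Qed.

Lemma measurable_cell_prob i a : measurable_fun setT (cell_prob (@kappa) i a).
Proof. by apply: measurableT_comp => //; exact: measurable_kernel. Qed.

Lemma cell_prob_ge0 i a x : (0 <= cell_prob (@kappa) i a x)%R.
Proof. exact: fine_ge0. Qed.

Lemma sum_cell_prob i x : (\sum_a cell_prob (@kappa) i a x = 1)%R.
Proof.
apply: EFin_inj; rewrite -sumEFin; under eq_bigr do rewrite cell_probE.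
transitivity (\sum_a \int[mech K i x]_y (\1_(@kappa i @^-1` [set a]) y)%:E).
  by apply: eq_bigr => a _; rewrite integral_indic ?setIT.
rewrite -ge0_integral_sum//; last first.
  by move=> a; apply/measurable_EFinP; exact: measurable_indic.
transitivity (\int[mech K i x]_(y in setT) (cst 1%E y)); last first.
  by rewrite integral_cst// mul1e; exact: prob_kernel.
apply: eq_integral => y _; rewrite sumEFin; congr EFin.
rewrite (big_only1 (kappa y)) ?indicE ?mem_set// => a /eqP ay _.
by rewrite indicE memNset// => /= E; apply: ay.
Qed.

Lemma private_cell_prob i a x y :
  (cell_prob (@kappa) i a x <= expR alpha * cell_prob (@kappa) i a y)%R.
Proof.
by rewrite -lee_fin EFinM !cell_probE; exact: mech_private.
Qed.

End cells.

Section view.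
Context d (T : measurableType d) (P : probability T R)
  (X : int -> {RV P >-> R}) (Z : {RV P >-> output_space K}).
Hypothesis XZ : privatized_view X Z.

Lemma privatized_view_labels (L : finType) (kappa : forall i, out K i -> L)
    (S : pred {ffun 'I_N -> L}) :
  (forall i a, measurable (kappa i @^-1` [set a])) ->
  P (Z @^-1` [set z | S (labels kappa z)]) =
  \int[P]_w (fun v => \sum_(k | S k) channel_prob (cell_prob kappa) k v)
    (fun i : 'I_N => X i.+1%:Z w).
Proof.
move=> mk; set E := [set z | _].
have mE : measurable E.
  by apply: label_system_measurable; exists L, kappa, S.
have mf k : measurable (fiber kappa k) by exact: (measurable_rectangle (fun i => mk i (k i))).
have mZ A : measurable A -> measurable (Z @^-1` A).
  by move=> mA; rewrite -[X in measurable X]setTI; exact: measurable_funPT.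
transitivity (\int[P]_w (\1_(Z @^-1` E) w)%:E).
  by rewrite integral_indic ?setIT//; exact: mZ.
transitivity (\int[P]_w \sum_(k | S k) (\1_(Z @^-1` fiber kappa k) w)%:E).
  by apply: eq_integral => w _; rewrite sumEFin; congr EFin; exact: indic_labels.
have mS (s : seq {ffun 'I_N -> L}) (D : set T) (F : {ffun 'I_N -> L} -> T -> \bar R) :
    (forall k, measurable_fun D (F k)) -> (forall k w, 0 <= F k w) -> measurable D ->
  \int[P]_(w in D) \sum_(k <- s | S k) F k w = \sum_(k <- s | S k) \int[P]_(w in D) F k w.
  move=> mF F0 mD; under eq_integral do rewrite -big_filter.
  by rewrite ge0_integral_sum// big_filter.
rewrite !mS//.
- apply: eq_bigr => k _; rewrite integral_indic ?setIT//; last exact: mZ.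
  have s0 : sigma_process X setT.
    rewrite -[setT]setD0; apply: sigma_algebraCD; exact: sigma_algebra0.
  have H := XZ s0 (fun i => mk i (k i)); rewrite setTI in H; apply: (etrans H).
  apply: eq_integral => w _; rewrite /channel_prob -prodEFin.
  apply: eq_bigr => i _; exact/esym/cell_probE.
- move=> k; apply: (vmeasurable_channel_prob (measurable_cell_prob mk)) => i.
  exact: measurable_funPT.
- by move=> k w; apply: channel_prob_ge0 => *; exact: cell_prob_ge0.
- by move=> k; apply/measurable_EFinP; apply: measurable_indic; exact: mZ.
Qed.

End view.

End labels.

(** * Comparison of randomized tests *)

Section testing.
Context {R : realType} {N h : nat} {alpha : R} (K : mechanisms N alpha)
  (f : R -> R) (fmin eps : R).
Local Notation I := (`[(- pi)%R, (pi : R)]%classic).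
Hypotheses (h0 : (0 < h)%N) (N0 : (0 < N)%N) (fmin0 : 0 < fmin)
  (fi : (@lebesgue_measure R).-integrable I (EFin \o f))
  (f_ge : forall x, x \in `[- pi, pi] -> fmin <= f x)
  (eps0 : 0 <= eps) (eps_le : eps <= 2 * pi * fmin / 3) (alpha0 : 0 < alpha).
Context d (T : measurableType d) (P : probability T R) (X : int -> {RV P >-> R})
  (Z : {RV P >-> output_space K})
  d' (T' : measurableType d') (P' : probability T' R) (X' : int -> {RV P' >-> R})
  (Z' : {RV P' >-> output_space K}).
Hypotheses (gX : gaussian_process X) (cX : centered X) (sX : stationary X)
  (fX : has_spectral_density X (f_plus f h eps)) (XZ : privatized_view X Z)
  (gX' : gaussian_process X') (cX' : centered X') (sX' : stationary X')
  (fX' : has_spectral_density X' (f_minus f h eps)) (XZ' : privatized_view X' Z').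

(** The two realizations live on unrelated probability spaces, since the risk takes a separate
    infimum over realizations for each sign. Only the two laws of the outputs are compared. *)
Lemma private_test_error (phi : output_space K -> R) theta :
  randomized_test K phi -> 0 < theta ->
  ('E_P[phi \o Z] <= 'E_P'[phi \o Z'] + (@test_error R N h fmin eps alpha theta)%:E)%E.
Proof.
move=> [mphi phi01] th0.
have e0 := @test_error_ge0 R N h fmin eps alpha theta th0.
have [A [AE Aq]] := spectral_gint N gX cX sX fX.
have [A' [A'E A'q]] := spectral_gint N gX' cX' sX' fX'.
pose PZ : probability (output_space K) R := distribution P Z.
pose PZ' : probability (output_space K) R := distribution P' Z'.
set e := test_error _ _ _ _ in e0 *.
have laws : forall B, measurable B -> (PZ B <= PZ' B + e%:E)%E.
  apply: (@le_measure_extension R _ (output_space K) PZ PZ' (@label_system R N alpha K) e).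
  - exact: setring_label_system.
  - exact: label_systemT.
  - exact: label_system_measurable.
  - exact: measurable_sub_label_system.
  - move=> _ [L [kappa [S [mk ->]]]].
    pose G v := (\sum_(k | S k) channel_prob (cell_prob kappa) k v)%E.
    have mq i a : measurable_fun setT (cell_prob kappa i a) by exact: measurable_cell_prob.
    have q0 i a x : 0 <= cell_prob kappa i a x by exact: cell_prob_ge0.
    have mG : vmeasurable G.
      move=> d0 T0 w mw; rewrite /G; under eq_fun do rewrite -big_filter.
      apply: emeasurable_sum => k; exact: vmeasurable_channel_prob.
    have G0 c : (0 <= G c)%E by apply: sume_ge0 => k _; exact: channel_prob_ge0.
    have E1 : PZ [set z | S (labels kappa z)] = gint A G (fun=> 0).
      exact: etrans (privatized_view_labels XZ S mk) (AE G mG G0).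
    have E2 : PZ' [set z | S (labels kappa z)] = gint A' G (fun=> 0).
      exact: etrans (privatized_view_labels XZ' S mk) (A'E G mG G0).
    rewrite E1 E2; apply: (channel_test h0 N0 fmin0 fi f_ge eps0 eps_le alpha0) => //.
    + exact: sum_cell_prob.
    + exact: private_cell_prob.
have phim : phi \in (mfun : {pred output_space K -> R}) by exact: mem_set.
pose phi1 : {RV PZ >-> R} := mfun_Sub phim.
pose phi2 : {RV PZ' >-> R} := mfun_Sub phim.
have := @le_expectation _ _ _ PZ PZ' phi1 phi2 e erefl phi01 e0 laws.
rewrite !expectation_def => le12; rewrite unlock.
have mphiE : measurable_fun setT (fun z => (phi z)%:E) by exact/measurable_EFinP.
have phi0 z : (0 <= (phi z)%:E)%E by rewrite lee_fin; have /andP[] := phi01 z.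
have E1 : (\int[PZ]_z (phi z)%:E = \int[P]_w (phi (Z w))%:E)%E.
  exact: ge0_integral_distribution.
have E2 : (\int[PZ']_z (phi z)%:E = \int[P']_w (phi (Z' w))%:E)%E.
  exact: ge0_integral_distribution.
by move: le12; rewrite [X in (X <= _)%E]E1 [X in (_ <= X + _)%E]E2.
Qed.

End testing.

(** * The separation rate and the choice of the constant *)

Lemma eps_low_ge0 {R : realType} (c alpha : R) N h : 0 <= c -> 0 <= eps_low c alpha N h.
Proof. by move=> c0; rewrite mulr_ge0// le_min ler01 powR_ge0. Qed.

Lemma eps_low_le {R : realType} (c alpha : R) N h : 0 <= c -> eps_low c alpha N h <= c.
Proof. by move=> c0; rewrite -[leRHS]mulr1 ler_wpM2l// ge_min lexx. Qed.

Lemma eps_low_sqr_le {R : realType} (c alpha : R) N h : 0 <= c ->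
  0 < Num.min (alpha ^+ 4) 1 * (N - h)%:R ->
  Num.min (alpha ^+ 4) 1 * (N - h)%:R * eps_low c alpha N h ^+ 2 <= c ^+ 2.
Proof.
move=> c0; rewrite /eps_low; set y := _ * _ => y0.
rewrite exprMn mulrCA -[leRHS]mulr1; apply: ler_wpM2l; first exact: sqr_ge0.
have p0 : 0 <= y `^ (- 2^-1) by exact: powR_ge0.
have m0 : 0 <= Num.min 1 (y `^ (- 2^-1)) by rewrite le_min ler01.
apply: (@le_trans _ _ (y * (y `^ (- 2^-1)) ^+ 2)).
  by rewrite ler_pM2l// ler_pXn2r// ge_min lexx orbT.
rewrite powRN powR12_sqrt ?(ltW y0)// exprVn sqr_sqrtr ?(ltW y0)//.
by rewrite mulfV// gt_eqF.
Qed.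

Theorem proposition5 (R : realType) (r fmin : R)
    (hr : 0 < r < 1 / 2) (hfmin : 0 < fmin) :
  (forall (h : nat) (f : R -> R), (1 <= h)%N -> spectral_density f ->
     (forall x, x \in `[- pi, pi] -> fmin <= f x) ->
     forall eps : R, 0 < eps <= pi * fmin ->
       spectral_density (f_plus f h eps) /\
       spectral_density (f_minus f h eps)) /\
  exists c : R, 0 < c <= pi * fmin /\
    forall (h : nat) (f : R -> R), (1 <= h)%N -> spectral_density f ->
    (forall x, x \in `[- pi, pi] -> fmin <= f x) ->
    forall (N : nat) (alpha : R), (h.+1 <= N)%N -> 0 < alpha ->
      (r%:E <=
       ereal_inf [set e | exists K : mechanisms N alpha,
         e = ereal_inf [set testing_risk K f h (eps_low c alpha N h) phi
                          | phi in randomized_test K]])%E.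
Proof.
split; first by move=> h f _ sf f_ge eps; exact: spectral_density_perturbed.
have /andP[r0 r12] := hr.
pose a := 2 * pi * fmin / 3.
have a0 : 0 < a by rewrite !mulr_gt0 ?pi_gt0// invr_gt0.
(* A test with both errors below [r] would have expectations more than [delta] apart under the two
   laws. *)
pose delta := 1 - 2 * r.
have delta0 : 0 < delta by rewrite /delta; lra.
have pc0 : 0 <= pair_const :> R := pair_const_ge0.
(* With c = a s, the correlation [eps / a] is at most [s]. This [s] is at most one and satisfies the
   two bounds needed below, whatever the value of [pair_const]. *)
pose s := delta / (32 * (pair_const + 1)).
have s0 : 0 < s by rewrite divr_gt0// mulr_gt0//; lra.
have s1 : s <= 1 by rewrite ler_pdivrMr ?mulr_gt0//; rewrite /delta; lra.
have ps : pair_const * s ^+ 2 <= delta ^+ 2 / 32.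
  have -> : delta = s * (32 * (pair_const + 1)) by rewrite /s divfK// gt_eqF//; lra.
  rewrite [leRHS](_ : _ = 32 * (pair_const + 1) ^+ 2 * s ^+ 2); last by field.
  by apply: ler_wpM2r; [exact: sqr_ge0|nra].
have c0 : 0 < a * s by exact: mulr_gt0.
have ca : a * s <= a by rewrite -[leRHS]mulr1 ler_pM2l.
exists (a * s); split.
  rewrite c0 (le_trans ca)// /a.
  have : 0 < pi * fmin by rewrite mulr_gt0// pi_gt0.
  by rewrite -mulrA; lra.
move=> h f h0 [f0 fi fev] f_ge N alpha hN alpha0.
set eps := eps_low _ _ _ _.
have N0 : (0 < N)%N by exact: leq_trans hN.
have eps0 : 0 <= eps := eps_low_ge0 _ _ _ (ltW c0).
have eps_le : eps <= a := le_trans (eps_low_le _ _ _ (ltW c0)) ca.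
(* Both terms of [test_error theta] are at most [delta / 2]. *)
pose theta := 8 / delta.
have th0 : 0 < theta by rewrite divr_gt0.
have err : @test_error R N h fmin eps alpha theta <= delta.
  have m0 : 0 < Num.min (alpha ^+ 4) 1 by rewrite lt_min exprn_gt0 ?ltr01.
  have y0 : 0 < Num.min (alpha ^+ 4) 1 * (N - h)%:R.
    by rewrite mulr_gt0// ltr0n subn_gt0.
  have := eps_low_sqr_le (ltW c0) y0; rewrite -/eps /test_error -/a => le_sqr.
  set x := (N - h)%:R * _; have xle : x <= delta ^+ 2 / 32.
    apply: le_trans ps; rewrite /x.
    rewrite [leLHS](_ : _ = pair_const *
      (Num.min (alpha ^+ 4) 1 * (N - h)%:R * eps ^+ 2 / a ^+ 2)).
      by rewrite ler_wpM2l// ler_pdivrMr ?exprn_gt0// [leRHS]mulrC -exprMn.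
    by field; rewrite gt_eqF.
  rewrite /theta invf_div.
  have : 8 / delta * x <= 8 / delta * (delta ^+ 2 / 32) by rewrite ler_wpM2l// ltW.
  rewrite (_ : 8 / delta * (delta ^+ 2 / 32) = delta / 4); last first.
    by field; rewrite gt_eqF.
  by lra.
apply: le_ereal_inf_tmp => _ [K ->]; apply: le_ereal_inf_tmp => _ [phi rphi <-].
rewrite leNgt gt_max; apply/negP => /andP[].
(* A value above an infimum is undercut by an actual realization: a risk below [r] provides one for
   each sign, with error below [r]. *)
move=> /ereal_inf_lt[_ [d' [T' [P' [X' [Z' [[gX' cX' sX' fX'] [XZ' ->]]]]]]] lt'].
move=> /ereal_inf_lt[_ [d [T [P [X [Z [[gX cX sX fX] [XZ ->]]]]]]] lt].
have le := private_test_error h0 N0 hfmin fi f_ge eps0 eps_le alpha0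
  gX cX sX fX XZ gX' cX' sX' fX' XZ' rphi th0.
have [mphi phi01] := rphi.
have E1 : ('E_P[phi \o Z] + 'E_P[(fun z => (1 - phi z)%R) \o Z] = 1)%E.
  have mZ : measurable_fun setT (phi \o Z).
    by apply: measurableT_comp => //; exact: measurable_funPT.
  rewrite unlock -ge0_integralD//=.
  - transitivity (\int[P]_w (cst 1%E w))%E; last first.
      by rewrite integral_cst// mul1e; exact: probability_setT.
    by apply: eq_integral => w _; rewrite -EFinD addrC subrK.
  - by move=> w _; rewrite lee_fin; have /andP[] := phi01 (Z w).
  - exact/measurable_EFinP.
  - by move=> w _; rewrite lee_fin subr_ge0; have /andP[] := phi01 (Z w).
  - by apply/measurable_EFinP; exact: measurable_funB.
have {}le : ('E_P[phi \o Z] < (r + delta)%:E)%E.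
  apply: le_lt_trans le _; rewrite EFinD; exact: lte_leD.
have := lteD le lt; rewrite E1 -EFinD lte_fin /delta; lra.
Qed.
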